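(* Lossy reachability in ABVASS$_{\vec 0}$ is in \textsc{Tower}. Moreover, for every fixed dimension $d$, lossy reachability restricted to ABVASS$_{\vec 0}$ of dimension $d$ is in \textsc{PTime} if $d=0$ and in $d$-\textsc{ExpTime} if $d\ge1$.
   Context: An ABVASS$_{\vec 0}$ is a tuple $\mathcal A=(Q,d,T_u,T_f,T_s,T_z)$ with $Q$ a finite set of states, $d\in\mathbb N$ the dimension, and finite sets of unary rules $T_u\subseteq Q\times\mathbb Z^d\times Q$, fork rules $T_f\subseteq Q^3$, split rules $T_s\subseteq Q^3$, full zero test rules $T_z\subseteq Q^2$. A deduction tree is a finite tree labelled by configurations $(q,\vec v)\in Q\times\mathbb N^d$ where each internal node $(q,\vec v)$ has: one child $(q_1,\vec v+\vec u)\in Q\times\mathbb N^d$ for a unary rule $(q,\vec u,q_1)$; two children $(q_1,\vec v),(q_2,\vec v)$ for a fork rule $(q,q_1,q_2)$; two children $(q_1,\vec v_1),(q_2,\vec v_2)$ with $\vec v_1+\vec v_2=\vec v$ for a split rule $(q,q_1,q_2)$; or, if $\vec v=\vec 0$, one child $(q_1,\vec 0)$ for a full zero test $(q,q_1)$. In a lossy deduction tree, additionally a node $(q,\vec v)$ may have a single child $(q,\vec v-\vec e_i)$ ($\vec e_i$ the $i$-th unit vector, $\vec v(i)\ge1$). Lossy reachability: given $\mathcal A,q_r,Q_\ell\subseteq Q$, is there a lossy deduction tree with root $(q_r,\vec 0)$ and leaves in $Q_\ell\times\{\vec 0\}$. Vectors in unary rules are encoded in binary. $\mathrm{tower}(0)=1$,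 $\mathrm{tower}(n+1)=2^{\mathrm{tower}(n)}$; \textsc{Tower} is the class of problems decidable in deterministic time $\mathrm{tower}(e(n))$ for some elementary function $e$; $d$-\textsc{ExpTime} is deterministic time bounded by a $d$-fold iterated exponential of a polynomial. *)

(* Defs.v *)
From HB Require Import structures.
From mathcomp Require Import all_boot all_order all_algebra.
Set Implicit Arguments. Unset Strict Implicit. Unset Printing Implicit Defensive.
Import Order.TTheory GRing.Theory Num.Theory.

(* States are 0 .. nQ-1, vectors are sequences of length abdim.          *)

Record instance := Instance {
  nQ   : nat;
  abdim  : nat;
  Tu   : seq (nat * seq int * nat);    (* unary rules (q, u, q1) *)
  Tf   : seq (nat * nat * nat);        (* fork rules (q, q1, q2) *)
  Ts   : seq (nat * nat * nat);        (* split rules (q, q1, q2) *)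
  Tz   : seq (nat * nat);              (* full zero tests (q, q1) *)
  qr   : nat;
  Ql   : seq nat
}.

Definition wf_instance (I : instance) : Prop :=
  [/\ all (fun r => [&& r.1.1 < nQ I, r.2 < nQ I & size r.1.2 == abdim I]) (Tu I),
      all (fun r => [&& r.1.1 < nQ I, r.1.2 < nQ I & r.2 < nQ I]) (Tf I),
      all (fun r => [&& r.1.1 < nQ I, r.1.2 < nQ I & r.2 < nQ I]) (Ts I),
      all (fun r => (r.1 < nQ I) && (r.2 < nQ I)) (Tz I) &
      qr I < nQ I /\ all (fun q => q < nQ I) (Ql I)].

Definition config := (nat * seq nat)%type.

Inductive dtree :=
| DLeaf of config
| DUn of config & dtree
| DBin of config & dtree & dtree.

Definition droot (t : dtree) : config :=
  match t with DLeaf c => c | DUn c _ => c | DBin c _ _ => c end.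

Fixpoint dleaves (t : dtree) : seq config :=
  match t with
  | DLeaf c => [:: c]
  | DUn _ t1 => dleaves t1
  | DBin _ t1 t2 => dleaves t1 ++ dleaves t2
  end.

Definition is_config (I : instance) (c : config) : Prop :=
  c.1 < nQ I /\ size c.2 = abdim I.

Definition zero_vec (I : instance) : seq nat := nseq (abdim I) 0%N.

Definition unary_step (I : instance) (c c1 : config) : Prop :=
  (exists u, (c.1, u, c1.1) \in Tu I /\
     forall i, i < abdim I -> ((nth 0%N c1.2 i)%:Z = (nth 0%N c.2 i)%:Z + nth 0 u i)%R)
  \/ ((c.1, c1.1) \in Tz I /\ c.2 = zero_vec I /\ c1.2 = zero_vec I).

Definition lossy_step (I : instance) (c c1 : config) : Prop :=
  c1.1 = c.1 /\ exists i, i < abdim I /\ (1 <= nth 0%N c.2 i)%N /\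
     c1.2 = set_nth 0%N c.2 i (nth 0%N c.2 i).-1.

Definition binary_step (I : instance) (c c1 c2 : config) : Prop :=
  ((c.1, c1.1, c2.1) \in Tf I /\ c1.2 = c.2 /\ c2.2 = c.2)
  \/ ((c.1, c1.1, c2.1) \in Ts I /\
      forall i, i < abdim I -> (nth 0%N c1.2 i + nth 0%N c2.2 i = nth 0%N c.2 i)%N).

Fixpoint lossy_deduction_tree (I : instance) (t : dtree) : Prop :=
  match t with
  | DLeaf c => is_config I c
  | DUn c t1 => is_config I c /\ (unary_step I c (droot t1) \/ lossy_step I c (droot t1))
                /\ lossy_deduction_tree I t1
  | DBin c t1 t2 => is_config I c /\ binary_step I c (droot t1) (droot t2)
                /\ lossy_deduction_tree I t1 /\ lossy_deduction_tree I t2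
  end.

Definition lossy_reach (I : instance) : Prop :=
  exists t, lossy_deduction_tree I t /\ droot t = (qr I, zero_vec I) /\
    forall c, c \in dleaves t -> c.1 \in Ql I /\ c.2 = zero_vec I.

(* Encoding of instances as words over the input alphabet {1,...,7}:  *)
(* 1 = bit 0, 2 = bit 1, 3 = end of number, 4 = minus sign,           *)
(* 5 = end of rule, 6 = unary tick, 7 = end of section.               *)
(* Numbers in rules (states, vector entries) are written in binary;   *)
(* |Q| and d are written in unary.                                    *)

Fixpoint bin_aux (fuel n : nat) : seq nat :=
  match fuel with
  | 0 => [::]
  | fuel'.+1 => if n == 0%N then [::] else (if odd n then 2 else 1) :: bin_aux fuel' n./2
  end.
Definition bin (n : nat) : seq nat := bin_aux n n.  (* LSB first *)

Definition enc_nat (n : nat) : seq nat := bin n ++ [:: 3].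
Definition enc_int (z : int) : seq nat :=
  match z with Posz n => enc_nat n | Negz n => 4 :: enc_nat n.+1 end.
Definition enc_vec (u : seq int) : seq nat := flatten (map enc_int u).

Definition enc_instance (I : instance) : seq nat :=
  nseq (nQ I) 6 ++ [:: 7] ++ nseq (abdim I) 6 ++ [:: 7] ++
  flatten [seq enc_nat r.1.1 ++ enc_vec r.1.2 ++ enc_nat r.2 ++ [:: 5] | r <- Tu I] ++ [:: 7] ++
  flatten [seq enc_nat r.1.1 ++ enc_nat r.1.2 ++ enc_nat r.2 ++ [:: 5] | r <- Tf I] ++ [:: 7] ++
  flatten [seq enc_nat r.1.1 ++ enc_nat r.1.2 ++ enc_nat r.2 ++ [:: 5] | r <- Ts I] ++ [:: 7] ++
  flatten [seq enc_nat r.1 ++ enc_nat r.2 ++ [:: 5] | r <- Tz I] ++ [:: 7] ++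
  enc_nat (qr I) ++ [:: 7] ++
  flatten [seq enc_nat q | q <- Ql I] ++ [:: 7].

(* Deterministic single-tape Turing machines (bi-infinite tape).      *)
(* Tape symbols are 'I_G.+1, symbol 0 is the blank; input letter k is *)
(* written as the tape symbol k.                                      *)

Record TM := MkTM {
  tm_S : nat;
  tm_G : nat;
  tm_delta : 'I_tm_S.+1 -> 'I_tm_G.+1 -> 'I_tm_S.+1 * 'I_tm_G.+1 * bool; (* true = move right *)
  tm_start : 'I_tm_S.+1;
  tm_acc : 'I_tm_S.+1;
  tm_rej : 'I_tm_S.+1
}.

Record tm_config (M : TM) := TMConfig {
  cf_state : 'I_(tm_S M).+1;
  cf_left  : seq 'I_(tm_G M).+1;   (* cells left of the head, nearest first *)
  cf_head  : 'I_(tm_G M).+1;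
  cf_right : seq 'I_(tm_G M).+1    (* cells right of the head, nearest first *)
}.

Definition tm_halted (M : TM) (s : 'I_(tm_S M).+1) : bool :=
  (s == tm_acc M) || (s == tm_rej M).

Definition tm_step (M : TM) (c : tm_config M) : tm_config M :=
  if tm_halted (cf_state c) then c else
  let: (s', a', mvr) := tm_delta (cf_state c) (cf_head c) in
  if mvr then
    TMConfig s' (a' :: cf_left c) (head ord0 (cf_right c)) (behead (cf_right c))
  else
    TMConfig s' (behead (cf_left c)) (head ord0 (cf_left c)) (a' :: cf_right c).

Definition tm_init (M : TM) (w : seq nat) : tm_config M :=
  let tape := [seq (inord k : 'I_(tm_G M).+1) | k <- w] in
  TMConfig (tm_start M) [::] (head ord0 tape) (behead tape).

Definition decides_within (M : TM) (T : nat -> nat) (w : seq nat) (b : Prop) : Prop :=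
  exists t, t <= T (size w) /\
    let s := cf_state (iter t (@tm_step M) (tm_init M w)) in
    tm_halted s /\ (s = tm_acc M <-> b).

Fixpoint tower (n : nat) : nat :=
  match n with 0 => 1 | n'.+1 => 2 ^ tower n' end.

Definition exp_iter (d m : nat) : nat := iter d (fun x => 2 ^ x) m.

Definition peval (cs : seq nat) (n : nat) : nat :=
  \sum_(i < size cs) nth 0%N cs i * n ^ i.

(* Kalmar elementary functions: terms built from projections, the constant 1,
   addition, truncated subtraction, bounded sums and bounded products
   (closed under composition by substitution). *)
Inductive eterm :=
| EProj of nat
| EOne
| EAdd of eterm & eterm
| EMonus of eterm & eterm
| ESum of eterm & eterm
| EProd of eterm & eterm.

Fixpoint eeval (t : eterm) (x : seq nat) : nat :=
  match t with
  | EProj i => nth 0%N x i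
  | EOne => 1
  | EAdd a b => eeval a x + eeval b x
  | EMonus a b => eeval a x - eeval b x
  | ESum f b => \sum_(0 <= i < eeval b x) eeval f (i :: x)
  | EProd f b => \prod_(0 <= i < eeval b x) eeval f (i :: x)
  end.

Definition elementary (e : nat -> nat) : Prop :=
  exists t : eterm, forall n, e n = eeval t [:: n].

(* Main.v *)
(* The configurations from which a lossy deduction tree exists form an upward
closed set W, the least set closed under reading the rules backwards with
inequalities in place of equalities.  Once the states q whose zero test leads to
a member of W are taken as axioms, zero tests disappear, and a Rackoff-style
induction on the number of tracked coordinates applies: either all coordinates
stay below a bound, and a derivation of minimal height meets each configuration
of the box at most once, or a coordinate exceeds m 2^h, where h bounds the height
of the derivations ignoring it, and then that coordinate can be carried along
since a step loses at most m or one half of it.  So it suffices to saturate inside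
the box [0, B]^d, where B is a d-fold exponential of the input length n, obtained
from n by iterating z |-> 2^(n z).  The saturation is a fold of polynomial-time
list operations over the list of all configurations of the box, hence takes time
polynomial in B^d; it runs on a single-tape Turing machine through programs on
serialised trees held on four stacks, which are stored as tracks of the tape. *)

Require Import Defs.
From HB Require Import structures.
From mathcomp Require Import all_boot all_order all_algebra.

From mathcomp Require Import boolp.
From mathcomp Require Import zify.
Set Implicit Arguments. Unset Strict Implicit. Unset Printing Implicit Defensive.

(** * Turing machines over finite types *)

(** A zero test constrains only the configuration after it, because the current vector can first be
    lost down to zero. It therefore succeeds at a state for every vector or for none, which is what
    allows it to become an axiom; the saturated set itself decides which states these are, and
    nested tests are resolved from the innermost outwards. A split may halve a coordinate at every
    level, so the quantity to be bounded before a large coordinate can be reinstated is the height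
    of a derivation and not its size. Exactly [d] exponentials suffice, although entries are binary
    and [max_height] climbs one exponential per tracked coordinate: with no coordinate tracked the
    height is at most the number of states, the bound [m] on the entries is absorbed by the first
    exponential, and the cap has to dominate [m * 2 ^ max_height k] only for [k < d], because the
    number of rounds of the saturation is given by the box and not by a height. In dimension 0 the
    cap is linear in the input and the box has a single vector. *)

Section FinTM.
Variables (S G : finType) (sini sacc srej : S) (letter : 'I_8 -> G).
Variable delta : S -> G -> S * G * bool.

Definition enc_state (s : S) : 'I_#|S|.+1 := inord (enum_rank s).
Definition dec_state (i : 'I_#|S|.+1) : S := nth sini (enum S) i.
Definition enc_sym (g : G) : 'I_(7 + #|G|).+1 := inord (8 + enum_rank g).
(* Codes below 8 are the raw input letters, so decoding is not injective. *)
Definition dec_sym (a : 'I_(7 + #|G|).+1) : G :=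
  if a < 8 then letter (inord a) else nth (letter ord0) (enum G) (a - 8).

Lemma enc_stateK : cancel enc_state dec_state.
Proof.
move=> s; rewrite /dec_state /enc_state inordK; first exact: nth_enum_rank.
by rewrite ltnS ltnW.
Qed.

Lemma enc_symK : cancel enc_sym dec_sym.
Proof.
move=> g; have lt := ltn_ord (enum_rank g).
rewrite /dec_sym /enc_sym inordK; last by rewrite !addSn !ltnS ltn_add2l.
by rewrite ltnNge leq_addr /= addKn nth_enum_rank.
Qed.

Definition fin_tm : TM :=
  @MkTM #|S| (7 + #|G|)
    (fun i a => let: (s', g', b) := delta (dec_state i) (dec_sym a) in
                (enc_state s', enc_sym g', b))
    (enc_state sini) (enc_state sacc) (enc_state srej).

(* The tape is a function of the position; everything left of position 0 is
   blank and never visited. *)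
Definition repr (c : tm_config fin_tm) (s : S) (f : nat -> G) (j : nat) :=
  [/\ cf_state c = enc_state s,
      map dec_sym (cf_left c) = rev (mkseq f j) &
      forall i, dec_sym (nth ord0 (cf_head c :: cf_right c) i) = f (j + i)].

Definition upd (f : nat -> G) j g i := if i == j then g else f i.

Definition goes s f j s' f' j' t := forall c,
  repr c s f j -> repr (iter t (@tm_step fin_tm) c) s' f' j'.

Lemma goes0 s f j : goes s f j s f j 0.
Proof. by []. Qed.

Lemma goes_trans s1 f1 j1 s2 f2 j2 s3 f3 j3 t1 t2 :
  goes s1 f1 j1 s2 f2 j2 t1 -> goes s2 f2 j2 s3 f3 j3 t2 ->
  goes s1 f1 j1 s3 f3 j3 (t1 + t2).
Proof. by move=> h1 h2 c /h1 /h2; rewrite addnC iterD. Qed.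

Lemma mkseq_upd f j g k : k <= j -> mkseq (upd f j g) k = mkseq f k.
Proof.
move=> le; apply: (@eq_from_nth _ (f 0)); rewrite !size_mkseq // => i lt.
by rewrite !nth_mkseq // /upd ltn_eqF // (leq_trans lt).
Qed.

Lemma repr_ext c s f f' j : f =1 f' -> repr c s f j -> repr c s f' j.
Proof.
move=> e [h1 h2 h3]; split=> //; last by move=> i; rewrite h3 e.
by rewrite h2 (eq_mkseq e).
Qed.

Lemma goes_ext s f j s' f' f'' j' t : f' =1 f'' ->
  goes s f j s' f' j' t -> goes s f j s' f'' j' t.
Proof. by move=> e h c /h; apply: repr_ext. Qed.

Lemma halted_enc s :
  tm_halted (M := fin_tm) (enc_state s) = (s == sacc) || (s == srej).
Proof. by rewrite /tm_halted /= !(can_eq enc_stateK). Qed.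

Lemma goes_right s f j s' g :
  s != sacc -> s != srej -> delta s (f j) = (s', g, true) ->
  goes s f j s' (upd f j g) j.+1 1.
Proof.
move=> na nr dl [st l h r] [/= -> hl hr].
rewrite /tm_step /= halted_enc (negPf na) (negPf nr) /=.
have h0 := hr 0; rewrite /= addn0 in h0.
rewrite enc_stateK h0 dl; split=> //=.
  rewrite hl enc_symK; apply: (can_inj revK).
  rewrite rev_cons !revK mkseqS; congr rcons; last by rewrite /upd eqxx.
  by rewrite mkseq_upd.
move=> i; rewrite /upd (_ : j.+1 + i == j = false); last by lia.
have := hr i.+1; rewrite (_ : j + i.+1 = j.+1 + i); last by lia.
by move=> <- /=; case: r {hr} => [|a r]; case: i => [|[|i]].
Qed.

Lemma goes_left s f j s' g :
  s != sacc -> s != srej -> delta s (f j.+1) = (s', g, false) ->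
  goes s f j.+1 s' (upd f j.+1 g) j 1.
Proof.
move=> na nr dl [st l h r] [/= -> hl hr].
rewrite /tm_step /= halted_enc (negPf na) (negPf nr) /=.
have h0 := hr 0; rewrite /= addn0 in h0.
rewrite enc_stateK h0 dl.
move: hl; rewrite mkseqS rev_rcons; case: l => [|a l] //= [ea hl].
split=> //=; first by rewrite hl mkseq_upd.
case=> [|[|i]] /=; first by rewrite /upd addn0 ltn_eqF // ea.
  by rewrite addn1 /upd eqxx enc_symK.
have := hr i.+1; rewrite /= => ->; rewrite /upd (_ : j + i.+2 == j.+1 = false); last by lia.
by congr f; lia.
Qed.

(** Stepping left of position 0 brings in a blank from the unvisited half of the tape and renumbers
    all cells by one. This happens once, to make room for the marker in front of the input. *)
Lemma goes_left0 s f s' g :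
  s != sacc -> s != srej -> delta s (f 0) = (s', g, false) ->
  goes s f 0 s' (fun i => if i is i'.+1 then upd f 0 g i' else letter ord0) 0 1.
Proof.
move=> na nr dl [st l h r] [/= -> hl hr].
rewrite /tm_step /= halted_enc (negPf na) (negPf nr) /=.
have h0 := hr 0; rewrite /= addn0 in h0.
rewrite enc_stateK h0 dl; case: l hl => [|//] _; split=> //=.
case=> [|[|i]] /=; rewrite ?enc_symK //; last by have := hr i.+1; rewrite /= => ->.
by rewrite /dec_sym /=; congr letter; apply: val_inj; rewrite /= inordK.
Qed.

Lemma repr_init (w : seq nat) : all (fun k => k < 8) w ->
  repr (tm_init fin_tm w) sini (fun i => letter (inord (nth 0 w i))) 0.
Proof.
move=> lw; split=> //= i; rewrite add0n.
set t := map _ w.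
have -> : nth ord0 (head ord0 t :: behead t) i = nth ord0 t i :> 'I_(7 + #|G|).+1.
  by case: (t) => [|a s] //; case: i => [|[]].
rewrite /t; have [lt|ge] := ltnP i (size w).
  rewrite (nth_map 0) //; have l8 := all_nthP 0 lw i lt.
  by rewrite /dec_sym inordK ?l8 // (leq_trans l8).
rewrite !nth_default ?size_map // /dec_sym /=.
Qed.

End FinTM.

(** * A machine with four stacks and one register *)

Notation sym := 'I_8.
Definition mstate := (sym * seq (seq sym))%type.

Inductive op := Push of 'I_4 | Pop of 'I_4 | SetR of sym.

(* Symbol 0 means "no symbol": pushing it does nothing, popping an empty stack yields it. *)
Definition exec (o : op) (m : mstate) : mstate :=
  let: (r, T) := m in
  match o with
  | Push k => (r, if r == ord0 then T else set_nth [::] T k (r :: nth [::] T k))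
  | Pop k => (head ord0 (nth [::] T k), set_nth [::] T k (behead (nth [::] T k)))
  | SetR a => (a, T)
  end.

Inductive instr := IOp of op | IJump of option sym & nat.

Definition jumps (r : sym) (o : option sym) := if o is Some a then r == a else true.

Definition astep (code : seq instr) (c : nat * mstate) : nat * mstate :=
  let: (pc, m) := c in
  if pc < size code then
    match nth (IJump None 0) code pc with
    | IOp o => (pc.+1, exec o m)
    | IJump o n => (if jumps m.1 o then n else pc.+1, m)
    end
  else c.

Section Simulation.
Variable code : seq instr.
Let n := size code.

Definition cell := {ffun 'I_4 -> sym}.
Definition tsym : Type := option cell.   (* None marks position 0 *)
HB.instance Definition _ := Finite.on tsym.

(* inl: 0, 1 = set-up, 2 = accept, 3 = reject.  inr (mode, pc, register) with
   mode (false,_) = go home and execute, (true,false) = look for the top of a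
   stack, (true,true) = one step left of the first free cell. *)
Definition tstate : Type := ('I_4 + bool * bool * 'I_n.+1 * sym)%type.
HB.instance Definition _ := Finite.on tstate.

Definition St (a b : bool) (pc : nat) (r : sym) : tstate :=
  inr (a, b, inord (minn pc n), r).
Definition Sp (i : 'I_4) : tstate := inl i.
Definition i0 : 'I_4 := @Ordinal 4 0 isT.
Definition i1 : 'I_4 := @Ordinal 4 1 isT.
Definition i2 : 'I_4 := @Ordinal 4 2 isT.
Definition i3 : 'I_4 := @Ordinal 4 3 isT.
Definition accsym : sym := @Ordinal 8 2 isT.

(* The input word is the initial content of stack 3, its last letter on top. *)
Definition letter (a : 'I_8) : tsym := Some [ffun k => if k == i3 then a else ord0].
Definition set_cell (c : cell) k a : cell := [ffun i => if i == k then a else c i].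

Definition delta (s : tstate) (g : tsym) : tstate * tsym * bool :=
  match s with
  | inl i => if val i == 0 then (Sp i1, g, false)
             else if val i == 1 then (St false false 0 ord0, None, true)
             else (s, g, true)
  | inr (a, b, pc, r) =>
    if ~~ a then
      match g with
      | Some _ => (s, g, false)
      | None =>
        if pc < n then
          match nth (IJump None 0) code pc with
          | IOp (SetR x) => (St false false pc.+1 x, g, true)
          | IOp _ => (St true false pc r, g, true)
          | IJump o m => (St false false (if jumps r o then m else pc.+1) r, g, true)
          end
        else (Sp (if r == accsym then i2 else i3), g, true)
      end
    else
      match nth (IJump None 0) code pc, g with
      | IOp (Push k), Some c =>
        if c k == ord0 then (St false false pc.+1 r, Some (set_cell c k r), false)
        else (s, g, true)
      | IOp (Pop k), Some c =>
        if ~~ b then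
          if c k == ord0 then (St true true pc r, g, false) else (s, g, true)
        else (St false false pc.+1 (c k), Some (set_cell c k ord0), false)
      | IOp (Pop k), None => (St false false pc.+1 ord0, g, true)
      | _, _ => (s, g, true)
      end
  end.

Definition M : TM := fin_tm (Sp i0) (Sp i2) (Sp i3) letter delta.

Notation goes := (@goes tstate tsym (Sp i0) (Sp i2) (Sp i3) letter delta).

Definition stk (T : seq (seq sym)) (k : nat) := nth [::] T k.

(* The bottom of every stack is at position 1. *)
Definition tape (T : seq (seq sym)) (j : nat) : tsym :=
  if j is i.+1 then Some [ffun k : 'I_4 => nth ord0 (rev (stk T k)) i] else None.

Definition good_stacks (T : seq (seq sym)) h :=
  forall k, all (fun a => a != ord0) (stk T k) /\ size (stk T k) <= h.

Lemma pc_val pc : pc <= n -> nat_of_ord (inord (minn pc n) : 'I_n.+1) = pc.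
Proof. by move=> le; rewrite (minn_idPl le) inordK. Qed.

Lemma upd_id (G : finType) (f : nat -> G) j : upd f j (f j) =1 f.
Proof. by move=> i; rewrite /upd; case: eqP => [->|]. Qed.

Lemma goes_step_right s f j s' : (if s is inr _ then true else false) ->
  delta s (f j) = (s', f j, true) -> goes s f j s' f j.+1 1.
Proof.
move=> hs hd; apply: goes_ext (upd_id f j) _.
by case: s hs hd => // s _ hd; apply: goes_right.
Qed.

Lemma goes_step_left s f j s' : (if s is inr _ then true else false) ->
  delta s (f j.+1) = (s', f j.+1, false) -> goes s f j.+1 s' f j 1.
Proof.
move=> hs hd; apply: goes_ext (upd_id f j.+1) _.
by case: s hs hd => // s _ hd; apply: goes_left.
Qed.

Lemma go_home pc r b T j : goes (St false b pc r) (tape T) j (St false b pc r) (tape T) 0 j.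
Proof.
elim: j => [|j IH]; first exact: goes0.
rewrite -[X in goes _ _ _ _ _ _ X]add1n; apply: goes_trans IH.
by apply: goes_step_left.
Qed.

Lemma tape_top T h (k : 'I_4) (c : cell) i : good_stacks T h -> i <= size (stk T k) ->
  tape T i.+1 = Some c -> (c k == ord0) = (i == size (stk T k)).
Proof.
move=> /(_ k) [nz _] le [<-]; rewrite ffunE.
move: le; rewrite leq_eqVlt => /orP[/eqP->|lt].
  by rewrite nth_default ?size_rev // !eqxx.
rewrite (ltn_eqF lt) nth_rev //; apply/negbTE.
by apply: (allP nz); rewrite mem_nth // ltn_subrL /= (leq_ltn_trans (leq0n i) lt).
Qed.

Lemma go_top pc r b T h (k : 'I_4) i : good_stacks T h -> pc < n ->
  nth (IJump None 0) code pc = IOp (Push k) \/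
  nth (IJump None 0) code pc = IOp (Pop k) /\ b = false ->
  i <= size (stk T k) ->
  goes (St true b pc r) (tape T) 1 (St true b pc r) (tape T) i.+1 i.
Proof.
move=> gT lt hc; elim: i => [|i IH] le; first exact: goes0.
rewrite -[X in goes _ _ _ _ _ _ X]addn1; apply: goes_trans (IH (ltnW le)) _.
apply: goes_step_right => //; rewrite /= pc_val ?(ltnW lt) //.
have := tape_top gT (ltnW le) (erefl (tape T i.+1)).
by case: hc => [->|[-> ->]]; rewrite ffunE => -> /=; rewrite ltn_eqF.
Qed.

Lemma stk_set T k s i : stk (set_nth [::] T k s) i = if i == k then s else stk T i.
Proof. by rewrite /stk nth_set_nth. Qed.

(** Between instructions the head rests on the marker. A stack operation walks up to the first free
    cell of its track and back, which accounts for [2 * h]; the bound on the stacks grows by one to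
    allow for a push. *)
Lemma sim_step pc m h : good_stacks m.2 h -> exists t,
  t <= 2 * h + 4 /\ good_stacks (astep code (pc, m)).2.2 h.+1 /\
  (pc < n ->
   goes (St false false pc m.1) (tape m.2) 0
     (St false false (astep code (pc, m)).1 (astep code (pc, m)).2.1)
     (tape (astep code (pc, m)).2.2) 0 t).
Proof.
case: m => r T /= gT.
have gT1 : good_stacks T h.+1 by move=> k; have [? /leqW] := gT k.
have [lt|ge] := ltnP pc (size code); last first.
  by exists 0; split=> //; split=> //; rewrite ltnNge ge.
have pcv : nat_of_ord (inord (minn pc n) : 'I_n.+1) = pc by rewrite pc_val // ltnW.
case ei: (nth (IJump None 0) code pc) => [o|o q]; last first.
  exists (1 + 1); split; first by lia.
  split=> // _; apply: goes_trans _ (@go_home _ _ _ _ 1).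
  by apply: goes_step_right => //=; rewrite pcv lt ei.
have lth k : size (stk T k) <= h by have [] := gT k.
have home0 r' o' : ei = ei -> o = o' -> (if o is SetR _ then false else true) ->
    goes (St false false pc r') (tape T) 0 (St true false pc r') (tape T) 1 1.
  move=> _ _ ho; apply: goes_step_right => //=; rewrite pcv lt ei.
  by case: (o) ho.
case: o ei home0 => [k|k|a] ei home0 /=.
- set T' := (if _ then _ else _).
  exists (1 + (size (stk T k) + (1 + size (stk T k)))); split; first by have := lth k; lia.
  split.
    rewrite /T'; case: eqP => // /eqP nz i; rewrite stk_set; case: eqP => _ //=.
    by rewrite nz; have [h1 h2] := gT k; rewrite ltnS.
  move=> _; apply: goes_trans (@home0 r (Push k) erefl erefl isT) _.
  apply: goes_trans (@go_top _ _ _ _ _ _ _ gT lt (or_introl ei) (leqnn _)) _.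
  apply: goes_trans _ (@go_home _ _ _ _ _).
  set s := size (stk T k).
  have := tape_top gT (leqnn _) (erefl (tape T s.+1)); rewrite eqxx => /eqP top.
  apply: goes_ext; last first.
    apply: goes_left => //; rewrite /= pcv ei /=.
    by move: top; rewrite !ffunE => ->; rewrite eqxx.
  case=> [|i]; rewrite /upd //= eqSS; case: (i =P s) => [->|ne]; congr Some; apply/ffunP => x.
    rewrite !ffunE /T'; case: (r =P ord0) => [r0|nz].
      case: (x =P k) => [->|//]; rewrite r0.
      by rewrite nth_default // size_rev.
    rewrite stk_set val_eqE; case: (x =P k) => [exk|//]; rewrite ?exk.
    by rewrite rev_cons nth_rcons size_rev -/s ltnn eqxx.
  rewrite !ffunE /T'; case: (r =P ord0) => [//|nz].
  rewrite stk_set val_eqE; case: (x =P k) => [exk|//]; rewrite ?exk.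
  rewrite rev_cons nth_rcons size_rev -/s.
  by case: ltnP => // le; rewrite (introF eqP ne) nth_default // size_rev -/s.
  set T' := set_nth _ _ _ _.
  have gT' : good_stacks T' h.+1.
    move=> i; rewrite stk_set; case: eqP => _ //.
    have [h1 h2] := gT k; split; last by rewrite size_behead (leq_trans (leq_pred _) (leqW h2)).
    by apply/allP => x /mem_behead xs; apply: (allP h1).
  have top := go_top (r := r) gT lt (or_intror (conj ei erefl)) (leqnn _).
  have chk : goes (St true false pc r) (tape T) (size (stk T k)).+1 (St true true pc r) (tape T) (size (stk T k)) 1.
    apply: goes_step_left => //=; rewrite pcv ei.
    have := tape_top gT (leqnn _) (erefl (tape T (size (stk T k)).+1)).
    by rewrite eqxx /= ffunE => ->.
  case es: (stk T k) top chk => [|a s] top chk.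
    exists (1 + (0 + (1 + (1 + 1)))); split; first by lia.
    split=> // _; apply: goes_trans (@home0 r (Pop k) erefl erefl isT) _.
    apply: goes_trans top _; apply: goes_trans chk _.
    have eT : tape T =1 tape T'.
      case=> [//|i]; rewrite /=; congr Some; apply/ffunP => x; rewrite !ffunE stk_set.
      by rewrite val_eqE; case: eqP => [->|//]; rewrite -/(stk T k) es.
    apply: goes_ext eT _; rewrite -/(stk T k) es /=.
    apply: goes_trans _ (@go_home _ _ _ _ 1).
    by apply: goes_step_right => //=; rewrite pcv ei.
  exists (1 + ((size s).+1 + (1 + (1 + size s)))); split.
    by have := lth k; rewrite es /=; lia.
  split=> // _; apply: goes_trans (@home0 r (Pop k) erefl erefl isT) _.
  apply: goes_trans top _; apply: goes_trans chk _.
  apply: goes_trans _ (@go_home _ _ _ _ _).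
  apply: goes_ext; last first.
    apply: goes_left => //; rewrite /= pcv ei /= ffunE es rev_cons nth_rcons size_rev ltnn eqxx.
    by rewrite -/(stk T k) es.
  case=> [|i]; rewrite /upd //= eqSS; case: (i =P size s) => [->|ne]; congr Some; apply/ffunP => x;
    rewrite !ffunE stk_set val_eqE; case: (x =P k) => [exk|//]; rewrite ?exk; rewrite -/(stk T k) es /=.
    by rewrite nth_default // size_rev.
  rewrite rev_cons nth_rcons size_rev; case: ltnP => // le.
  by rewrite (introF eqP ne) nth_default // size_rev.
- exists (1 + 1); split; first by lia.
  split=> // _; apply: goes_trans _ (@go_home _ _ _ _ 1).
  by apply: goes_step_right => //=; rewrite pcv lt ei.
Qed.

End Simulation.

Definition init_m (w : seq nat) : mstate :=
  (ord0, [:: [::]; [::]; [::]; rev [seq (inord k : sym) | k <- w]]).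

Section Run.
Variable code : seq instr.
Notation n := (size code).
Notation goes := (@goes (tstate code) tsym (Sp code i0) (Sp code i2) (Sp code i3) letter (@delta code)).

(** A step lengthens a stack by at most one, so [h + t] bounds all stacks throughout the run. *)
Lemma asm_run t c h : good_stacks c.2.2 h -> exists t',
  t' <= t * (2 * (h + t) + 4) /\
  goes (St code false false c.1 c.2.1) (tape c.2.2) 0
     (let c' := iter t (astep code) c in St code false false c'.1 c'.2.1)
     (tape (iter t (astep code) c).2.2) 0 t'.
Proof.
elim: t c h => [|t IH] [pc m] h gT; first by exists 0; split=> //; apply: goes0.
rewrite iterSr.
have [t1 [le1 [gT1 st]]] := sim_step code pc gT.
have [t2 [le2 st2]] := IH _ _ gT1.
have [lt|ge] := ltnP pc n; last first.
  exists t2; split.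
    by apply: leq_trans le2 _; rewrite addSnnS leq_mul2r leqnSn orbT.
  by move: st2; rewrite /astep /= ltnNge ge.
exists (t1 + t2); split; last by apply: goes_trans (st lt) st2.
rewrite mulSn leq_add //; first by lia.
by rewrite addSnnS in le2.
Qed.

Lemma tm_run (w : seq nat) t m : all (fun k => 0 < k < 8) w ->
  iter t (astep code) (0, init_m w) = (n, m) ->
  exists t', t' <= t * (2 * (size w + t) + 4) + 4 /\
    let s := cf_state (iter t' (@tm_step (M code)) (tm_init (M code) w)) in
    tm_halted s /\ (s = tm_acc (M code) <-> m.1 = accsym).
Proof.
move=> hw hrun.
pose T0 := (init_m w).2.
have gT : good_stacks T0 (size w).
  case=> [|[|[|[|k]]]] //; last by rewrite /stk nth_default.
  rewrite /stk /= size_rev size_map all_rev; split=> //.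
  apply/allP => a /mapP[x /(allP hw) /andP[x0 x8] ->].
  by rewrite -val_eqE /= inordK // -lt0n.
have [t1 [le1 st1]] := asm_run t (c := (0, init_m w)) gT.
have : goes (Sp code i0) (fun i => letter (inord (nth 0 w i))) 0 (St code false false 0 ord0) (tape T0) 0 3.
  (* Step left of the input, write the marker there, and come back to it. *)
  rewrite -[3]/(1 + (1 + 1)); apply: goes_trans.
    by apply: goes_left0.
  apply: goes_trans; first by apply: goes_right.
  apply: goes_ext; last by apply: goes_step_left; rewrite /upd.
  case=> [|i]; rewrite /upd //= /letter.
  have -> : (if i == 0 then Some [ffun k => if k == i3 then inord (nth 0 w 0) else ord0]
     else Some [ffun k => if k == i3 then inord (nth 0 w i) else ord0]) =
     Some [ffun k : 'I_4 => if k == i3 then inord (nth 0 w i) : 'I_8 else ord0].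
    by case: eqP => // ->.
  congr Some; apply/ffunP => k; rewrite !ffunE /stk.
  case: eqP => [->|ne] /=.
    rewrite revK; have [lt|ge] := ltnP i (size w); first by rewrite (nth_map 0).
    by rewrite !nth_default ?size_map //; apply: val_inj; rewrite /= inordK.
  by case: k ne => -[|[|[|[|k]]]] // lk ne; rewrite ?nth_nil //; case: ne; apply: val_inj.
move=> st0.
rewrite hrun /= in st1.
have fin : goes (St code false false n m.1) (tape m.2) 0
   (Sp code (if m.1 == accsym then i2 else i3)) (tape m.2) 1 1.
  by apply: goes_step_right => //=; rewrite pc_val // ltnn.
have w8 : all (fun k => k < 8) w by apply: sub_all hw => k /andP[].
have [hst _ _] := goes_trans st0 (goes_trans st1 fin) (repr_init (Sp code i0) (Sp code i2) (Sp code i3) letter (@delta code) w8).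
exists (3 + (t1 + 1)); split; first by rewrite /=; lia.
rewrite hst /M halted_enc; split; first by case: ifP.
split; last by move=> ->.
by case: (m.1 =P accsym) => // _ /(can_inj (enc_stateK (Sp code i0))).
Qed.
End Run.

(** * While programs and their compilation to jump code *)

Inductive com :=
| COp of op
| CSeq of com & com
| CIf of sym & com & com
| CWhile of sym & com.   (* loop until the register is the given symbol *)

(** The step counts include the jumps inserted by the compiler, so [compile_run] holds with exactly
    the same [t]. *)
Inductive run : com -> mstate -> mstate -> nat -> Prop :=
| RunOp o m : run (COp o) m (exec o m) 1
| RunSeq c1 c2 m1 m2 m3 t1 t2 :
    run c1 m1 m2 t1 -> run c2 m2 m3 t2 -> run (CSeq c1 c2) m1 m3 (t1 + t2)
| RunIfT a c1 c2 m m' t : m.1 = a -> run c1 m m' t -> run (CIf a c1 c2) m m' t.+1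
| RunIfF a c1 c2 m m' t : m.1 <> a -> run c2 m m' t -> run (CIf a c1 c2) m m' t.+2
| RunWhileT a c m : m.1 = a -> run (CWhile a c) m m 1
| RunWhileF a c m1 m2 m3 t1 t2 : m1.1 <> a -> run c m1 m2 t1 ->
    run (CWhile a c) m2 m3 t2 -> run (CWhile a c) m1 m3 (t1 + t2).+2.

Arguments astep : simpl never.

Fixpoint compile_size (c : com) : nat :=
  match c with
  | COp _ => 1
  | CSeq c1 c2 => compile_size c1 + compile_size c2
  | CIf _ c1 c2 => compile_size c1 + compile_size c2 + 2
  | CWhile _ c => compile_size c + 2
  end.

(* [i] is the absolute position of the generated code. *)
Fixpoint compile (i : nat) (c : com) : seq instr :=
  match c with
  | COp o => [:: IOp o]
  | CSeq c1 c2 => compile i c1 ++ compile (i + compile_size c1) c2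
  | CIf a c1 c2 =>
      IJump (Some a) (i + compile_size c2 + 2) :: compile i.+1 c2 ++
      IJump None (i + compile_size (CIf a c1 c2)) :: compile (i + compile_size c2 + 2) c1
  | CWhile a c =>
      IJump (Some a) (i + compile_size (CWhile a c)) :: compile i.+1 c ++ [:: IJump None i]
  end.

Lemma size_compile i c : size (compile i c) = compile_size c.
Proof.
elim: c i => [o|c1 h1 c2 h2|a c1 h1 c2 h2|a c h] i //=;
  by rewrite ?size_cat /= ?h1 ?h2 ?h; lia.
Qed.

Definition code_at (code : seq instr) i (l : seq instr) :=
  exists p q, code = p ++ l ++ q /\ size p = i.

Lemma code_atL code i l1 l2 : code_at code i (l1 ++ l2) -> code_at code i l1.
Proof. by case=> p [q [-> <-]]; exists p, (l2 ++ q); rewrite !catA. Qed.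

Lemma code_atR code i l1 l2 : code_at code i (l1 ++ l2) -> code_at code (i + size l1) l2.
Proof. by case=> p [q [-> <-]]; exists (p ++ l1), q; rewrite !catA size_cat. Qed.

Lemma astep_at code i x l m : code_at code i (x :: l) ->
  astep code (i, m) = match x with
    | IOp o => (i.+1, exec o m)
    | IJump o n => (if jumps m.1 o then n else i.+1, m) end.
Proof.
case=> p [q [-> <-]]; rewrite /astep size_cat /= size_cat.
by rewrite ifT; [rewrite nth_cat ltnn subnn | lia].
Qed.

Lemma compile_run c m m' t : run c m m' t -> forall code i,
  code_at code i (compile i c) ->
  iter t (astep code) (i, m) = (i + compile_size c, m').
Proof.
elim=> {c m m' t} /=.
- by move=> o m code i hc; rewrite /= (astep_at _ hc) addn1.
- move=> c1 c2 m1 m2 m3 t1 t2 _ h1 _ h2 code i hc.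
  rewrite addnC iterD (h1 _ _ (code_atL hc)) h2 ?addnA //.
  by have := code_atR hc; rewrite size_compile.
- move=> a c1 c2 m m' t ea _ h code i hc.
  rewrite -iterS iterSr (astep_at _ hc) /= ea eqxx h; first by congr pair; lia.
  have := code_atR (l1 := [:: _]) hc => /= {}hc; have := code_atR hc.
  rewrite -cat1s => {}hc; have := code_atR hc.
  by rewrite size_compile /= (_ : i + 1 + compile_size c2 + 1 = i + compile_size c2 + 2) //; lia.
- move=> a c1 c2 m m' t /eqP/negPf ea _ h code i hc.
  have := code_atR (l1 := [:: _]) hc; rewrite addn1 => hc2.
  rewrite -iterS iterSr (astep_at _ hc) /= ea (h _ _ (code_atL hc2)).
  have := code_atR hc2; rewrite size_compile => /astep_at -> /=.
  by congr pair; lia.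
- by move=> a c m ea code i hc; rewrite /= (astep_at _ hc) /= ea eqxx addnA.
- move=> a c m1 m2 m3 t1 t2 /eqP/negPf ea _ h1 _ h2 code i hc.
  have := code_atR (l1 := [:: _]) hc; rewrite addn1 => hc2.
  rewrite -!iterS (_ : (t1 + t2).+2 = t2 + (1 + (t1 + 1))); last by lia.
  rewrite !iterD /= (astep_at _ hc) /= ea (h1 _ _ (code_atL hc2)).
  have := code_atR hc2; rewrite size_compile => /astep_at -> /=.
  exact: h2.
Qed.

(** * Structured programs on serialised trees *)

Inductive tree := TNil | TCons of tree & tree.

Definition a1 : sym := @Ordinal 8 1 isT.
Definition a2 : sym := @Ordinal 8 2 isT.

(* Prefix notation: walking over a tree only needs a counter of pending subtrees. *)
Fixpoint ser (x : tree) : seq sym :=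
  match x with TNil => [:: a1] | TCons x y => a2 :: ser x ++ ser y end.

Lemma ser_neq0 x : all (fun a : sym => a != ord0) (ser x).
Proof. by elim: x => //= x hx y hy; rewrite all_cat hx hy. Qed.

Definition does c (s s' : seq (seq sym)) T :=
  forall r, exists r' t, t <= T /\ run c (r, s) (r', s') t.

Lemma does_le c s s' T T' : T <= T' -> does c s s' T -> does c s s' T'.
Proof.
by move=> le h r; have [r' [t [le' hr]]] := h r; exists r', t; split=> //; apply: leq_trans le.
Qed.

Lemma does_seq c1 c2 s1 s2 s3 T1 T2 :
  does c1 s1 s2 T1 -> does c2 s2 s3 T2 -> does (CSeq c1 c2) s1 s3 (T1 + T2).
Proof.
move=> h1 h2 r; have [r1 [t1 [le1 r1P]]] := h1 r; have [r2 [t2 [le2 r2P]]] := h2 r1.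
by exists r2, (t1 + t2); split; [apply: leq_add | apply: RunSeq r1P r2P].
Qed.

Lemma run_op o m m' : exec o m = m' -> run (COp o) m m' 1.
Proof. by move=> <-; apply: RunOp. Qed.

Ltac ops := first
  [ eapply run_op; simpl;
    repeat match goal with H : (_ == ord0) = false |- _ => rewrite H end; reflexivity
  | eapply RunSeq; [ops | ops] ].

(* Stacks: 0 holds the values, 1 and 3 are buffers, 2 counts pending subtrees. *)
Definition pop k := COp (Pop k).
Definition push k := COp (Push k).
Definition put a := CSeq (COp (SetR a)) (push i0).

Lemma does_put a V B C I : a != ord0 ->
  does (put a) [:: V; B; C; I] [:: a :: V; B; C; I] 2.
Proof.
move=> /negPf nz r; exists a, (1 + 1); split=> //.
by ops.
Qed.

(** There are two buffers because [swap] parks two trees at the same time. *)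
Definition fwd_buffer (b : bool) := if b then i1 else i3.
(** The register doubles as the loop condition. After [a2] a token is pushed and the register stays
    [a2]: one pending subtree has become two. After [a1] a token is popped, which leaves 0 in the
    register exactly when no subtree is pending. *)
Definition walk_body b :=
  CSeq (pop i0) (CSeq (push (fwd_buffer b)) (CIf a2 (push i2) (pop i2))).
Definition walk b := CSeq (COp (SetR a1)) (CWhile ord0 (walk_body b)).

Definition lay (b : bool) (V K C J : seq sym) :=
  if b then [:: V; K; C; J] else [:: V; J; C; K].

(** The rest of the run is a hypothesis, so that the two subtrees of a node are chained backwards.
    Reading a subtree ends by popping one token of [C] into the register, whence [head ord0 C] and
    [behead C]. *)
Lemma walk_loop b x L K C J m t r : r <> ord0 ->
  run (CWhile ord0 (walk_body b)) (head ord0 C, lay b L (rev (ser x) ++ K) (behead C) J) m t ->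
  exists t', t' <= t + 7 * size (ser x) /\
    run (CWhile ord0 (walk_body b)) (r, lay b (ser x ++ L) K C J) m t'.
Proof.
elim: x L K C t r => [|x hx y hy] L K C t r nz hr.
  exists ((1 + (1 + 3)) + t).+2; split; first by rewrite /=; lia.
  apply: RunWhileF => //; last exact: hr.
  apply: RunSeq; first by apply: run_op.
  apply: RunSeq; first by apply: run_op.
  apply: RunIfF; first by case: (b).
  by apply: run_op; case: (b).
rewrite /= rev_cons rev_cat cat_rcons -catA in hr.
have [t1 [le1 hr1]] := hy _ _ _ _ a2 ltac:(by []) hr.
have [t2 [le2 hr2]] := hx (ser y ++ L) (a2 :: K) (a2 :: C) t1 a2 ltac:(by []) hr1.
exists ((1 + (1 + 2)) + t2).+2; split; first by rewrite /= size_cat; lia.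
apply: RunWhileF => //; last exact: hr2.
apply: RunSeq; first by apply: run_op.
apply: RunSeq; first by apply: run_op.
apply: RunIfT; first by case: (b).
by apply: run_op; case: (b); rewrite /= catA.
Qed.

Lemma does_walk b x L K J :
  does (walk b) (lay b (ser x ++ L) K [::] J) (lay b L (rev (ser x) ++ K) [::] J)
    (7 * size (ser x) + 2).
Proof.
move=> r; have h := RunWhileT (a := ord0) (walk_body b)
  (m := (ord0, lay b L (rev (ser x) ++ K) [::] J)) erefl.
have [t [le ht]] := walk_loop (C := [::]) (r := a1) ltac:(by []) h.
exists ord0, (1 + t); split; first by lia.
by apply: RunSeq ht; apply: run_op.
Qed.

Definition drain k c := CSeq (pop k) (CWhile ord0 (CSeq c (pop k))).
Definition skip := COp (SetR ord0).

Lemma drain_buffer b (V K C J : seq sym) : all (fun a : sym => a != ord0) K ->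
  does (drain (fwd_buffer b) (push i0)) (lay b V K C J) (lay b (rev K ++ V) [::] C J)
    (4 * size K + 2).
Proof.
move=> nz r; suff: exists t, t <= 4 * size K + 1 /\
    run (CWhile ord0 (CSeq (push i0) (pop (fwd_buffer b))))
      (head ord0 K, lay b V (behead K) C J) (ord0, lay b (rev K ++ V) [::] C J) t.
  case=> t [le ht]; exists ord0, (1 + t); split; first by lia.
  by apply: RunSeq ht; apply: run_op; case: (b).
elim: K V nz => [|a K IH] V /=; first by exists 1; split=> //; apply: RunWhileT.
case/andP=> /negPf an /(IH (a :: V))[t [le ht]].
exists ((1 + 1) + t).+2; split; first by lia.
rewrite rev_cons cat_rcons; apply: RunWhileF ht; first by apply/eqP; rewrite /= an.
by case: (b); ops.
Qed.

Lemma drain_copy (V K : seq sym) : all (fun a : sym => a != ord0) K ->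
  does (drain i1 (CSeq (push i0) (push i2))) [:: V; K; [::]; [::]]
    [:: rev K ++ V; [::]; rev K; [::]] (5 * size K + 2).
Proof.
move=> nz r; suff: forall C, exists t, t <= 5 * size K + 1 /\
    run (CWhile ord0 (CSeq (CSeq (push i0) (push i2)) (pop i1)))
      (head ord0 K, [:: V; behead K; C; [::]]) (ord0, [:: rev K ++ V; [::]; rev K ++ C; [::]]) t.
  case/(_ [::])=> t [le ht]; exists ord0, (1 + t); split; first by lia.
  by rewrite cats0 in ht; apply: RunSeq ht; apply: run_op.
elim: K V nz => [|a K IH] V /=; first by exists 1; split=> //; apply: RunWhileT.
case/andP=> /negPf an /(IH (a :: V)) {}IH C; have [t [le ht]] := IH (a :: C).
exists (((1 + 1) + 1) + t).+2; split; first by lia.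
rewrite rev_cons !cat_rcons; apply: RunWhileF ht; first by apply/eqP; rewrite /= an.
by ops.
Qed.

Lemma drain_count (V C : seq sym) : all (fun a : sym => a != ord0) C ->
  does (drain i2 (push i1)) [:: V; [::]; C; [::]] [:: V; rev C; [::]; [::]] (4 * size C + 2).
Proof.
move=> nz r; suff: forall K, exists t, t <= 4 * size C + 1 /\
    run (CWhile ord0 (CSeq (push i1) (pop i2)))
      (head ord0 C, [:: V; K; behead C; [::]]) (ord0, [:: V; rev C ++ K; [::]; [::]]) t.
  case/(_ [::])=> t [le ht]; exists ord0, (1 + t); split; first by lia.
  by rewrite cats0 in ht; apply: RunSeq ht; apply: run_op.
elim: C nz => [|a C IH] /=; first by exists 1; split=> //; apply: RunWhileT.
case/andP=> /negPf an /IH {}IH K; have [t [le ht]] := IH (a :: K).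
exists ((1 + 1) + t).+2; split; first by lia.
rewrite rev_cons !cat_rcons; apply: RunWhileF ht; first by apply/eqP; rewrite /= an.
by ops.
Qed.

Lemma drain_drop (V K : seq sym) : all (fun a : sym => a != ord0) K ->
  does (drain i1 skip) [:: V; K; [::]; [::]] [:: V; [::]; [::]; [::]] (4 * size K + 2).
Proof.
move=> nz r; suff: exists t, t <= 4 * size K + 1 /\
    run (CWhile ord0 (CSeq skip (pop i1)))
      (head ord0 K, [:: V; behead K; [::]; [::]]) (ord0, [:: V; [::]; [::]; [::]]) t.
  case=> t [le ht]; exists ord0, (1 + t); split; first by lia.
  by apply: RunSeq ht; apply: run_op.
elim: K nz => [|a K IH] /=; first by exists 1; split=> //; apply: RunWhileT.
case/andP=> /negPf an /IH[t [le ht]].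
exists ((1 + 1) + t).+2; split; first by lia.
apply: RunWhileF ht; first by apply/eqP; rewrite /= an.
by ops.
Qed.

Definition vals V : seq (seq sym) := [:: V; [::]; [::]; [::]].

Definition dup :=
  CSeq (walk true) (CSeq (drain i1 (CSeq (push i0) (push i2)))
    (CSeq (drain i2 (push i1)) (drain i1 (push i0)))).

Lemma rev_neq0 x : all (fun a : sym => a != ord0) (rev (ser x)).
Proof. by rewrite all_rev ser_neq0. Qed.

Lemma does_dup x L : does dup (vals (ser x ++ L)) (vals (ser x ++ ser x ++ L))
  (20 * size (ser x) + 8).
Proof.
have h1 := @does_walk true x L [::] [::]; rewrite cats0 in h1.
have h2 := @drain_copy L _ (rev_neq0 x); rewrite revK size_rev in h2.
have h3 := @drain_count (ser x ++ L) _ (ser_neq0 x).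
have h4 := @drain_buffer true (ser x ++ L) _ [::] [::] (rev_neq0 x); rewrite revK size_rev in h4.
by apply: does_le (does_seq h1 (does_seq h2 (does_seq h3 h4))); lia.
Qed.

Definition drop_top := CSeq (walk true) (drain i1 skip).

Lemma does_drop x L : does drop_top (vals (ser x ++ L)) (vals L) (11 * size (ser x) + 4).
Proof.
have h1 := @does_walk true x L [::] [::]; rewrite cats0 in h1.
have h2 := @drain_drop L _ (rev_neq0 x); rewrite size_rev in h2.
by apply: does_le (does_seq h1 h2); lia.
Qed.

Definition swap :=
  CSeq (walk true) (CSeq (walk false) (CSeq (drain i1 (push i0)) (drain i3 (push i0)))).

Lemma does_swap x y L : does swap (vals (ser x ++ ser y ++ L)) (vals (ser y ++ ser x ++ L))
  (11 * (size (ser x) + size (ser y)) + 8).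
Proof.
have h1 := @does_walk true x (ser y ++ L) [::] [::]; rewrite cats0 in h1.
have h2 := @does_walk false y L [::] (rev (ser x)); rewrite cats0 in h2.
have h3 := @drain_buffer true L _ [::] (rev (ser y)) (rev_neq0 x); rewrite revK size_rev in h3.
have h4 := @drain_buffer false (ser x ++ L) _ [::] [::] (rev_neq0 y); rewrite revK size_rev in h4.
by apply: does_le (does_seq h1 (does_seq h2 (does_seq h3 h4))); lia.
Qed.

Fixpoint put_tree (x : tree) : com :=
  match x with
  | TNil => put a1
  | TCons x y => CSeq (put_tree y) (CSeq (put_tree x) (put a2))
  end.

Lemma does_put_tree x V B C I :
  does (put_tree x) [:: V; B; C; I] [:: ser x ++ V; B; C; I] (2 * size (ser x)).
Proof.
elim: x V => [|x hx y hy] V; first exact: does_put.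
rewrite /= -catA size_cat.
have h := does_seq (hy V) (does_seq (hx _) (@does_put a2 _ B C I isT)).
by apply: does_le h; lia.
Qed.

(** * Functions with bounded cost *)

Class coded (T : Type) := code : T -> tree.

(** Unary coding: the time may be polynomial in the cap, so nothing is lost, and arithmetic reduces
    to lists of units. *)
Fixpoint code_nat_ (n : nat) : tree := if n is n'.+1 then TCons TNil (code_nat_ n') else TNil.
#[global] Instance code_nat : coded nat := code_nat_.
#[global] Instance code_unit : coded unit := fun=> TNil.
#[global] Instance code_bool : coded bool := fun b => if b then TCons TNil TNil else TNil.
#[global] Instance code_prod A B `{coded A} `{coded B} : coded (A * B) :=
  fun p => TCons (code p.1) (code p.2).
#[global] Instance code_seq A `{coded A} : coded (seq A) :=
  foldr (fun x t => TCons (code x) t) TNil.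

Definition csize {A} `{coded A} (a : A) := size (ser (code a)).
Arguments csize : simpl never.

Section Csize.
Context {A B : Type} `{coded A} `{coded B}.
Lemma csize_gt0 (a : A) : 0 < csize a.
Proof. by rewrite /csize; case: (code a). Qed.
Lemma ser_pair (a : A) (b : B) : ser (code (a, b)) = a2 :: ser (code a) ++ ser (code b).
Proof. by []. Qed.
Lemma ser_cons (a : A) (s : seq A) : ser (code (a :: s)) = a2 :: ser (code a) ++ ser (code s).
Proof. by []. Qed.
Lemma csize_pair (a : A) (b : B) : csize (a, b) = (csize a + csize b).+1.
Proof. by rewrite /csize /= size_cat. Qed.
Lemma csize_cons (a : A) (s : seq A) : csize (a :: s) = (csize a + csize s).+1.
Proof. by rewrite /csize /= size_cat. Qed.
Lemma csize_nil : csize ([::] : seq A) = 1.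
Proof. by []. Qed.
Lemma csize_cat (s t : seq A) : (csize (s ++ t)).+1 = csize s + csize t.
Proof. by elim: s => [|x s IH]; rewrite /= ?csize_cons ?csize_nil //; lia. Qed.
Lemma csize_rev (s : seq A) : csize (rev s) = csize s.
Proof.
elim: s => // x s IH; rewrite rev_cons -cats1 csize_cons.
by have := csize_cat (rev s) [:: x]; rewrite csize_cons csize_nil IH; lia.
Qed.
Lemma csize_filter p (s : seq A) : csize (filter p s) <= csize s.
Proof. by elim: s => //= x s IH; case: (p x); rewrite !csize_cons; lia. Qed.
Lemma csize_map_le (f : B -> A) m (s : seq B) : (forall x1 x x2, s = x1 ++ x :: x2 -> csize (f x) <= m) ->
  csize (map f s) <= size s * m.+1 + 1.
Proof.
elim: s => [//|x s IH] h /=; rewrite csize_cons mulSn.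
have := h [::] x s erefl; have := IH (fun x1 y x2 e => h (x :: x1) y x2 (f_equal (cons x) e)).
by lia.
Qed.
Lemma csize_mem (x1 x2 : seq A) x : csize x < csize (x1 ++ x :: x2).
Proof. by elim: x1 => [|y x1 IH] /=; rewrite csize_cons; lia. Qed.
Lemma size_csize (s : seq A) : size s < csize s.
Proof. by elim: s => //= a s IH; rewrite csize_cons; have := csize_gt0 a; lia. Qed.
End Csize.

Lemma csize_nat (n : nat) : csize n = n.*2.+1.
Proof. by elim: n => // n; rewrite /csize /= => ->; lia. Qed.
Lemma leq_expl m n k : m <= n -> m ^ k <= n ^ k.
Proof. by case: k => // k; rewrite leq_exp2r. Qed.

(** The base is at least 2, so a single exponent absorbs constants, sums and products. *)
Definition pb {A} (X F : A -> nat) := exists k, forall a, F a <= (X a + 2) ^ k.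

Section Pb.
Context {A : Type}.
Implicit Types X Y F G : A -> nat.

Lemma pb_le X F G : (forall a, F a <= G a) -> pb X G -> pb X F.
Proof. by move=> le [k h]; exists k => a; apply: leq_trans (h a). Qed.

Lemma pb_id X : pb X X.
Proof. by exists 1 => a; rewrite expn1; lia. Qed.

Lemma pb_const X n : pb X (fun=> n).
Proof.
exists n => a; apply: ltnW; apply: (leq_trans (ltn_expl n (erefl : 1 < 2))).
by apply: leq_expl; lia.
Qed.

Lemma pb_mul X F G : pb X F -> pb X G -> pb X (fun a => F a * G a).
Proof. by move=> [k hk] [l hl]; exists (k + l) => a; rewrite expnD leq_mul. Qed.

Lemma pb_add X F G : pb X F -> pb X G -> pb X (fun a => F a + G a).
Proof.
move=> [k hk] [l hl]; exists (k + l).+1 => a; rewrite expnS expnD.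
have := hk a; have := hl a; set Y := X a + 2.
have h0 i : 0 < Y ^ i by rewrite expn_gt0 /Y; lia.
move: (h0 k) (h0 l); move: (Y ^ k) (Y ^ l) => u v u0 v0 h1 h2.
have : u * v * 2 <= Y * (u * v) by rewrite mulnC leq_mul2r /Y; lia.
by nia.
Qed.

Lemma pb_exp X F k : pb X F -> pb X (fun a => F a ^ k).
Proof. by move=> [l h]; exists (l * k) => a; rewrite expnM leq_expl. Qed.

Lemma pb_trans X Y F : pb X Y -> pb Y F -> pb X F.
Proof.
move=> hY [l hl].
have [m hm] : pb X (fun a => Y a + 2) by apply: pb_add (pb_const _ _).
by exists (m * l) => a; rewrite expnM; apply: leq_trans (hl a) (leq_expl _ _).
Qed.

Lemma pb_sub X Y F : (forall a, X a <= Y a) -> pb X F -> pb Y F.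
Proof. by move=> le; apply: pb_trans; apply: pb_le (pb_id _). Qed.

End Pb.

Lemma pb_pre A B (f : A -> B) X F : pb X F -> pb (fun a => X (f a)) (fun a => F (f a)).
Proof. by case=> k h; exists k => a. Qed.

Definition computes {A B} `{coded A} `{coded B} c (f : A -> B) F :=
  forall a L, does c (vals (ser (code a) ++ L)) (vals (ser (code (f a)) ++ L)) (F a).

(* [T] accounts for what is not polynomial in the size of the argument: both the
   running time and the size of the result are polynomial in [csize a + T a]. *)
Definition Cost {A B} `{coded A} `{coded B} (f : A -> B) (T : A -> nat) :=
  exists c F, [/\ computes c f F, pb (fun a => csize a + T a) F &
                  pb (fun a => csize a + T a) (fun a => csize (f a))].

Notation FP f := (Cost f (fun=> 0)).

Lemma Cost_mono {A B} `{coded A} `{coded B} (f g : A -> B) T T' :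
  (forall a, f a = g a) -> pb (fun a => csize a + T' a) T ->
  Cost f T -> Cost g T'.
Proof.
move=> e le [c [F [h1 h2 h3]]]; exists c, F.
have hp : pb (fun a => csize a + T' a) (fun a => csize a + T a).
  by apply: pb_add le; apply: pb_sub (pb_id _) => a; apply: leq_addr.
split; [by move=> a L; rewrite -e | exact: pb_trans h2|].
by apply: pb_le (pb_trans hp h3) => a; rewrite e.
Qed.

Lemma Cost_le {A B} `{coded A} `{coded B} (f : A -> B) T T' :
  (forall a, T a <= T' a) -> Cost f T -> Cost f T'.
Proof.
by move=> le; apply: Cost_mono => //; apply: pb_le (pb_id _) => a; apply: leq_trans (le a) (leq_addl _ _).
Qed.

Lemma pb_r {A} (X Y F : A -> nat) : pb X F -> pb (fun a => X a + Y a) F.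
Proof. by apply: pb_sub => a; apply: leq_addr. Qed.

Ltac pbs := repeat first [assumption | apply: pb_id | apply: pb_const | apply: pb_add | apply: pb_mul | apply: pb_exp].

Section Combinators.
Context {A B C : Type} `{coded A} `{coded B} `{coded C}.

Lemma pb_cs (T : A -> nat) : pb (fun a => csize a + T a) (fun a => csize a).
Proof. exact: pb_r (pb_id _). Qed.

Lemma Cost_comp (f : A -> B) (g : B -> C) T T' :
  Cost f T -> Cost g T' -> Cost (fun a => g (f a)) (fun a => T a + T' (f a)).
Proof.
move=> [c [F [f1 f2 f3]]] [d [G [g1 g2 g3]]].
pose (X := fun a : A => csize a + (T a + T' (f a))).
have hf Y : pb (fun a => csize a + T a) Y -> pb X Y.
  by apply: pb_sub => a; rewrite /X; lia.
have hg Y : pb (fun b => csize b + T' b) Y -> pb X (fun a => Y (f a)).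
  move=> /(pb_pre f); apply: pb_trans; apply: pb_add (hf _ f3) _.
  by apply: pb_le (pb_id _) => a; rewrite /X; lia.
exists (CSeq c d), (fun a => F a + G (f a)); split.
- by move=> a L; apply: does_seq (f1 a L) (g1 _ L).
- by apply: pb_add; [apply: hf | apply: hg].
- exact: (hg _ g3).
Qed.

Lemma FP_id : FP (@id A).
Proof.
exists skip, (fun=> 1); split; [|exact: pb_const|exact: pb_cs].
by move=> a L r; exists ord0, 1; split=> //; ops.
Qed.

Lemma FP_const (b : B) : FP (fun _ : A => b).
Proof.
exists (CSeq drop_top (put_tree (code b))), (fun a => 11 * csize a + 4 + 2 * csize b).
split; [|by pbs; apply: pb_cs | exact: pb_const].
by move=> a L; apply: does_seq (does_drop _ _) (does_put_tree _ _ _ _ _).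
Qed.

Lemma Cost_pair (f : A -> B) (g : A -> C) T T' :
  Cost f T -> Cost g T' -> Cost (fun a => (f a, g a)) (fun a => T a + T' a).
Proof.
move=> [c [F [f1 f2 f3]]] [d [G [g1 g2 g3]]].
pose (X := fun a : A => csize a + (T a + T' a)).
have hf Y : pb (fun a => csize a + T a) Y -> pb X Y.
  by apply: pb_sub => a; rewrite /X; lia.
have hg Y : pb (fun a => csize a + T' a) Y -> pb X Y.
  by apply: pb_sub => a; rewrite /X; lia.
exists (CSeq dup (CSeq d (CSeq swap (CSeq c (put a2))))),
  (fun a => 20 * csize a + 8 + (G a + (11 * (csize (g a) + csize a) + 8 + (F a + 2)))).
split.
- move=> a L; apply: does_seq (does_dup _ _) _; apply: does_seq (g1 a _) _.
  apply: does_seq (does_swap _ _ _) _; apply: does_seq (f1 a _) _.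
  by rewrite /= -catA; apply: does_put.
- by pbs; first [exact: hf | exact: hg | exact: pb_cs].
- have h : pb X (fun a => csize (f a) + csize (g a) + 1).
    by pbs; [exact: hf | exact: hg].
  by apply: pb_le h => a; rewrite csize_pair addn1.
Qed.

Lemma does_pop a V B0 C0 I : does (pop i0) [:: a :: V; B0; C0; I] [:: V; B0; C0; I] 1.
Proof. by move=> r; exists a, 1; split=> //; ops. Qed.

Lemma FP_fst : FP (@fst A B).
Proof.
exists (CSeq (pop i0) (CSeq swap drop_top)),
  (fun p => 1 + (11 * (csize p.1 + csize p.2) + 8 + (11 * csize p.2 + 4))).
have h1 : pb (fun p : A * B => csize p + 0) (fun p => csize p.1).
  by apply: pb_le (pb_id _) => -[x y]; rewrite csize_pair /=; lia.
have h2 : pb (fun p : A * B => csize p + 0) (fun p => csize p.2).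
  by apply: pb_le (pb_id _) => -[x y]; rewrite csize_pair /=; lia.
split=> //; last by pbs.
move=> [a b] L; rewrite /= -catA; apply: does_seq (does_pop _ _ _ _ _) _.
by apply: does_seq (does_swap _ _ _) (does_drop _ _).
Qed.

Lemma FP_snd : FP (@snd A B).
Proof.
exists (CSeq (pop i0) drop_top), (fun p => 1 + (11 * csize p.1 + 4)).
have h1 : pb (fun p : A * B => csize p + 0) (fun p => csize p.1).
  by apply: pb_le (pb_id _) => -[x y]; rewrite csize_pair /=; lia.
have h2 : pb (fun p : A * B => csize p + 0) (fun p => csize p.2).
  by apply: pb_le (pb_id _) => -[x y]; rewrite csize_pair /=; lia.
split=> //; last by pbs.
by move=> [a b] L; rewrite /= -catA; apply: does_seq (does_pop _ _ _ _ _) (does_drop _ _).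
Qed.

(** The program is the identity. A cons cell has the code of the pair of its head and tail, and a
    number has that of a list of units, so converting between them is free. *)
Lemma FP_recode (f : A -> B) : (forall a, code (f a) = code a) -> FP f.
Proof.
move=> e; have [c [F [h1 h2 h3]]] := FP_id; exists c, F; split=> //.
  by move=> a L; rewrite e; apply: h1.
by apply: pb_le h3 => a; rewrite /csize e.
Qed.

Definition peek_if c1 c2 := CSeq (pop i0) (CIf a2 c1 c2).

Lemma does_peekT c1 c2 V s T : does c1 (vals V) s T ->
  does (peek_if c1 c2) (vals (a2 :: V)) s (T + 3).
Proof.
move=> h r; have [r' [t [le ht]]] := h a2; exists r', (1 + t.+1); split; first by lia.
by apply: RunSeq; [apply: run_op | apply: RunIfT].
Qed.

Lemma does_peekF c1 c2 V s T : does c2 (vals V) s T ->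
  does (peek_if c1 c2) (vals (a1 :: V)) s (T + 3).
Proof.
move=> h r; have [r' [t [le ht]]] := h a1; exists r', (1 + t.+2); split; first by lia.
by apply: RunSeq; [apply: run_op | apply: RunIfF].
Qed.

Lemma Cost_if (b : A -> bool) (f g : A -> B) T0 T1 T2 :
  Cost b T0 -> Cost f T1 -> Cost g T2 ->
  Cost (fun a => if b a then f a else g a) (fun a => T0 a + (T1 a + T2 a)).
Proof.
move=> [e [E [b1 b2 b3]]] [c [F [f1 f2 f3]]] [d [G [g1 g2 g3]]].
pose (X := fun a : A => csize a + (T0 a + (T1 a + T2 a))).
have hb Y : pb (fun a => csize a + T0 a) Y -> pb X Y.
  by apply: pb_sub => a; rewrite /X; lia.
have hf Y : pb (fun a => csize a + T1 a) Y -> pb X Y.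
  by apply: pb_sub => a; rewrite /X; lia.
have hg Y : pb (fun a => csize a + T2 a) Y -> pb X Y.
  by apply: pb_sub => a; rewrite /X; lia.
exists (CSeq dup (CSeq e (peek_if (CSeq (pop i0) (CSeq (pop i0) c)) d))),
  (fun a => 20 * csize a + 8 + (E a + (2 + (F a + G a) + 3))).
split.
- move=> a L; apply: does_seq (does_dup _ _) _; apply: does_seq (b1 a _) _.
  case: (b a); last by apply: does_le (does_peekF _ (g1 a L)); lia.
  apply: (@does_le _ _ _ (1 + (1 + F a) + 3)); first by lia.
  apply: does_peekT => //.
  by apply: does_seq (does_pop _ _ _ _ _) (does_seq (does_pop _ _ _ _ _) (f1 a L)).
- by pbs; first [exact: hf | exact: hg | exact: hb | exact: pb_cs].
- have h : pb X (fun a => csize (f a) + csize (g a)).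
    by pbs; [exact: hf | exact: hg].
  by apply: pb_le h => a; case: (b a); lia.
Qed.

Lemma Cost_seq (s : A -> seq C) (f : A -> B) (g : A * (C * seq C) -> B) T0 T1 T2 :
  Cost s T0 -> Cost f T1 -> Cost g T2 ->
  Cost (fun a => if s a is x :: r then g (a, (x, r)) else f a)
    (fun a => T0 a + (T1 a + if s a is x :: r then T2 (a, (x, r)) else 0)).
Proof.
move=> [e [E [b1 b2 b3]]] [c [F [f1 f2 f3]]] [d [G [g1 g2 g3]]].
pose (X := fun a : A => csize a + (T0 a + (T1 a + if s a is x :: r then T2 (a, (x, r)) else 0))).
have hb Y : pb (fun a => csize a + T0 a) Y -> pb X Y.
  by apply: pb_sub => a; rewrite /X; lia.
have hf Y : pb (fun a => csize a + T1 a) Y -> pb X Y.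
  by apply: pb_sub => a; rewrite /X; lia.
have hg Y : pb (fun a => csize a + T2 a) Y ->
    pb X (fun a => if s a is x :: r then Y (a, (x, r)) else 0).
  case=> k hk.
  have h : pb X (fun a => csize (s a) + 1 + X a).
    by pbs; apply: hb.
  have [l hl] := h.
  have [m hm] : pb X (fun a => (X a + 2) ^ l + 2).
    by apply: pb_add (pb_const _ _); exists l.
  exists (m * k) => a; case es: (s a) => [//|x r]; rewrite expnM.
  apply: leq_trans (hk _) (leq_expl _ _); apply: leq_trans (hm a).
  rewrite leq_add2r; apply: leq_trans (hl a).
  by rewrite /X es csize_cons !csize_pair; lia.
(* The [a2] consumed by the test is pushed back, which makes the exposed head and tail a pair; after
   the swap with [a], one more [a2] forms the argument of [g]. *)
exists (CSeq dup (CSeq e (peek_if (CSeq (put a2) (CSeq swap (CSeq (put a2) d))) (CSeq skip c)))),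
  (fun a => 20 * csize a + 8 + (E a +
     (2 + (11 * (csize (s a) + csize a) + 8) + 2 + 1 + F a
      + (if s a is x :: r then G (a, (x, r)) else 0) + 3))).
split.
- move=> a L; apply: does_seq (does_dup _ _) _; apply: does_seq (b1 a _) _.
  case: (s a) => [|x r].
    have hs : does skip (vals (ser (code a) ++ L)) (vals (ser (code a) ++ L)) 1.
      by move=> r; exists ord0, 1; split=> //; ops.
    by apply: does_le (does_peekF _ (does_seq hs (f1 a L))); lia.
  pose proof (@does_put a2 (ser (code x) ++ ser (code r) ++ ser (code a) ++ L) [::] [::] [::] isT) as h1.
  have h2 : does swap
      (vals (a2 :: ser (code x) ++ ser (code r) ++ ser (code a) ++ L))
      (vals (ser (code a) ++ ser (code (x, r)) ++ L)) (11 * (csize (x, r) + csize a) + 8).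
    rewrite (_ : a2 :: _ = ser (code (x, r)) ++ ser (code a) ++ L); first exact: does_swap.
    by rewrite ser_pair cat_cons -catA.
  pose proof (@does_put a2 (ser (code a) ++ ser (code (x, r)) ++ L) [::] [::] [::] isT) as h3.
  have h4 := g1 (a, (x, r)) L.
  rewrite ser_pair cat_cons -catA in h4.
  have h := does_peekT (CSeq skip c) (does_seq h1 (does_seq h2 (does_seq h3 h4))).
  rewrite ser_cons cat_cons -catA; apply: does_le h.
  by rewrite csize_cons csize_pair; lia.
- by pbs; first [exact: hf | exact: (hg _ g2) | exact: hb | exact: pb_cs].
- have h : pb X (fun a => csize (f a) + (if s a is x :: r then csize (g (a, (x, r))) else 0)).
    by pbs; [exact: (hf _ f3) | exact: (hg _ g3)].
  by apply: pb_le h => a; case: (s a) => [|x r]; lia.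
Qed.

End Combinators.

Section Loop.
Context {X A : Type} `{coded X} `{coded A}.
Variable h : X * A -> A.
Let fold a s := foldl (fun a x => h (x, a)) a s.

(** The register holds the root symbol of the remaining list, [a2] as long as it is nonempty.
    Pushing it twice turns the exposed head, tail and accumulator into [((x, s), a)]. After [G], the
    first pop removes the root of the resulting pair and the second fetches the root of the new
    list, so the loop ends on [a1]. *)
Definition loop_body G := CSeq (push i0) (CSeq (push i0) (CSeq G (CSeq (pop i0) (pop i0)))).
Definition loop G := CSeq (pop i0) (CWhile a1 (loop_body G)).

Lemma does_loop G F : computes G (fun p => (p.1.2, h (p.1.1, p.2))) F ->
  forall s a m L, (forall s1 x s2, s = s1 ++ x :: s2 -> F ((x, s2), fold a s1) <= m) ->
  does (loop G) (vals (ser (code s) ++ ser (code a) ++ L)) (vals (ser (code (fold a s)) ++ L))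
    (size s * (m + 6) + 2).
Proof.
move=> hG s a m L hm r0.
enough (loopP : forall V r,
    (r, V) = (head ord0 (ser (code s)), behead (ser (code s)) ++ ser (code a) ++ L) ->
    exists r' t, t <= size s * (m + 6) + 1 /\
    run (CWhile a1 (loop_body G)) (r, vals V) (r', vals (ser (code (fold a s)) ++ L)) t).
  have [] := loopP _ _ erefl => r' [t [le ht]]; exists r', (1 + t); split; first by lia.
  by apply: RunSeq ht; apply: run_op; case: (s).
elim: s a hm => [|x s IH] a hm V r [-> ->].
  by exists a1, 1; split=> //; apply: RunWhileT.
have hm' : forall s1 y s2, s = s1 ++ y :: s2 -> F ((y, s2), fold (h (x, a)) s1) <= m.
  by move=> s1 y s2 e; apply: (hm (x :: s1)); rewrite e.
have [r' [t [le ht]]] := IH _ hm' _ _ erefl.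
have [r1 [t1 [le1 ht1]]] := hG ((x, s), a) L a2.
have le2 : F ((x, s), a) <= m by apply: (hm [::]).
move: (F _) le1 le2 => u le1 le2.
exists r', ((1 + (1 + (t1 + (1 + 1)))) + t).+2; split; first by rewrite [size _]/= mulSn; lia.
apply: RunWhileF ht => //.
apply: RunSeq; first by apply: run_op.
apply: RunSeq; first by apply: run_op.
apply: RunSeq.
  by move: ht1; rewrite !ser_pair !cat_cons -!catA; apply.
apply: RunSeq; first by apply: run_op.
by apply: run_op; case: (s).
Qed.

(** Iterating a polynomial-time step can blow up the accumulator, so [M] has to bound it after every
    prefix of the list. *)
Lemma Cost_loop (Th : X * A -> nat) (M : seq X * A -> nat) : Cost h Th ->
  (forall s a s1 x s2, s = s1 ++ x :: s2 -> Th (x, fold a s1) + csize (fold a s1) <= M (s, a)) ->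
  (forall s a, csize (fold a s) <= M (s, a)) ->
  Cost (fun p => fold p.2 p.1) M.
Proof.
move=> hh hM hE.
have hb : Cost (fun p : X * seq X * A => (p.1.2, h (p.1.1, p.2))) (fun p => Th (p.1.1, p.2)).
  pose proof (Cost_comp (FP_fst (A := X * seq X) (B := A)) (FP_fst (A := X) (B := seq X))) as h11.
  pose proof (Cost_comp (FP_fst (A := X * seq X) (B := A)) (FP_snd (A := X) (B := seq X))) as h12.
  pose proof (FP_snd (A := X * seq X) (B := A)) as h2.
  by apply: (Cost_le _ (Cost_pair h12 (Cost_comp (Cost_pair h11 h2) hh))).
have [G [F [g1 g2 _]]] := hb.
have [k hk] := g2.
exists (CSeq (pop i0) (loop G)).
pose (Y := fun p : seq X * A => csize p + M p).
have bm (p : seq X * A) s1 x s2 : p.1 = s1 ++ x :: s2 ->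
    F ((x, s2), fold p.2 s1) <= (csize p + M p + M p + 4) ^ k.
  case: p => s a /= e; apply: leq_trans (hk _) (leq_expl _ _) => /=.
  have := hM s a s1 x s2 e; rewrite !csize_pair => h1.
  have : csize x + csize s2 < csize s.
    rewrite e; elim: (s1) => [|y s3 IH] /=; first by rewrite csize_cons.
    by rewrite csize_cons; lia.
  lia.
exists (fun p => 1 + (size p.1 * ((csize p + M p + M p + 4) ^ k + 6) + 2)); split.
- move=> [s a] L; rewrite ser_pair cat_cons -catA.
  apply: does_seq (does_pop _ _ _ _ _) _.
  by apply: (does_loop g1 (s := s) (a := a)) => s1 x s2 e; apply: (bm (s, a)).
- have h1 : pb Y (fun p => size p.1).
    apply: (pb_le _ (pb_id _)) => -[s a]; rewrite /Y csize_pair /=.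
    by pose proof (size_csize s); lia.
  have h2 : pb Y (fun p => (csize p + M p + M p + 4) ^ k).
    have : pb Y (fun p => csize p + M p + M p + 2).
      by pbs; apply: (pb_le _ (pb_id _)) => p; rewrite /Y; lia.
    by move=> /pb_trans; apply; exists k => p; apply: leq_expl; lia.
  by apply: pb_add (pb_const _ _) (pb_add (pb_mul h1 (pb_add h2 (pb_const _ _))) (pb_const _ _)).
- apply: (pb_le _ (pb_id _)) => -[s a] /=.
  by apply: leq_trans (hE s a) (leq_addl _ _).
Qed.
End Loop.

Lemma Cost_foldl {E A X} `{coded E} `{coded A} `{coded X}
    (h : E * (A * X) -> A) (a0 : E -> A) (s : E -> seq X) Th T0 T1 (M : E -> nat) :
  Cost h Th -> Cost a0 T0 -> Cost s T1 ->
  let acc e s1 := foldl (fun a x => h (e, (a, x))) (a0 e) s1 in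
  (forall e s1 x s2, s e = s1 ++ x :: s2 -> Th (e, (acc e s1, x)) + csize (acc e s1) <= M e) ->
  (forall e, csize (acc e (s e)) <= M e) ->
  Cost (fun e => acc e (s e)) (fun e => T0 e + (T1 e + M e)).
Proof.
move=> hh h0 hs acc hM hE.
pose proof (FP_fst (A := X) (B := E * A)) as e1.
pose proof (FP_snd (A := X) (B := E * A)) as e2.
pose proof (Cost_comp e2 (FP_fst (A := E) (B := A))) as f1.
pose proof (Cost_comp e2 (FP_snd (A := E) (B := A))) as f2.
pose proof (Cost_pair f1 (Cost_comp (Cost_pair f1 (Cost_pair f2 e1)) hh)) as hh'.
(* The loop body sees only an element and the accumulator, so the environment travels inside the
   accumulator. *)
pose (h' := fun p : X * (E * A) => (p.2.1, h (p.2.1, (p.2.2, p.1)))).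
have fE e a t : foldl (fun a x => h' (x, a)) (e, a) t = (e, foldl (fun a x => h (e, (a, x))) a t).
  by elim: t a => //= x t IH a; rewrite IH.
(* [Cost_loop] asks for a bound on every list and initial accumulator, even those that come from no
   [e]. The maximum over all prefixes is such a bound, and [M e] controls it on
   [(s e, (e, a0 e))]. *)
pose (Ms := fun p : seq X * (E * A) =>
  \max_(i < (size p.1).+1) (csize (foldl (fun a x => h' (x, a)) p.2 (take i p.1)) +
     if drop i p.1 is x :: _ then
       Th (let q := foldl (fun a x => h' (x, a)) p.2 (take i p.1) in (q.1, (q.2, x))) else 0)).
have hl : Cost (fun p => foldl (fun a x => h' (x, a)) p.2 p.1) Ms.
  apply: (Cost_loop (h := h') hh').
  - move=> t a s1 x s2 e; rewrite /Ms /=.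
    have lt : size s1 < (size t).+1 by rewrite e size_cat /= ltnS leq_addr.
    apply: leq_trans (leq_bigmax (Ordinal lt)); rewrite /= e take_size_cat // drop_size_cat //.
    by rewrite addnC.
  - move=> t a; apply: leq_trans (leq_bigmax (@Ordinal (size t).+1 (size t) (ltnSn _))).
    by rewrite /= take_size leq_addr.
pose proof (Cost_comp (Cost_comp (Cost_pair hs (Cost_pair (FP_id (A := E)) h0)) hl) (FP_snd (A := E) (B := A))) as hfin; move: hfin.
apply: Cost_mono; first by move=> e; rewrite /= fE.
have hM2 e : Ms (s e, (e, a0 e)) <= M e + M e + csize e + 1.
  apply/bigmax_leqP => -[i /= lt] _; rewrite fE /= -/(acc e (take i (s e))) csize_pair.
  case ed: (drop i (s e)) => [|x t].
    have -> : take i (s e) = s e by rewrite -[RHS](cat_take_drop i) ed cats0.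
    by have := hE e; lia.
  have := hM e (take i (s e)) x t; rewrite -ed cat_take_drop => /(_ erefl); lia.
apply: (@pb_le _ _ _ (fun e => (csize e + (T0 e + (T1 e + M e))) * 3 + 1)); last by pbs.
by move=> e; have := hM2 e; lia.
Qed.

(* Unlike [have := t], this resolves the [coded] instances occurring in [t]. *)
Tactic Notation "note" constr(t) := generalize t.

(** * Closure properties of polynomial-time functions *)

Section Closure.
Context {E A B : Type} `{coded E} `{coded A} `{coded B}.

Lemma FP_comp (g : A -> B) (f : E -> A) : FP g -> FP f -> FP (fun e => g (f e)).
Proof. by move=> hg hf; apply: (Cost_le _ (Cost_comp hf hg)). Qed.

Lemma FP_pair (f : E -> A) (g : E -> B) : FP f -> FP g -> FP (fun e => (f e, g e)).
Proof. by move=> hf hg; apply: (Cost_le _ (Cost_pair hf hg)). Qed.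

Lemma FP_ext (f g : E -> A) : f =1 g -> FP f -> FP g.
Proof. by move=> e; apply: Cost_mono => //; apply: pb_const. Qed.

Lemma FP_if (b : E -> bool) (f g : E -> A) : FP b -> FP f -> FP g ->
  FP (fun e => if b e then f e else g e).
Proof. by move=> hb hf hg; apply: (Cost_le _ (Cost_if hb hf hg)). Qed.

Lemma FP_case (s : E -> seq A) (f : E -> B) (g : E -> A -> seq A -> B) :
  FP s -> FP f -> FP (fun p : E * (A * seq A) => g p.1 p.2.1 p.2.2) ->
  FP (fun e => if s e is x :: r then g e x r else f e).
Proof.
by move=> hs hf hg; apply: (Cost_le _ (Cost_seq hs hf hg)) => e; case: (s e).
Qed.

Lemma FP_foldl (h : E -> A -> B -> A) (a0 : E -> A) (s : E -> seq B) (M : E -> nat) :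
  FP (fun p : E * (A * B) => h p.1 p.2.1 p.2.2) -> FP a0 -> FP s -> pb (@csize E _) M ->
  (forall e s1 s2, s e = s1 ++ s2 -> csize (foldl (h e) (a0 e) s1) <= M e) ->
  FP (fun e => foldl (h e) (a0 e) (s e)).
Proof.
move=> hh h0 hs hM hb.
pose proof (Cost_foldl (M := M) hh h0 hs) as hf; move: hf => /= hf.
apply: Cost_mono (hf _ _) => //.
- by pbs; apply: pb_trans hM; apply: pb_sub (pb_id _) => a; rewrite addn0.
- by move=> e s1 x s2 /hb; rewrite add0n.
- by move=> e; apply: (hb e (s e) [::]); rewrite cats0.
Qed.

End Closure.

Section Fields.
Context {E A B : Type} `{coded E} `{coded A} `{coded B}.
Lemma FP_fst' (f : E -> A * B) : FP f -> FP (fun e => (f e).1).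
Proof. by move=> hf; apply: (FP_comp FP_fst hf). Qed.
Lemma FP_snd' (f : E -> A * B) : FP f -> FP (fun e => (f e).2).
Proof. by move=> hf; apply: (FP_comp FP_snd hf). Qed.
Lemma FP_cons (f : E -> A) (s : E -> seq A) : FP f -> FP s -> FP (fun e => f e :: s e).
Proof.
move=> hf hs; refine (FP_comp (g := fun p : A * seq A => p.1 :: p.2) _ (FP_pair hf hs)).
exact: FP_recode.
Qed.
End Fields.

Lemma FP_unary {E} `{coded E} (f : E -> nat) : FP f -> FP (fun e => nseq (f e) tt).
Proof.
by move=> hf; refine (FP_comp (g := fun n => nseq n tt) _ hf); apply: FP_recode; elim=> // n /(f_equal (TCons TNil)).
Qed.
Lemma FP_count {E} `{coded E} (f : E -> seq unit) : FP f -> FP (fun e => size (f e)).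
Proof.
move=> hf; refine (FP_comp (g := @size unit) _ hf); apply: FP_recode.
by elim=> // -[] s /(f_equal (TCons TNil)).
Qed.
Lemma FP_succ {E} `{coded E} (f : E -> nat) : FP f -> FP (fun e => (f e).+1).
Proof.
move=> hf; have h := FP_count (FP_cons (FP_const tt) (FP_unary hf)).
by apply: (FP_ext _ h) => e; rewrite /= size_nseq.
Qed.

(* Placeholders, extended as closure lemmas become available. *)
Ltac fp_lists := fail.
Ltac fp_arith := fail.
Ltac fp_parse := fail.
Ltac fp_rules := fail.
Ltac fp1 := first
  [ assumption
  | match goal with H : Cost ?a _ |- Cost (fun q => ?a (@?g q)) _ =>
      refine (FP_comp (g := a) (f := g) H _) end
  | simple eapply FP_const
  | exact FP_id
  | simple eapply FP_pair
  | simple eapply FP_fst'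
  | simple eapply FP_snd'
  | simple eapply FP_cons
  | simple eapply FP_succ
  | simple eapply FP_if
  | simple eapply FP_case
  | fp_lists | fp_arith | fp_parse | fp_rules ].
Ltac fp := repeat fp1.

Section Bool.
Context {E : Type} `{coded E}.
Implicit Types b c : E -> bool.
Lemma FP_and b c : FP b -> FP c -> FP (fun e => b e && c e).
Proof. by move=> hb hc; apply: (FP_if hb hc (FP_const false)). Qed.
Lemma FP_or b c : FP b -> FP c -> FP (fun e => b e || c e).
Proof. by move=> hb hc; apply: (FP_if hb (FP_const true) hc). Qed.
Lemma FP_not b : FP b -> FP (fun e => ~~ b e).
Proof. by move=> hb; apply: (FP_if hb (FP_const false) (FP_const true)). Qed.
End Bool.


Lemma FP_size {E A} `{coded E} `{coded A} (f : E -> A) : FP f -> pb (@csize E _) (fun e => csize (f e)).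
Proof. by move=> [c [F [_ _ h]]]; apply: pb_trans h; apply: (pb_le _ (pb_id _)) => e; rewrite addn0. Qed.

Lemma foldl_cons A (a u : seq A) : foldl (fun a x => x :: a) a u = rev u ++ a.
Proof. by elim: u a => //= x u IH a; rewrite IH rev_cons cat_rcons. Qed.

Lemma FP_rev {E A} `{coded E} `{coded A} (s : E -> seq A) : FP s -> FP (fun e => rev (s e)).
Proof.
move=> hs.
apply: (FP_ext (f := fun e => foldl (fun a x => x :: a) [::] (s e))); first by move=> e; rewrite foldl_cons cats0.
refine (FP_foldl (h := fun _ a x => x :: a) (a0 := fun=> [::]) _ _ hs (FP_size hs) _); try by fp.
by move=> e s1 s2 ->; rewrite foldl_cons cats0 csize_rev; note (csize_cat s1 s2); note (csize_gt0 s2); lia.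
Qed.

Section Lists.
Context {E A B : Type} `{coded E} `{coded A} `{coded B}.

Lemma FP_map (f : E -> A -> B) (s : E -> seq A) :
  FP (fun p : E * A => f p.1 p.2) -> FP s -> FP (fun e => map (f e) (s e)).
Proof.
move=> hf hs.
have fE e t : foldl (fun a x => f e x :: a) [::] t = rev (map (f e) t).
  by elim/last_ind: t => //= t x IH; rewrite foldl_rcons IH map_rcons rev_rcons.
have [c [F [_ _ [k hk]]]] := hf.
have hM : pb (@csize E _) (fun e => csize (s e) * ((csize e + csize (s e) + 4) ^ k).+1 + 1).
  apply: (pb_le (G := fun e => csize (s e) * ((csize e + csize (s e) + 4) ^ k + 1) + 1)).
    by move=> e; rewrite !addn1.
  by note (FP_size hs) => *; pbs.
enough (h : FP (fun e => foldl (fun a x => f e x :: a) [::] (s e))).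
  by apply: (FP_ext _ (FP_rev h)) => e; rewrite fE revK.
refine (FP_foldl (h := fun e a x => f e x :: a) (a0 := fun=> [::]) _ _ hs hM _); try by fp.
  refine (FP_cons _ _); last by fp.
  refine (FP_comp (f := fun p : E * (seq B * A) => (p.1, p.2.2)) hf _); by fp.
move=> e s1 s2 es; rewrite fE csize_rev.
apply: leq_trans (csize_map_le (m := (csize e + csize (s e) + 4) ^ k) _) _.
  move=> x1 x x2 e1; apply: leq_trans (hk (e, x)) (leq_expl _ _).
  rewrite csize_pair; note (csize_mem x1 (x2 ++ s2) x).
  by rewrite es e1 -catA /=; lia.
rewrite leq_add2r leq_mul2r; apply/orP; right.
by rewrite es; note (size_csize (s1 ++ s2)); rewrite size_cat; lia.
Qed.

Lemma FP_filter (p : E -> A -> bool) (s : E -> seq A) :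
  FP (fun q : E * A => p q.1 q.2) -> FP s -> FP (fun e => filter (p e) (s e)).
Proof.
move=> hp hs.
have fE e t : foldl (fun a x => if p e x then x :: a else a) [::] t = rev (filter (p e) t).
  elim/last_ind: t => //= t x IH; rewrite foldl_rcons IH filter_rcons.
  by case: (p e x); rewrite ?rev_rcons.
enough (h : FP (fun e => foldl (fun a x => if p e x then x :: a else a) [::] (s e))).
  by apply: (FP_ext _ (FP_rev h)) => e; rewrite fE revK.
refine (FP_foldl (h := fun e a x => if p e x then x :: a else a) (a0 := fun=> [::]) _ _ hs (FP_size hs) _);
  try by fp.
  refine (FP_if _ _ _); try by fp.
  refine (FP_comp (f := fun p : E * (seq A * A) => (p.1, p.2.2)) hp _); by fp.
move=> e s1 s2 ->; rewrite fE csize_rev; apply: leq_trans (csize_filter _ _) _.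
by note (csize_cat s1 s2); note (csize_gt0 s2); lia.
Qed.

Lemma FP_has (p : E -> A -> bool) (s : E -> seq A) :
  FP (fun q : E * A => p q.1 q.2) -> FP s -> FP (fun e => has (p e) (s e)).
Proof.
move=> hp hs; apply: (FP_ext _ (FP_case (FP_filter hp hs) (FP_const false)
  (g := fun _ _ _ => true) (FP_const true))) => e.
by elim: (s e) => //= x t IH; case: (p e x).
Qed.

Lemma FP_all (p : E -> A -> bool) (s : E -> seq A) :
  FP (fun q : E * A => p q.1 q.2) -> FP s -> FP (fun e => all (p e) (s e)).
Proof.
move=> hp hs; have h := FP_not (FP_has (p := fun e x => ~~ p e x) (FP_not hp) hs).
by apply: (FP_ext _ h) => e; rewrite has_predC negbK.
Qed.

Lemma FP_cat (s t : E -> seq A) : FP s -> FP t -> FP (fun e => s e ++ t e).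
Proof.
move=> hs ht.
apply: (FP_ext (f := fun e => foldl (fun a x => x :: a) (t e) (rev (s e)))).
  by move=> e; rewrite foldl_cons revK.
have hM : pb (@csize E _) (fun e => csize (s e) + csize (t e)).
  by note (FP_size hs); note (FP_size ht) => *; pbs.
refine (FP_foldl (h := fun _ a x => x :: a) _ ht (FP_rev hs) hM _); first by fp.
move=> e s1 s2 es; rewrite foldl_cons.
note (csize_cat (rev s1) (t e)); rewrite csize_rev.
by note (csize_cat s1 s2); rewrite -es csize_rev; note (csize_gt0 s2); lia.
Qed.

End Lists.

Lemma FP_flatten {E A} `{coded E} `{coded A} (s : E -> seq (seq A)) : FP s -> FP (fun e => flatten (s e)).
Proof.
move=> hs.
have fE (u : seq (seq A)) : foldl (fun a x => x ++ a) [::] u = flatten (rev u).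
  by elim/last_ind: u => //= u x IH; rewrite foldl_rcons IH rev_rcons.
have cE (u : seq (seq A)) : csize (flatten u) <= csize u.
  elim: u => //= x u IH; rewrite csize_cons; note (csize_cat x (flatten u)).
  by lia.
apply: (FP_ext (f := fun e => foldl (fun a x => x ++ a) [::] (rev (s e)))).
  by move=> e; rewrite fE revK.
refine (FP_foldl (h := fun _ a x => x ++ a) (a0 := fun=> [::]) _ (FP_const _) (FP_rev hs) (FP_size hs) _).
  by apply: FP_cat; fp.
move=> e s1 s2 es; rewrite fE; apply: leq_trans (cE _) _; rewrite csize_rev.
by note (csize_cat s1 s2); rewrite -es csize_rev; note (csize_gt0 s2); lia.
Qed.

Ltac fp_lists ::= first
  [ simple eapply FP_and
  | simple eapply FP_or
  | simple eapply FP_not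
  | simple eapply FP_unary
  | simple eapply FP_count
  | simple eapply FP_rev
  | simple eapply FP_cat
  | simple eapply FP_flatten
  | simple eapply FP_map
  | simple eapply FP_filter
  | simple eapply FP_has
  | simple eapply FP_all ].

Lemma FP_length {E} `{coded E} {A} `{coded A} (s : E -> seq A) : FP s -> FP (fun e => size (s e)).
Proof.
move=> hs; have h : FP (fun e => size (map (fun=> tt) (s e))) by fp.
by apply: (FP_ext _ h) => e; rewrite size_map.
Qed.

Lemma FP_behead {E} `{coded E} {A} `{coded A} (s : E -> seq A) : FP s -> FP (fun e => behead (s e)).
Proof.
move=> hs; have h : FP (fun e => if s e is x :: r then r else [::]) by fp.
by apply: (FP_ext _ h) => e; case: (s e).
Qed.

Lemma FP_head {E} `{coded E} {A} `{coded A} (x0 : A) (s : E -> seq A) : FP s -> FP (fun e => head x0 (s e)).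
Proof.
move=> hs; have h : FP (fun e => if s e is x :: r then x else x0) by fp.
by apply: (FP_ext _ h) => e; case: (s e).
Qed.

Lemma FP_nth {E} `{coded E} {A} `{coded A} (x0 : A) (s : E -> seq A) i : FP s -> FP (fun e => nth x0 (s e) i).
Proof.
elim: i s => [|i IH] s hs.
  by have h := FP_head x0 hs; apply: (FP_ext _ h) => e; case: (s e).
by have h := IH _ (FP_behead hs); apply: (FP_ext _ h) => e; rewrite nth_behead.
Qed.

Lemma FP_last {E} `{coded E} {A} `{coded A} (x0 : A) (s : E -> seq A) : FP s -> FP (fun e => last x0 (s e)).
Proof.
move=> hs; have h := FP_head x0 (FP_rev hs); apply: (FP_ext _ h) => e.
by elim/last_ind: (s e) => // t x _; rewrite rev_rcons last_rcons.
Qed.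

Lemma FP_addn {E} `{coded E} (m n : E -> nat) : FP m -> FP n -> FP (fun e => m e + n e).
Proof.
move=> hm hn; have h : FP (fun e => size (nseq (m e) tt ++ nseq (n e) tt)) by fp.
by apply: (FP_ext _ h) => e; rewrite size_cat !size_nseq.
Qed.

Lemma FP_pred {E} `{coded E} (n : E -> nat) : FP n -> FP (fun e => (n e).-1).
Proof.
move=> hn; have h := FP_count (FP_behead (FP_unary hn)).
by apply: (FP_ext _ h) => e; rewrite size_behead size_nseq.
Qed.

Lemma FP_subn {E} `{coded E} (m n : E -> nat) : FP m -> FP n -> FP (fun e => m e - n e).
Proof.
move=> hm hn.
have fE a (t : seq unit) : foldl (fun a _ => a.-1) a t = a - size t.
  by elim: t a => [|x t IH] a /=; rewrite ?subn0 // IH; lia.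
have h : FP (fun e => foldl (fun a _ => a.-1) (m e) (nseq (n e) tt)).
  refine (FP_foldl (h := fun _ a _ => a.-1) _ hm (FP_unary hn) (FP_size hm) _).
    by refine (FP_pred _); fp.
  by move=> e s1 s2 _; rewrite fE !csize_nat; lia.
by apply: (FP_ext _ h) => e; rewrite fE size_nseq.
Qed.

Lemma FP_leq {E} `{coded E} (m n : E -> nat) : FP m -> FP n -> FP (fun e => m e <= n e).
Proof.
move=> hm hn; have hs := FP_subn hm hn.
have h : FP (fun e => if nseq (m e - n e) tt is x :: r then false else true) by fp.
by apply: (FP_ext _ h) => e; rewrite /leq; case: (m e - n e).
Qed.

Lemma FP_eqn {E} `{coded E} (m n : E -> nat) : FP m -> FP n -> FP (fun e => m e == n e).
Proof.
move=> hm hn; have h := FP_and (FP_leq hm hn) (FP_leq hn hm).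
by apply: (FP_ext _ h) => e; rewrite eqn_leq.
Qed.

Lemma FP_minn {E} `{coded E} (m n : E -> nat) : FP m -> FP n -> FP (fun e => minn (m e) (n e)).
Proof.
by move=> hm hn; have := FP_if (FP_leq (FP_succ hm) hn) hm hn.
Qed.

Lemma FP_muln {E} `{coded E} (m n : E -> nat) : FP m -> FP n -> FP (fun e => m e * n e).
Proof.
move=> hm hn.
have h : FP (fun e => size (flatten [seq nseq (n e) tt | _ <- nseq (m e) tt])) by fp.
apply: (FP_ext _ h) => e; elim: (m e) => //= k IH.
by rewrite size_cat size_nseq IH mulSn.
Qed.

Lemma FP_zip {E} `{coded E} {A B} `{coded A} `{coded B} (s : E -> seq A) (t : E -> seq B) :
  FP s -> FP t -> FP (fun e => zip (s e) (t e)).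
Proof.
move=> hs ht.
pose g (st : seq B * seq (A * B)) (x : A) := if st.1 is y :: r then (r, (x, y) :: st.2) else st.
have fE (u : seq A) (v : seq B) o : foldl g (v, o) u = (drop (size u) v, rev (zip u v) ++ o).
  elim: u v o => [|x u IH] [|y v] o //=; rewrite IH /=; last by rewrite rev_cons cat_rcons.
  by case: (u).
have cE (u : seq A) (v : seq B) : csize (zip u v) <= csize u + csize v.
  elim: u v => [|x u IH] [|y v] //=; rewrite ?csize_nil ?csize_cons ?csize_pair; try by lia.
  by have := IH v; lia.
have hM : pb (@csize E _) (fun e => csize (s e) + csize (t e) + csize (t e) + 1).
  by note (FP_size hs); note (FP_size ht) => *; pbs.
have h : FP (fun e => foldl g (t e, [::]) (s e)).
  refine (FP_foldl (h := fun _ => g) (a0 := fun e => (t e, [::])) _ _ hs hM _); rewrite /g; fp.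
  move=> e s1 s2 es; rewrite fE cats0 csize_pair csize_rev.
  note (cE s1 (t e)); note (csize_cat s1 s2); note (csize_gt0 s2); rewrite -es.
  note (csize_cat (take (size s1) (t e)) (drop (size s1) (t e))); rewrite cat_take_drop.
  note (csize_gt0 (take (size s1) (t e))).
  by lia.
have h' : FP (fun e => rev (foldl g (t e, [::]) (s e)).2) by fp.
by apply: (FP_ext _ h') => e; rewrite fE cats0 revK.
Qed.

Lemma FP_eqseq {E} `{coded E} (s t : E -> seq nat) : FP s -> FP t -> FP (fun e => s e == t e).
Proof.
move=> hs ht.
have h1 : FP (fun e => all (fun p => p.1 == p.2) (zip (s e) (t e))).
  by refine (FP_all (p := fun _ p => p.1 == p.2) _ (FP_zip hs ht)); refine (FP_eqn _ _); fp.
have h := FP_and (FP_eqn (FP_length hs) (FP_length ht)) h1.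
apply: (FP_ext _ h) => e; elim: (s e) (t e) => [|x u IH] [|y v] //=.
by rewrite eqseq_cons -IH eqSS andbCA.
Qed.

Lemma FP_allpairs {E} `{coded E} {A B C} `{coded A} `{coded B} `{coded C} (f : E -> A -> B -> C)
    (s : E -> seq A) (t : E -> seq B) :
  FP (fun p : E * A * B => f p.1.1 p.1.2 p.2) -> FP s -> FP t ->
  FP (fun e => [seq f e x y | x <- s e, y <- t e]).
Proof.
move=> hf hs ht; apply: FP_flatten.
refine (FP_map (f := fun e x => [seq f e x y | y <- t e]) _ hs).
refine (FP_map (f := fun (p : E * A) y => f p.1 p.2 y) hf _).
by fp.
Qed.


Ltac fp_arith ::= first
  [ simple eapply FP_length | simple eapply FP_behead | simple eapply FP_head
  | simple eapply FP_nth | simple eapply FP_last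
  | simple eapply FP_addn | simple eapply FP_eqn | simple eapply FP_eqseq
  | simple eapply FP_leq | simple eapply FP_subn | simple eapply FP_minn | simple eapply FP_muln
  | simple eapply FP_zip | simple eapply FP_allpairs ].

(** * The saturation algorithm *)

Notation str := (seq nat).

(* A separator terminates a piece; a last unterminated piece is kept. *)
Definition splits (a : nat) (w : str) : seq str :=
  foldr (fun (c : nat) acc => if c == a then [::] :: acc
                      else (c :: head [::] acc) :: behead acc) [::] w.

Definition sec i w := nth [::] (splits 7 w) i.
Definition rules i w := [seq splits 3 r | r <- splits 5 (sec i w)].
(** States are handled through the numerals that name them in the input, without decoding. Every
    piece of the word is a candidate, vector entries included; a piece survives the saturation only
    if it names a leaf state or the source of a rule. *)
Definition cand w := flatten [seq splits 3 r | r <- flatten [seq splits 5 s | s <- splits 7 w]].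

(* Value of a binary numeral, truncated at [cap]; the sign is ignored. *)
Definition tokval cap (t : str) :=
  foldr (fun (c : nat) acc => if c == 4 then acc
                      else minn cap (acc + acc + (if c == 2 then 1 else 0))) 0 t.

Definition entry_ok cap x1 x (t : str) :=
  if has (fun c : nat => c == 4) t then x1 + tokval cap t <= x else x1 <= x + tokval cap t.

Definition vec_ok cap (v1 v : seq nat) (us : seq str) :=
  all (fun p => entry_ok cap p.1 p.2.1 p.2.2) (zip v1 (zip v us)).
Definition vec_le (v1 v : seq nat) := all (fun p => p.1 <= p.2) (zip v1 v).
Definition vec_add_le (v1 v2 v : seq nat) := all (fun p => p.1 + p.2.1 <= p.2.2) (zip v1 (zip v2 v)).
Definition vec0 (v : seq nat) := all (fun x : nat => x == 0) v.

Notation bconf := (str * seq nat)%type.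

(* One-step justification from [S]; the inequalities are complete because [S] stands
   for its upward closure. *)
Definition ok_leaf w (c : bconf) := has (fun q => c.1 == q) (splits 3 (sec 7 w)).
Definition ok_unary w cap S (c : bconf) :=
  has (fun r => (head [::] r == c.1) &&
    has (fun c1 : bconf => (last [::] r == c1.1) && vec_ok cap c1.2 c.2 (behead r)) S) (rules 2 w).
Definition ok_fork w S (c : bconf) :=
  has (fun r => (head [::] r == c.1) &&
    (has (fun c1 : bconf => (nth [::] r 1 == c1.1) && vec_le c1.2 c.2) S &&
     has (fun c2 : bconf => (nth [::] r 2 == c2.1) && vec_le c2.2 c.2) S)) (rules 3 w).
Definition ok_split w S (c : bconf) :=
  has (fun r => (head [::] r == c.1) &&
    has (fun c1 : bconf => (nth [::] r 1 == c1.1) &&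
      has (fun c2 : bconf => (nth [::] r 2 == c2.1) && vec_add_le c1.2 c2.2 c.2) S) S) (rules 4 w).
Definition ok_zero w S (c : bconf) :=
  has (fun r => (head [::] r == c.1) &&
    has (fun c1 : bconf => (nth [::] r 1 == c1.1) && vec0 c1.2) S) (rules 5 w).

Definition ok w cap S c :=
  [|| ok_leaf w c, ok_unary w cap S c, ok_fork w S c, ok_split w S c | ok_zero w S c].

Definition box w (vs : seq (seq nat)) : seq bconf := [seq (q, v) | q <- cand w, v <- vs].
(* As many rounds as there are configurations in the box, so the result is closed. *)
Definition saturate w cap vs :=
  foldl (fun S (_ : bconf) => filter (ok w cap S) (box w vs)) [::] (box w vs).
Definition answer w cap vs :=
  has (fun c : bconf => (c.1 == head [::] (splits 3 (sec 6 w))) && vec0 c.2) (saturate w cap vs).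

(** * Polynomial cost of the saturation *)

Section Parsing.
Context {E : Type} `{coded E}.

Lemma FP_foldr {A B} `{coded A} `{coded B} (h : E -> B -> A -> A) (a0 : E -> A) (s : E -> seq B) (M : E -> nat) :
  FP (fun p : E * (A * B) => h p.1 p.2.2 p.2.1) -> FP a0 -> FP s -> pb (@csize E _) M ->
  (forall e s1 s2, s e = s1 ++ s2 -> csize (foldr (h e) (a0 e) s2) <= M e) ->
  FP (fun e => foldr (h e) (a0 e) (s e)).
Proof.
move=> hh h0 hs hM hb.
have h1 : FP (fun e => foldl (fun a x => h e x a) (a0 e) (rev (s e))).
  refine (FP_foldl (h := fun e a x => h e x a) hh h0 (FP_rev hs) hM _).
  move=> e s1 s2 es; rewrite -(revK s1) foldl_rev; apply: (hb e (rev s2)).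
  by rewrite -rev_cat -es revK.
by apply: (FP_ext _ h1) => e; rewrite foldl_rev.
Qed.

Lemma csize_splits a w : csize (splits a w) <= 2 * csize w.
Proof.
elim: w => //= c w IH; rewrite csize_cons; case: ifP => _.
  by rewrite csize_cons csize_nil; lia.
rewrite !csize_cons; note (csize_gt0 c); move: IH.
by case: (splits a w) => [|x r] /=; rewrite ?csize_cons ?csize_nil; lia.
Qed.

Lemma FP_splits a (f : E -> str) : FP f -> FP (fun e => splits a (f e)).
Proof.
move=> hf; have hM : pb (@csize E _) (fun e => 2 * csize (f e)).
  by note (FP_size hf) => *; pbs.
refine (FP_foldr (h := fun _ (c : nat) acc => if c == a then [::] :: acc
                      else (c :: head [::] acc) :: behead acc) (a0 := fun=> [::]) _ _ hf hM _); fp.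
move=> e s1 s2 es; apply: leq_trans (csize_splits a s2) _.
by note (csize_cat s1 s2); note (csize_gt0 s1); rewrite -es; lia.
Qed.
End Parsing.

Ltac fp_parse ::= simple eapply FP_splits.

Section Sections.
Context {E : Type} `{coded E}.
Implicit Types (w : E -> str) (cap : E -> nat) (S : E -> seq bconf) (c : E -> bconf).

Lemma FP_sec i w : FP w -> FP (fun e => sec i (w e)).
Proof. by move=> hw; rewrite /sec; fp. Qed.

Lemma FP_rules i w : FP w -> FP (fun e => rules i (w e)).
Proof.
by move=> hw; have h := FP_sec i hw; rewrite /rules; fp.
Qed.

Lemma FP_cand w : FP w -> FP (fun e => cand (w e)).
Proof. by move=> hw; rewrite /cand; fp. Qed.
End Sections.

Lemma tokval_le cap t : tokval cap t <= cap.
Proof. by elim: t => //= c t IH; case: ifP => // _; apply: geq_minl. Qed.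

Lemma FP_tokval {E} `{coded E} (cap : E -> nat) t : FP cap -> FP t -> FP (fun e => tokval (cap e) (t e)).
Proof.
move=> hc ht.
refine (FP_foldr (h := fun e (c : nat) acc => if c == 4 then acc
   else minn (cap e) (acc + acc + (if c == 2 then 1 else 0))) (a0 := fun=> 0) _ _ ht (FP_size hc) _); fp.
by move=> e s1 s2 _; rewrite !csize_nat; have := tokval_le (cap e) s2; rewrite /tokval; lia.
Qed.

Lemma FP_entry_ok {E} `{coded E} (cap x1 x : E -> nat) t :
  FP cap -> FP x1 -> FP x -> FP t -> FP (fun e => entry_ok (cap e) (x1 e) (x e) (t e)).
Proof. by move=> h1 h2 h3 h4; have h := FP_tokval h1 h4; rewrite /entry_ok; fp. Qed.

Lemma FP_vec_ok {E} `{coded E} (cap : E -> nat) v1 v us :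
  FP cap -> FP v1 -> FP v -> FP us -> FP (fun e => vec_ok (cap e) (v1 e) (v e) (us e)).
Proof.
move=> h1 h2 h3 h4.
refine (FP_all (p := fun e p => entry_ok (cap e) p.1 p.2.1 p.2.2) (s := fun e => zip (v1 e) (zip (v e) (us e))) _ _).
  by refine (FP_entry_ok _ _ _ _); fp.
by fp.
Qed.

Lemma FP_vec_le {E} `{coded E} (v1 v : E -> seq nat) : FP v1 -> FP v -> FP (fun e => vec_le (v1 e) (v e)).
Proof. by move=> h1 h2; rewrite /vec_le; fp. Qed.

Lemma FP_vec_add_le {E} `{coded E} (v1 v2 v : E -> seq nat) :
  FP v1 -> FP v2 -> FP v -> FP (fun e => vec_add_le (v1 e) (v2 e) (v e)).
Proof. by move=> h1 h2 h3; rewrite /vec_add_le; fp. Qed.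

Lemma FP_vec0 {E} `{coded E} (v : E -> seq nat) : FP v -> FP (fun e => vec0 (v e)).
Proof. by move=> h1; rewrite /vec0; fp. Qed.

Ltac fp_rules ::= first
  [ simple eapply FP_sec | simple eapply FP_rules | simple eapply FP_cand
  | simple eapply FP_vec_ok | simple eapply FP_vec_le | simple eapply FP_vec_add_le
  | simple eapply FP_vec0 ].

Section Rules.
Context {E : Type} `{coded E}.
Implicit Types (w : E -> str) (cap : E -> nat) (S : E -> seq bconf) (c : E -> bconf).

Lemma FP_ok w cap S c : FP w -> FP cap -> FP S -> FP c ->
  FP (fun e => ok (w e) (cap e) (S e) (c e)).
Proof.
move=> hw hcap hS hc; rewrite /ok.
have h1 : FP (fun e => ok_leaf (w e) (c e)) by rewrite /ok_leaf; fp.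
have h2 : FP (fun e => ok_unary (w e) (cap e) (S e) (c e)) by rewrite /ok_unary; fp.
have h3 : FP (fun e => ok_fork (w e) (S e) (c e)) by rewrite /ok_fork; fp.
have h4 : FP (fun e => ok_split (w e) (S e) (c e)) by rewrite /ok_split; fp.
have h5 : FP (fun e => ok_zero (w e) (S e) (c e)) by rewrite /ok_zero; fp.
by fp.
Qed.
End Rules.

Section Answer.
Context {E : Type} `{coded E}.
Implicit Types (w : E -> str) (cap : E -> nat).

(** The accumulator of the saturation is always a sublist of the box, hence polynomial in the
    arguments. The exponentials are thereby confined to the computation of the cap and of the
    vectors. *)
Lemma FP_answer w cap vs : FP w -> FP cap -> FP vs ->
  FP (fun e => answer (w e) (cap e) (vs e)).
Proof.
move=> hw hcap hvs.
have hb : FP (fun e => box (w e) (vs e)) by rewrite /box; fp.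
have hs : FP (fun e => saturate (w e) (cap e) (vs e)).
  refine (FP_foldl (h := fun e S _ => filter (ok (w e) (cap e) S) (box (w e) (vs e)))
    (a0 := fun=> [::]) _ _ hb (FP_size hb) _); last first.
  - move=> e s1 s2 _; case/lastP: s1 => [|s1 x]; first exact: csize_gt0.
    by rewrite foldl_rcons; apply: csize_filter.
  - exact: FP_const.
  refine (FP_filter (p := fun (q : E * (seq bconf * bconf)) c => ok (w q.1) (cap q.1) q.2.1 c) _ _).
    by refine (FP_ok _ _ _ _); fp.
  by refine (FP_comp (g := fun e => box (w e) (vs e)) hb _); fp.
by rewrite /answer; fp.
Qed.
End Answer.

(** * Computing the cap and the vectors of the box *)

Definition pow2 (k : nat) := foldl (fun a (_ : unit) => a + a) 1 (nseq k tt).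

Lemma pow2E k : pow2 k = 2 ^ k.
Proof.
have h a : foldl (fun a (_ : unit) => a + a) a (nseq k tt) = 2 ^ k * a.
  by elim: k a => [|k IH] a /=; rewrite ?mul1n // IH expnS; lia.
by rewrite /pow2 h muln1.
Qed.

Lemma Cost_pow2 : Cost pow2 (fun k => 2 ^ k).
Proof.
pose proof (Cost_foldl (h := fun p : nat * (nat * unit) => p.2.1 + p.2.1) (a0 := fun=> 1)
  (s := fun k => nseq k tt) (M := fun k => (2 ^ k).*2.+1) (Th := fun=> 0) (T0 := fun=> 0) (T1 := fun=> 0)) as h.
have fE (s : seq unit) a : foldl (fun a (_ : unit) => a + a) a s = 2 ^ size s * a.
  by elim: s a => [|x s IH] a /=; rewrite ?mul1n // IH expnS; lia.
apply: Cost_mono (h _ _ _ _ _) => //.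
- by apply: (@pb_le _ _ _ (fun k => (2 ^ k + 2 ^ k + 1)));
    [move=> k; lia | pbs; apply: (pb_le _ (pb_id _)) => k; lia].
- by refine (FP_addn _ _); fp.
- by fp.
- by fp.
- move=> k s1 x s2 e; rewrite csize_nat fE muln1 add0n !ltnS leq_double leq_exp2l //.
  by rewrite -(size_nseq k tt) e size_cat leq_addr.
- by move=> k; rewrite csize_nat fE size_nseq muln1.
Qed.

(* The cap on coordinates: it dominates the Rackoff bound [max_height] below, and its
   [d]-th value is a [d]-fold exponential. *)
Definition height n d := iter d (fun z => 2 ^ (n * z)) n.

Definition capB (w : str) :=
  foldl (fun z (_ : nat) => pow2 ((size w).+1 * z)) (size w).+1 (sec 1 w).

Lemma heightS n d : height n d.+1 = 2 ^ (n * height n d).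
Proof. by []. Qed.

Lemma height_leS n d : 0 < n -> height n d <= height n d.+1.
Proof.
move=> n0; rewrite heightS; apply: leq_trans (ltnW (ltn_expl (height n d) (erefl : 1 < 2))) _.
by rewrite leq_exp2l // leq_pmull.
Qed.

Lemma height_mono n d d' : 0 < n -> d <= d' -> height n d <= height n d'.
Proof.
move=> n0; elim: d' => [|d' IH]; first by rewrite leqn0 => /eqP->.
rewrite leq_eqVlt => /orP[/eqP->//|]; rewrite ltnS => /IH le.
exact: leq_trans le (height_leS _ _).
Qed.

Lemma foldl_height n (s : seq nat) d :
  foldl (fun z (_ : nat) => pow2 (n * z)) (height n d) s = height n (d + size s).
Proof.
by elim: s d => [|x s IH] d /=; rewrite ?addn0 // pow2E -heightS IH addSnnS.
Qed.

Lemma capBE w : capB w = height (size w).+1 (size (sec 1 w)).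
Proof. by rewrite /capB -[X in foldl _ X]/(height (size w).+1 0) foldl_height. Qed.

Lemma Cost_capB : Cost capB (fun w => height (size w).+1 (size (sec 1 w))).
Proof.
have aE (w s : str) : foldl (fun a x => pow2 ((size (w, (a, x)).1).+1 * (w, (a, x)).2.1)) (size w).+1 s
    = height (size w).+1 (size s) by exact: (@foldl_height (size w).+1 s 0).
pose proof (Cost_foldl (h := fun p : str * (nat * nat) => pow2 ((size p.1).+1 * p.2.1))
  (a0 := fun w : str => (size w).+1) (s := fun w => sec 1 w)
  (M := fun w => 3 * height (size w).+1 (size (sec 1 w)) + 1)
  (Th := fun p => 2 ^ ((size p.1).+1 * p.2.1)) (T0 := fun=> 0) (T1 := fun=> 0)) as h.
apply: Cost_mono (h _ _ _ _ _) => //.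
- by pbs; apply: (pb_le _ (pb_id _)) => w; rewrite leq_addl.
- have hm : FP (fun p : str * (nat * nat) => (size p.1).+1 * p.2.1) by fp.
  by apply: (Cost_le _ (Cost_comp hm Cost_pow2)).
- by fp.
- by apply: FP_sec; fp.
- move=> w s1 x s2 e; rewrite aE /=.
  rewrite csize_nat -heightS e size_cat /=.
  have := @height_mono (size w).+1 (size s1).+1 (size s1 + (size s2).+1) isT.
  have := height_leS (n := (size w).+1) (size s1) isT.
  by move=> h1 /(_ ltac:(lia)) h2; rewrite -heightS; lia.
- by move=> w; rewrite aE csize_nat; lia.
Qed.

(** The length of the accumulator is the next number to insert. *)
Definition rng B := foldl (fun a (_ : unit) => size a :: a) [::] (nseq B tt).

Lemma rngE B : rng B = rev (iota 0 B).
Proof.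
rewrite /rng; elim: B => // B IH; rewrite -[B.+1]addn1 nseqD foldl_cat IH /=.
by rewrite size_rev size_iota iotaD rev_cat.
Qed.

Lemma csize_rng B : csize (rev (iota 0 B)) <= B * (2 * B + 2) + 1.
Proof.
have h m : B <= m -> csize (rev (iota 0 B)) <= B * (2 * m + 2) + 1.
  elim: B => [//|B IH] lt; rewrite -addn1 iotaD rev_cat /= csize_cons csize_nat.
  by have := IH (ltnW lt); lia.
exact: h.
Qed.

Lemma FP_rng {E} `{coded E} (B : E -> nat) : FP B -> FP (fun e => rng (B e)).
Proof.
move=> hB.
have hM : pb (@csize E _) (fun e => csize (B e) * (2 * csize (B e) + 2) + 1).
  by note (FP_size hB) => *; pbs.
refine (FP_foldl (h := fun _ a (_ : unit) => size a :: a) (a0 := fun=> [::]) _ (FP_const _) (FP_unary hB) hM _).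
  by fp.
move=> e s1 s2 es.
have -> : s1 = nseq (size s1) tt by elim: (s1) => [|[] t IH] //=; rewrite -IH.
rewrite -/(rng _) rngE; apply: leq_trans (csize_rng _) _; rewrite csize_nat.
have : size s1 <= B e by rewrite -(size_nseq (B e) tt) es size_cat leq_addr.
move: (size s1) => m le; rewrite leq_add2r leq_mul //; lia.
Qed.

Definition vecs B (ds : seq nat) :=
  foldl (fun vs (_ : nat) => [seq x :: v | x <- rng B.+1, v <- vs]) [:: [::]] ds.

Lemma mem_vecs B ds v : (v \in vecs B ds) = (size v == size ds) && all (fun x => x <= B) v.
Proof.
elim/last_ind: ds v => [|ds x IH] v; first by case: v => //= x v; rewrite inE.
rewrite /vecs foldl_rcons -/(vecs B ds) size_rcons.
apply/allpairsP/idP => [[[y u] [/= hy hu ->]]|].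
  rewrite /= eqSS; move: hu hy; rewrite IH rngE mem_rev mem_iota => /andP[-> ->].
  by rewrite ltnS andbT => ->.
case: v => [|y u] //=; rewrite eqSS => /and3P[h1 h2 h3]; exists (y, u).
by rewrite /= IH h1 h3 rngE mem_rev mem_iota.
Qed.

Lemma size_vecs B ds : size (vecs B ds) = B.+1 ^ size ds.
Proof.
elim/last_ind: ds => // ds x IH; rewrite /vecs foldl_rcons -/(vecs B ds) size_rcons.
by rewrite size_allpairs IH rngE size_rev size_iota expnS.
Qed.

(** There are [B.+1 ^ d] vectors, each with [d] unary entries of code size at most [2 * B + 1] and
    one more symbol per list cell. *)
Definition vecs_bound B d := B.+1 ^ d * (d * (2 * B + 2) + 2) + 1.

Lemma csize_vecs B ds : csize (vecs B ds) <= vecs_bound B (size ds).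
Proof.
rewrite /vecs_bound -size_vecs.
have h v : all (fun x => x <= B) v -> csize v <= size v * (2 * B + 2) + 1.
  elim: v => //= x v IH /andP[le /IH]; rewrite csize_cons csize_nat; lia.
have : all (fun v => csize v <= size ds * (2 * B + 2) + 1) (vecs B ds).
  by apply/allP => v; rewrite mem_vecs => /andP[/eqP<- /h].
elim: (vecs B ds) => //= v vs IH /andP[le /IH]; rewrite csize_cons mulSn; lia.
Qed.

Lemma vecs_bound_mono B d d' : d <= d' -> vecs_bound B d <= vecs_bound B d'.
Proof.
move=> le; rewrite leq_add2r leq_mul //; first by rewrite leq_pexp2l.
by rewrite leq_add2r leq_mul.
Qed.

Lemma Cost_vecs : Cost (fun p : nat * seq nat => vecs p.1 p.2) (fun p => vecs_bound p.1 (size p.2)).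
Proof.
pose proof (Cost_foldl
  (h := fun p : (nat * seq nat) * (seq (seq nat) * nat) => [seq x :: v | x <- rng p.1.1.+1, v <- p.2.1])
  (a0 := fun=> [:: [::]]) (s := fun p => p.2)
  (M := fun p => vecs_bound p.1 (size p.2)) (Th := fun=> 0) (T0 := fun=> 0) (T1 := fun=> 0)) as h.
apply: Cost_mono (h _ _ _ _ _) => //.
- by apply: (pb_le _ (pb_id _)) => w /=; rewrite !add0n leq_addl.
- refine (FP_allpairs (f := fun _ x v => x :: v) _ (FP_rng _) _); by fp.
- by fp.
- by fp.
- move=> [B ds] s1 x s2 /= e; rewrite -/(vecs B s1) add0n.
  by apply: leq_trans (csize_vecs _ _) (vecs_bound_mono _ _); rewrite e size_cat leq_addr.
- by move=> [B ds]; apply: csize_vecs.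
Qed.

Definition decide (w : str) := answer w (capB w) (vecs (capB w) (sec 1 w)).

Lemma Cost_decide : Cost decide (fun w =>
  capB w + vecs_bound (capB w) (size (sec 1 w))).
Proof.
have h1 : FP (fun w : str => sec 1 w) by apply: FP_sec; fp.
pose proof (Cost_pair (FP_id (A := str)) (Cost_pair Cost_capB h1)) as h2.
have f1 : FP (fun p : str * (nat * str) => (p.1, p.2.1)) by fp.
have f2 : FP (fun p : str * (nat * str) => p.2) by fp.
pose proof (Cost_pair f1 (Cost_comp f2 Cost_vecs)) as h3.
have f3 : FP (fun p : (str * nat) * seq (seq nat) => answer p.1.1 p.1.2 p.2).
  by apply: FP_answer; fp.
pose proof (Cost_comp (Cost_comp h2 h3) f3) as h4.
by apply: (Cost_le _ h4) => w /=; rewrite -capBE; lia.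
Qed.

(** * Reading the input and assembling the machine *)

Definition read_letter (ks : seq nat) :=
  foldr (fun k c => CIf (inord k) (CSeq (put_tree (code k)) (put a2)) c) skip ks.

Lemma run_read_letter ks k V I : k < 8 -> all (fun i => i < 8) ks -> k \in ks ->
  exists r t, t <= 2 * size ks + 2 * csize k + 2 /\
    run (read_letter ks) (inord k, [:: V; [::]; [::]; I]) (r, [:: a2 :: ser (code k) ++ V; [::]; [::]; I]) t.
Proof.
move=> k8; elim: ks => //= k' ks IH /andP[k8' hks]; rewrite inE.
case: (k =P k') => [<- _|ne /= hk].
  pose proof (does_seq (does_put_tree (code k) V [::] [::] I)
    (@does_put a2 (ser (code k) ++ V) [::] [::] I isT)) as h.
  have [r [t [le ht]]] := h (inord k).
  exists r, t.+1; split; first by rewrite /csize; lia.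
  exact: RunIfT.
have [r [t [le ht]]] := IH hks hk; exists r, t.+2; split; first by lia.
apply: RunIfF ht => /= /(congr1 val) /=; rewrite !inordK //.
Qed.

(** The last letter of the input is on top of stack 3, so consing the letters as they are popped
    restores their original order. *)
Definition read_input :=
  CSeq (put a1) (CSeq (pop i3) (CWhile ord0 (CSeq (read_letter (iota 1 7)) (pop i3)))).

Lemma run_read_input w : all (fun k => 0 < k < 8) w ->
  exists r t, t <= 50 * size w + 4 /\ run read_input (init_m w) (r, vals (ser (code w))) t.
Proof.
move=> hw; rewrite /init_m.
enough (K : forall u (v : str), all (fun k => 0 < k < 8) u -> exists r t, t <= 50 * size u + 1 /\
   run (CWhile ord0 (CSeq (read_letter (iota 1 7)) (pop i3)))
     (head ord0 [seq (inord k : sym) | k <- u], [:: ser (code v); [::]; [::]; behead [seq (inord k : sym) | k <- u]])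
     (r, vals (ser (code (catrev u v)))) t).
  have [r [t [le ht]]] := K (rev w) [::] ltac:(by rewrite all_rev).
  rewrite size_rev in le; rewrite -/(rev (rev w)) revK map_rev in ht.
  exists r, ((1 + 1) + (1 + t)); split; first by lia.
  apply: RunSeq; first by ops.
  by apply: RunSeq ht; apply: run_op.
elim=> [|k u IH] v /=; first by exists ord0, 1; split=> //; apply: RunWhileT.
case/andP=> /andP[k0 k8] hu; have [r [t [le ht]]] := IH (k :: v) hu.
have kin : k \in iota 1 7 by rewrite mem_iota k0.
have [r1 [t1 [le1 ht1]]] := run_read_letter (ser (code v)) (behead (map (fun k => inord k : sym) (k :: u))) k8 (erefl : all (fun i => i < 8) (iota 1 7)) kin.
exists r, ((t1 + 1) + t).+2; split; first by rewrite csize_nat /= in le1; lia.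
apply: RunWhileF ht; first by move/(congr1 val); rewrite /= inordK //; lia.
apply: RunSeq; first exact: ht1.
by apply: run_op.
Qed.

Lemma tm_decide : exists (M : TM) K, forall w, all (fun k => 0 < k < 8) w ->
  exists t, t <= (size w + capB w + vecs_bound (capB w) (size (sec 1 w)) + 2) ^ K /\
    let s := cf_state (iter t (@tm_step M) (tm_init M w)) in
    tm_halted s /\ (s = tm_acc M <-> decide w).
Proof.
have [c [F [hc [k hk] _]]] := Cost_decide.
pose prog := CSeq read_input (CSeq c (pop i0)).
pose cd := compile 0 prog.
pose X w := size w + capB w + vecs_bound (capB w) (size (sec 1 w)).
have [K hK] : pb X (fun w => let t := 50 * size w + 4 + ((16 * X w + 3) ^ k + 1) in
    t * (2 * (size w + t) + 4) + 4).
  have hw : pb X size by apply: (pb_le _ (pb_id _)) => w; rewrite /X -addnA leq_addr.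
  by pbs.
exists (M cd), K => w hw.
(* A letter is at most 7, hence of code size at most 15, and its list cell adds one. *)
have csz : csize w <= 16 * size w + 1.
  elim: w hw => //= x w IH /andP[/andP[_ x8] /IH].
  by rewrite csize_cons csize_nat; lia.
have [r1 [t1 [le1 ht1]]] := run_read_input hw.
have [r2 [t2 [le2 ht2]]] := hc w [::] r1.
rewrite cats0 in ht2.
(* The root symbol of the coded Boolean is [a2], which equals [accsym], exactly when the answer is
   true. *)
have h3 : run (pop i0) (r2, vals (ser (code (decide w)) ++ [::]))
    (head ord0 (ser (code (decide w))), vals (behead (ser (code (decide w)) ++ [::]))) 1.
  by apply: run_op; rewrite cats0.
have ht := RunSeq ht1 (RunSeq ht2 h3).
have := compile_run ht (code := cd) (i := 0).
rewrite add0n => /(_ (ex_intro _ [::] (ex_intro _ [::] (conj _ erefl)))); rewrite cats0 => /(_ erefl).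
rewrite -(size_compile 0) => hrun.
have [t' [le' [s1 s2]]] := tm_run hw hrun.
exists t'; split; last first.
  by split=> //; rewrite s2 /=; case: (decide w).
apply: leq_trans (hK w); apply: leq_trans le' _ => /=.
have le3 : t2 <= (16 * X w + 3) ^ k.
  apply: leq_trans le2 _; apply: leq_trans (hk w) (leq_expl _ _).
  by rewrite /X; lia.
have le4 : t1 + (t2 + 1) <= 50 * size w + 4 + ((16 * X w + 3) ^ k + 1) by lia.
by rewrite leq_add2r leq_mul //; lia.
Qed.

(** * The Rackoff argument *)

Section Rackoff.
Variables (N d m : nat).
Notation state := 'I_N.
Notation vec := ('I_d -> nat).
(* Axiom states, and rules with two children: [None] splits the vector, [Some u]
   adds [u] for both children (unary rules repeat the child, forks have u = 0). *)
Variables (L : state -> Prop) (rl : state -> state -> state -> option ('I_d -> int) -> Prop).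
Hypothesis rl_le : forall q q1 q2 u, rl q q1 q2 (Some u) -> forall i, (- m%:Z <= u i <= m%:Z)%R.

(* Inequalities instead of equalities account for the lossy steps. *)
Definition splits_to (k : option ('I_d -> int)) (J : {set 'I_d}) (v v1 v2 : vec) :=
  forall i, i \in J -> match k with
    | None => v1 i + v2 i <= v i
    | Some u => ((v1 i)%:Z <= (v i)%:Z + u i)%R /\ ((v2 i)%:Z <= (v i)%:Z + u i)%R
    end.

(* Derivations of height [h] that only look at the coordinates in [J]. *)
Inductive der (C : nat -> Prop) (J : {set 'I_d}) : nat -> state -> vec -> Prop :=
| der_leaf h q v : L q -> der C J h q v
| der_rule h q q1 q2 k v v1 v2 : rl q q1 q2 k -> splits_to k J v v1 v2 ->
    (forall i, i \in J -> C (v1 i) /\ C (v2 i)) ->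
    der C J h q1 v1 -> der C J h q2 v2 -> der C J h.+1 q v.

Lemma splits_to_le k (J : {set 'I_d}) (v v1 v2 v' v1' v2' : vec) :
  (forall i, i \in J -> v i <= v' i) -> (forall i, i \in J -> v1' i <= v1 i) ->
  (forall i, i \in J -> v2' i <= v2 i) -> splits_to k J v v1 v2 -> splits_to k J v' v1' v2'.
Proof.
move=> le le1 le2 h i iJ; have := h i iJ; have := le i iJ; have := le1 i iJ; have := le2 i iJ.
by case: k {h} => [u|]; lia.
Qed.

Lemma der_mono C (J : {set 'I_d}) h h' q (v v' : vec) : h <= h' -> (forall i, i \in J -> v i <= v' i) ->
  der C J h q v -> der C J h' q v'.
Proof.
move=> leh lev H; elim: H h' v' leh lev => {h q v} [h q v Lq|h q q1 q2 k v v1 v2 r s c d1 h1 d2 h2] h' v' leh lev.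
  exact: der_leaf.
case: h' leh => // h' leh; apply: (der_rule (v1 := v1) (v2 := v2) r) => //.
- exact: splits_to_le s.
- exact: h1.
- exact: h2.
Qed.

Lemma der_sub C (J J' : {set 'I_d}) h q v : J' \subset J -> der C J h q v -> der C J' h q v.
Proof.
move/subsetP => sub; elim=> {h q v} [h q v Lq|h q q1 q2 k v v1 v2 r s c d1 h1 d2 h2].
  exact: der_leaf.
apply: (der_rule (v1 := v1) (v2 := v2) r) => // i iJ; [exact: s (sub _ iJ)|exact: c (sub _ iJ)].
Qed.

(* A large coordinate can be tracked through a short derivation ignoring it:
   each step loses at most [m] or half of it. *)
Lemma der_track (C : nat -> Prop) (J : {set 'I_d}) i h q (v : vec) : i \in J -> der C (J :\ i) h q v ->
  (forall h', h' < h -> C (m * 2 ^ h')) ->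
  forall v', (forall j, j \in J :\ i -> v j <= v' j) -> m * 2 ^ h <= v' i -> der C J h q v'.
Proof.
move=> iJ; elim=> {h q v} [h q v Lq|h q q1 q2 k v v1 v2 r s c d1 h1 d2 h2] hC v' le big.
  exact: der_leaf.
pose w (u : vec) j := if j == i then m * 2 ^ h else u j.
have hC' h' : h' < h -> C (m * 2 ^ h') by move=> lt; apply: hC; apply: ltnW.
have wi u : m * 2 ^ h <= w u i by rewrite /w eqxx.
have wj u j : j \in J :\ i -> u j <= w u j by rewrite !inE /w => /andP[/negPf->].
apply: (der_rule (v1 := w v1) (v2 := w v2) r).
- move=> j jJ; case: (j =P i) => [->|/eqP ne].
    have m1 : m <= m * 2 ^ h by rewrite leq_pmulr // expn_gt0.
    rewrite expnS in big; rewrite /w eqxx.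
    case: k r {s} => [u /rl_le /(_ i) h3|_]; last by lia.
    by split; lia.
  have jJi : j \in J :\ i by rewrite !inE ne.
  have := s j jJi; have := le j jJi; rewrite /w (negPf ne).
  by case: k {r s} => [u|]; lia.
- move=> j jJ; rewrite /w; case: (j =P i) => [_|/eqP ne]; first by split; apply: hC.
  by apply: c; rewrite !inE ne.
- by apply: h1 => // j; apply: wj.
- by apply: h2 => // j; apply: wj.
Qed.

(** * One level of the Rackoff induction: small and large vectors *)

Section Level.
Variables (J : {set 'I_d}) (B D h0 : nat).
Hypothesis DB : D <= B.
Notation C := (fun x => x <= B).
Definition derivable q v := exists h, der (fun=> True) J h q v.
Definition capped (v : vec) : vec := fun i => minn B (v i).
Definition large (v : vec) := exists2 i, i \in J & D < v i.
Definition small (v : vec) := forall i, i \in J -> v i <= D.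
Hypothesis der_large : forall q v, derivable q v -> large v -> der C J h0 q (capped v).

Notation small_conf := (state * {ffun 'I_d -> 'I_D.+1})%type.
(** [inord] distorts only values above [D]; a small vector has such values at most outside [J],
    where no condition is checked. *)
Definition trunc (v : vec) : {ffun 'I_d -> 'I_D.+1} := [ffun i => inord (v i)].
(** Large derivable configurations are granted from the start, since [der_large] supplies
    derivations of bounded height for them; only the finitely many small ones are generated in
    rounds. *)
Definition known (X : {set small_conf}) q v :=
  (large v /\ derivable q v) \/ (small v /\ (q, trunc v) \in X).
Definition next (X : {set small_conf}) : {set small_conf} :=
  [set c : small_conf | `[< L c.1 \/ exists q1 q2 k v1 v2, [/\ rl c.1 q1 q2 k,
     splits_to k J (fun i => c.2 i) v1 v2, known X q1 v1 & known X q2 v2] >] ].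

Lemma large_or_small v : large v \/ small v.
Proof.
case: (pselect (large v)) => [|nl]; [by left | right=> i iJ].
by rewrite leqNgt; apply/negP => lt; apply: nl; exists i.
Qed.

Lemma next_mono : {homo next : X Y / X \subset Y}.
Proof.
move=> X Y /subsetP sub; apply/subsetP => c; rewrite !inE => /asboolP[Lc|].
  by apply/asboolP; left.
case=> q1 [q2 [k [v1 [v2 [r s k1 k2]]]]]; apply/asboolP; right.
have kn q v : known X q v -> known Y q v by case=> [|[sm /sub]]; [left | right].
by exists q1, q2, k, v1, v2; split=> //; apply: kn.
Qed.

Lemma truncE v i : i \in J -> small v -> nat_of_ord (trunc v i) = v i.
Proof. by move=> iJ sm; rewrite ffunE inordK // ltnS sm. Qed.

Lemma derivable_known q v : derivable q v -> known (fixset next) q v.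
Proof.
case=> h; elim=> {h q v} [h q v Lq|h q q1 q2 k v v1 v2 r s c d1 h1 d2 h2].
  have [lg|sm] := large_or_small v; [left | right]; split=> //.
    by exists 0; apply: der_leaf.
  by rewrite -(fixsetK next_mono) inE; apply/asboolP; left.
have [lg|sm] := large_or_small v; [left | right]; split=> //.
  by exists h.+1; apply: der_rule r s c d1 d2.
rewrite -(fixsetK next_mono) inE; apply/asboolP; right.
exists q1, q2, k, v1, v2; split=> //.
by apply: splits_to_le s => // i iJ /=; rewrite truncE.
Qed.

Lemma known_der n q v : known (iter n next set0) q v -> der C J (h0 + n) q (capped v).
Proof.
elim: n q v => [|n IH] q v [[lg dv]|[sm]]; try by apply: (der_mono _ _ (der_large dv lg)); rewrite ?leq_addr.
  by rewrite inE.
rewrite inE => /asboolP /= [Lq|]; first exact: der_leaf.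
case=> q1 [q2 [k [v1 [v2 [r s /IH k1 /IH k2]]]]]; rewrite addnS.
apply: (der_rule r _ _ k1 k2); last by move=> i _; rewrite !geq_minl.
apply: splits_to_le s => i iJ /=; rewrite ?geq_minr //.
by rewrite truncE // /capped leq_min leqnn (leq_trans (sm i iJ) DB).
Qed.

(** Monotone iteration takes the place of cutting repetitions out of a derivation: the least fixed
    point of [next] is reached within as many rounds as there are small configurations,
    [N * D.+1 ^ d], and each round adds one to the height. *)
Lemma level_der q v : derivable q v -> der C J (h0 + N * D.+1 ^ d) q (capped v).
Proof.
move=> /derivable_known; rewrite /fixset => /known_der.
by rewrite card_prod card_ffun !card_ord.
Qed.

End Level.

(** With [k'] tracked coordinates, derivations can be chosen of height at most [max_height k'], so a
    coordinate of size [m * 2 ^ max_height k'] outlasts them. With this threshold as [D], the added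
    term counts the small configurations; its exponent is [d] at every level because [trunc] records
    all coordinates. *)
Fixpoint max_height k := if k is k'.+1 then
  max_height k' + N * (m * 2 ^ max_height k').+1 ^ d else N.

Lemma rackoff B (J : {set 'I_d}) q (v : vec) : (forall k, k < #|J| -> m * 2 ^ max_height k <= B) ->
  derivable J q v -> der (fun x => x <= B) J (max_height #|J|) q (capped B v).
Proof.
move Ek: #|J| => k; elim: k J Ek q v => [|k IH] J Ek q v hB dv.
  (* With [J] empty nothing is large, and [D = 0] leaves a single truncated vector, so only the [N]
     states count. *)
  have -> : max_height 0 = 0 + N * 1 ^ d by rewrite exp1n muln1.
  apply: level_der => // q' v' _ [i].
  by rewrite (cards0_eq Ek) inE.
apply: level_der dv => [|q' v' [h dv'] [i iJ lg]]; first exact: hB.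
have Ei : #|J :\ i| = k by move: Ek; rewrite (cardsD1 i) iJ => -[].
have dr : derivable (J :\ i) q' v' by exists h; apply: der_sub dv'; apply: subsetDl.
have hB' k' : k' < k -> m * 2 ^ max_height k' <= B by move=> lt; apply: hB; apply: ltnW.
apply: (der_track iJ (IH _ Ei _ _ hB' dr)) => //.
  move=> h' lt; apply: leq_trans (hB k (ltnSn k)).
  by rewrite leq_mul2l leq_exp2l // (ltnW lt) orbT.
by rewrite /capped leq_min hB // ltnW.
Qed.

End Rackoff.

(** * Decoding instances *)

Lemma splits_cons a (x w : str) : a \notin x -> splits a (x ++ a :: w) = x :: splits a w.
Proof.
elim: x => [|c x IH] /=; first by rewrite eqxx.
by rewrite inE negb_or eq_sym => /andP[/negPf-> /IH->].
Qed.

Lemma splits_last a (x : str) : a \notin x -> x != [::] -> splits a x = [:: x].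
Proof.
elim: x => [//|c x IH] /=; rewrite inE negb_or eq_sym => /andP[/negPf-> nx] _.
by case: x IH nx => // c' x IH /IH ->.
Qed.

Lemma splits_flatten (A : Type) a (f : A -> str) (xs : seq A) w :
  (forall x, a \notin f x) ->
  splits a (flatten [seq f x ++ [:: a] | x <- xs] ++ w) = map f xs ++ splits a w.
Proof.
by move=> h; elim: xs => //= x xs IH; rewrite -!catA /= splits_cons // IH.
Qed.

Lemma splits_flatten0 (A : Type) a (f : A -> str) (xs : seq A) :
  (forall x, a \notin f x) -> splits a (flatten [seq f x ++ [:: a] | x <- xs]) = map f xs.
Proof. by move=> h; rewrite -[flatten _]cats0 splits_flatten // cats0. Qed.

Definition is_bit (c : nat) := (c == 1) || (c == 2).

Lemma bin_bits n : all is_bit (bin n).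
Proof.
rewrite /bin; move: {1}n => k; elim: k n => //= k IH n; case: eqP => // _ /=.
by rewrite IH; case: odd.
Qed.

Definition tok (z : int) : str := match z with Posz n => bin n | Negz n => 4 :: bin n.+1 end.

Lemma enc_intE z : enc_int z = tok z ++ [:: 3].
Proof. by case: z. Qed.

Lemma tok_chars z : all (fun c => is_bit c || (c == 4)) (tok z).
Proof.
have h n : all (fun c => is_bit c || (c == 4)) (bin n).
  by apply: sub_all (bin_bits n) => c ->.
by case: z => n; [exact: h | apply/andP; split=> //; exact: (h n.+1)].
Qed.

Lemma notin_bin a n : ~~ is_bit a -> a \notin bin n.
Proof. by apply: contra => /(allP (bin_bits n)). Qed.

Lemma bin_aux_val cap k n : n <= k -> n <= cap -> tokval cap (bin_aux k n) = n.
Proof.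
elim: k n => [|k IH] n; first by rewrite leqn0 => /eqP->.
move=> nk ncap /=; case: eqP => [->//|n0] /=.
have -> /= : (if odd n then 2 else 1) == 4 = false by case: odd.
rewrite -/(tokval cap _) IH; try lia.
have -> : (if (if odd n then 2 else 1) == 2 then 1 else 0) = odd n :> nat by case: odd.
have := odd_double_half n; rewrite -addnn => e.
by rewrite (_ : _ + _ + _ = n); [apply/minn_idPr | lia].
Qed.

Lemma bin_val cap n : n <= cap -> tokval cap (bin n) = n.
Proof. exact: bin_aux_val. Qed.

Lemma bin_inj : injective bin.
Proof.
move=> n n' e; rewrite -(@bin_val (maxn n n') n) ?leq_maxl // e bin_val //.
exact: leq_maxr.
Qed.

Lemma bin_aux_size k n : n <= k -> n < 2 ^ size (bin_aux k n).
Proof.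
elim: k n => [|k IH] n; first by rewrite leqn0 => /eqP->.
move=> nk /=; case: eqP => [->//|n0] /=; rewrite expnS.
by have := IH n./2 ltac:(lia); lia.
Qed.

Lemma bin_size n : n < 2 ^ size (bin n).
Proof. exact: bin_aux_size. Qed.

Lemma tok_size z : `|z|%N <= 2 ^ size (tok z).
Proof.
case: z => n; first exact: ltnW (bin_size n).
change (n.+1 <= 2 ^ (size (bin n.+1)).+1).
by rewrite expnS; have := bin_size n.+1; lia.
Qed.

Definition un_code (r : nat * seq int * nat) : seq str := bin r.1.1 :: rcons (map tok r.1.2) (bin r.2).
Definition bi_code (r : nat * nat * nat) : seq str := [:: bin r.1.1; bin r.1.2; bin r.2].
Definition ze_code (r : nat * nat) : seq str := [:: bin r.1; bin r.2].

Definition terminate (s : seq str) : str := flatten [seq x ++ [:: 3] | x <- s].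

Lemma enc_un r : enc_nat r.1.1 ++ enc_vec r.1.2 ++ enc_nat r.2 ++ [:: 5] = terminate (un_code r) ++ [:: 5].
Proof.
rewrite /terminate /un_code /= map_rcons flatten_rcons -map_comp /enc_vec /enc_nat -!catA.
by congr (_ ++ _ ++ _ ++ _); congr flatten; apply: eq_map => z; rewrite enc_intE.
Qed.
Lemma enc_bi r : enc_nat r.1.1 ++ enc_nat r.1.2 ++ enc_nat r.2 ++ [:: 5] = terminate (bi_code r) ++ [:: 5].
Proof. by rewrite /terminate /= cats0 /enc_nat -!catA. Qed.
Lemma enc_ze r : enc_nat r.1 ++ enc_nat r.2 ++ [:: 5] = terminate (ze_code r) ++ [:: 5].
Proof. by rewrite /terminate /= cats0 /enc_nat -!catA. Qed.

Definition clean (s : seq str) := all (all (fun c => is_bit c || (c == 4))) s.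

Lemma clean_un r : clean (un_code r).
Proof.
rewrite /clean /= all_rcons all_map; apply/and3P; split.
- exact: (tok_chars (Posz r.1.1)).
- exact: (tok_chars (Posz r.2)).
- by apply/allP => z _; apply: tok_chars.
Qed.
Lemma clean_bi r : clean (bi_code r).
Proof. by rewrite /clean /= !(tok_chars (Posz _)). Qed.
Lemma clean_ze r : clean (ze_code r).
Proof. by rewrite /clean /= !(tok_chars (Posz _)). Qed.

Lemma splits3 s : clean s -> splits 3 (terminate s) = s.
Proof.
rewrite /terminate; elim: s => //= x s IH /andP[hx /IH e].
by rewrite -catA splits_cons ?e //; apply/negP => /(allP hx).
Qed.

Lemma notin_terminate a s : ~~ is_bit a -> a != 4 -> a != 3 -> clean s -> a \notin terminate s.
Proof.
move=> h1 h2 h3; elim: s => //= x s IH /andP[hx /IH hs].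
rewrite /terminate /= !mem_cat; apply/negP => /orP[/orP[/(allP hx)|]|ha].
- by rewrite (negPf h1) (negPf h2).
- by rewrite inE (negPf h3).
- by rewrite /terminate ha in hs.
Qed.

Arguments terminate : simpl never.

Section Parse.
Variable I : instance.
Let w := enc_instance I.

Definition sections : seq str := [::
  nseq (nQ I) 6; nseq (abdim I) 6;
  flatten [seq terminate (un_code r) ++ [:: 5] | r <- Tu I];
  flatten [seq terminate (bi_code r) ++ [:: 5] | r <- Tf I];
  flatten [seq terminate (bi_code r) ++ [:: 5] | r <- Ts I];
  flatten [seq terminate (ze_code r) ++ [:: 5] | r <- Tz I];
  terminate [:: bin (qr I)]; terminate (map bin (Ql I))].

Lemma wE : w = flatten [seq s ++ [:: 7] | s <- sections].
Proof.
rewrite /w /enc_instance /sections /= cats0 -!catA.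
have -> : flatten [seq enc_nat r.1.1 ++ enc_vec r.1.2 ++ enc_nat r.2 ++ [:: 5] | r <- Tu I] =
  flatten [seq terminate (un_code r) ++ [:: 5] | r <- Tu I].
  by congr flatten; apply: eq_map => r; apply: enc_un.
have e3 T : flatten [seq enc_nat r.1.1 ++ enc_nat r.1.2 ++ enc_nat r.2 ++ [:: 5] | r <- T] =
  flatten [seq terminate (bi_code r) ++ [:: 5] | r <- T].
  by congr flatten; apply: eq_map => r; apply: enc_bi.
rewrite !e3.
have -> : flatten [seq enc_nat r.1 ++ enc_nat r.2 ++ [:: 5] | r <- Tz I] =
  flatten [seq terminate (ze_code r) ++ [:: 5] | r <- Tz I].
  by congr flatten; apply: eq_map => r; apply: enc_ze.
by rewrite (_ : terminate (map bin (Ql I)) = flatten [seq enc_nat q | q <- Ql I]) // /terminate -map_comp.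
Qed.

Lemma flatten_notin (A : Type) a (f : A -> str) xs :
  (forall x, a \notin f x) -> a \notin flatten (map f xs).
Proof. by move=> h; elim: xs => //= x xs IH; rewrite mem_cat negb_or h. Qed.

Lemma notin5 a s : ~~ is_bit a -> a != 4 -> a != 3 -> a != 5 -> clean s ->
  a \notin terminate s ++ [:: 5].
Proof. by move=> h1 h2 h3 h5 c; rewrite mem_cat negb_or notin_terminate //= inE. Qed.

Lemma clean_bins s : clean (map bin s).
Proof. by rewrite /clean all_map; apply/allP => n _; apply: (tok_chars (Posz n)). Qed.

Lemma splits7 : splits 7 w = sections.
Proof.
have hs : all (fun s : str => 7 \notin s) sections.
  rewrite /sections /= !mem_nseq !andbF /=.
  do !(apply/andP; split=> //).
  - by apply: flatten_notin => r; apply: notin5 (clean_un r).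
  - by apply: flatten_notin => r; apply: notin5 (clean_bi r).
  - by apply: flatten_notin => r; apply: notin5 (clean_bi r).
  - by apply: flatten_notin => r; apply: notin5 (clean_ze r).
  - by apply: notin_terminate (clean_bins [:: qr I]).
  - by apply: notin_terminate (clean_bins (Ql I)).
rewrite wE; elim: sections hs => [|s ss IH] //= /andP[h /IH e].
by rewrite -catA splits_cons // e.
Qed.

Lemma sec1 : sec 1 w = nseq (abdim I) 6. Proof. by rewrite /sec splits7. Qed.

Lemma rulesE (A : Type) (f : A -> seq str) xs : (forall x, clean (f x)) ->
  [seq splits 3 r | r <- splits 5 (flatten [seq terminate (f x) ++ [:: 5] | x <- xs])] = map f xs.
Proof.
move=> h; rewrite splits_flatten0; last by move=> x; apply: notin_terminate.
by rewrite -map_comp; apply: eq_map => x /=; rewrite splits3.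
Qed.

Lemma rules2 : rules 2 w = map un_code (Tu I).
Proof. by rewrite /rules /sec splits7 rulesE //; apply: clean_un. Qed.
Lemma rules3 : rules 3 w = map bi_code (Tf I).
Proof. by rewrite /rules /sec splits7 rulesE //; apply: clean_bi. Qed.
Lemma rules4 : rules 4 w = map bi_code (Ts I).
Proof. by rewrite /rules /sec splits7 rulesE //; apply: clean_bi. Qed.
Lemma rules5 : rules 5 w = map ze_code (Tz I).
Proof. by rewrite /rules /sec splits7 rulesE //; apply: clean_ze. Qed.
Lemma root6 : splits 3 (sec 6 w) = [:: bin (qr I)].
Proof. by rewrite /sec splits7 splits3 //; apply: (clean_bins [:: qr I]). Qed.
Lemma leaves7 : splits 3 (sec 7 w) = map bin (Ql I).
Proof. by rewrite /sec splits7 splits3 //; apply: clean_bins. Qed.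

Lemma cand_rule i r s : i < 8 -> r \in rules i w -> s \in r -> s \in cand w.
Proof.
move=> i8 /mapP[p hp ->] hs; apply/flattenP; exists (splits 3 p) => //.
apply: map_f; apply/flattenP; exists (splits 5 (sec i w)) => //; apply: map_f.
by rewrite /sec mem_nth // splits7.
Qed.

(** The section of leaves contains no rule terminator, so splitting it at 5 returns it whole,
    provided that it is nonempty, which [q] ensures. *)
Lemma cand_leaf q : q \in Ql I -> bin q \in cand w.
Proof.
move=> hq; apply/flattenP; exists (splits 3 (sec 7 w)); last by rewrite leaves7 map_f.
apply: map_f; apply/flattenP; exists (splits 5 (sec 7 w)).
  by apply: map_f; rewrite /sec mem_nth // splits7.
rewrite /sec splits7 /=.
have n5 : 5 \notin terminate (map bin (Ql I)) by apply: notin_terminate (clean_bins _).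
have : terminate (map bin (Ql I)) != [::].
  by case: (Ql I) hq => // x s _; rewrite /terminate /=; case: (bin x).
by move=> ne; rewrite splits_last // mem_seq1.
Qed.

Lemma letters_w : all (fun k => 0 < k < 8) w.
Proof.
rewrite wE; apply/allP => c /flattenP[s /mapP[t ht ->]]; rewrite mem_cat inE => /orP[|/eqP->//].
have hterm u : clean u -> all (fun k => 0 < k < 8) (terminate u).
  rewrite /terminate; elim: u => //= x u IH /andP[hx /IH]; rewrite all_cat all_cat /= => ->.
  rewrite ?andbT; apply: sub_all hx => k; rewrite /is_bit.
  by move=> /orP[/orP[]|] /eqP->.
have h5 (A : Type) (f : A -> seq str) xs : (forall x, clean (f x)) ->
  all (fun k => 0 < k < 8) (flatten [seq terminate (f x) ++ [:: 5] | x <- xs]).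
  by move=> h; elim: xs => //= x xs IH; rewrite !all_cat IH hterm.
move: c; apply/allP; move: t ht; apply/allP; rewrite /sections /=.
rewrite !all_nseq !orbT !h5 ?hterm //; [exact: clean_bins|exact: (clean_bins [:: qr I])|exact: clean_ze|exact: clean_bi|exact:clean_bi|exact: clean_un].
Qed.

Lemma size_w : nQ I + abdim I + 8 <= size w.
Proof. by rewrite wE /= !size_cat !size_nseq /=; lia. Qed.

(** The unary numbers, the eight section marks and any single entry occupy disjoint parts of the
    word. *)
Lemma size_w_rule r z : r \in Tu I -> z \in r.1.2 -> nQ I + abdim I + 8 + size (tok z) <= size w.
Proof.
move=> hr hz; rewrite wE /= !size_cat !size_nseq /=.
suff : size (tok z) <= size (flatten [seq terminate (un_code r) ++ [:: 5] | r <- Tu I]) by lia.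
have h2 (A : eqType) (f : A -> str) xs x : x \in xs -> size (f x) <= size (flatten (map f xs)).
  elim: xs => //= y xs IH; rewrite inE size_cat => /orP[/eqP->|/IH]; lia.
apply: leq_trans (h2 _ _ _ _ hr); rewrite size_cat; apply: leq_trans (leq_addr _ _).
have hz' : tok z \in un_code r by rewrite /un_code inE mem_rcons inE map_f ?orbT.
by apply: leq_trans (h2 _ (fun x => x ++ [:: 3]) _ _ hz'); rewrite size_cat leq_addr.
Qed.

End Parse.

(** * Lossy derivations as a least fixed point *)

Section Good.
Variable I : instance.
Notation d := (abdim I).
Notation "v $ i" := (nth 0%N v i) (at level 9, i at level 9).

(* Backward reading of lossy deduction trees; inequalities absorb the lossy steps. *)
Inductive good : nat -> seq nat -> Prop :=
| good_leaf q v : q \in Ql I -> size v = d -> good q v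
| good_unary q u q1 v v1 : (q, u, q1) \in Tu I -> size v = d -> size v1 = d ->
    (forall i, i < d -> ((v1 $ i)%:Z <= (v $ i)%:Z + nth 0 u i)%R) -> good q1 v1 -> good q v
| good_fork q q1 q2 v v1 v2 : (q, q1, q2) \in Tf I -> size v = d -> size v1 = d -> size v2 = d ->
    (forall i, i < d -> v1 $ i <= v $ i) -> (forall i, i < d -> v2 $ i <= v $ i) ->
    good q1 v1 -> good q2 v2 -> good q v
| good_split q q1 q2 v v1 v2 : (q, q1, q2) \in Ts I -> size v = d -> size v1 = d -> size v2 = d ->
    (forall i, i < d -> v1 $ i + v2 $ i <= v $ i) -> good q1 v1 -> good q2 v2 -> good q v
| good_zero q q1 v : (q, q1) \in Tz I -> size v = d -> good q1 (zero_vec I) -> good q v.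

Lemma good_size q v : good q v -> size v = d.
Proof. by case. Qed.

Lemma good_le q v v' : size v' = d -> (forall i, i < d -> v $ i <= v' $ i) -> good q v -> good q v'.
Proof.
move=> sv' le g; case: g le => {q v} [q v hq sv|q u q1 v v1 r sv s1 h g|q q1 q2 v v1 v2 r sv s1 s2 h1 h2 g1 g2|q q1 q2 v v1 v2 r sv s1 s2 h g1 g2|q q1 v r sv g] le.
- exact: good_leaf.
- by apply: (good_unary r sv' s1) => // i lt; have := le i lt; have := h i lt; lia.
- by apply: (good_fork r sv' s1 s2) g1 g2 => i lt; have := le i lt; have := h1 i lt; have := h2 i lt; lia.
- by apply: (good_split r sv' s1 s2) g1 g2 => i lt; have := le i lt; have := h i lt; lia.
- exact: good_zero r sv' g.
Qed.

Hypothesis wf : wf_instance I.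

Definition final (t : dtree) := forall c, c \in dleaves t -> c.1 \in Ql I /\ c.2 = zero_vec I.

Lemma size_zero : size (zero_vec I) = d. Proof. exact: size_nseq. Qed.
Lemma nth_zero i : (zero_vec I) $ i = 0. Proof. by rewrite nth_nseq if_same. Qed.

Lemma eq_vec (v v' : seq nat) : size v = d -> size v' = d -> (forall i, i < d -> v $ i = v' $ i) -> v = v'.
Proof. by move=> s s' h; apply: (@eq_from_nth _ 0); rewrite s // => i /h. Qed.

Lemma tree_good t : lossy_deduction_tree I t -> final t -> good (droot t).1 (droot t).2.
Proof.
elim: t => [c|c t IH|c t1 IH1 t2 IH2] /=.
- move=> _ /(_ c); rewrite inE eqxx => /(_ isT)[hq ->]; apply: good_leaf hq _; exact: size_zero.
- case=> -[_ sc] [st ht] /(IH ht) {}IH; have s1 := good_size IH.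
  case: st => [[[u [r h]]|[r [c0 c1]]]|[e [i [lt [pos e2]]]]].
  + by apply: (good_unary r sc s1) IH => i /h ->.
  + by apply: (good_zero r sc); rewrite -c1.
  + rewrite e e2 in IH; apply: good_le IH => // j ltj; rewrite nth_set_nth /=.
    by case: eqP => [->|//]; apply: leq_pred.
- case=> -[_ sc] [st [ht1 ht2]] hf.
  have {}IH1 : good (droot t1).1 (droot t1).2 by apply: IH1 => // x hx; apply: hf; rewrite mem_cat hx.
  have {}IH2 : good (droot t2).1 (droot t2).2 by apply: IH2 => // x hx; apply: hf; rewrite mem_cat hx orbT.
  have s1 := good_size IH1; have s2 := good_size IH2.
  case: st => [[r [e1 e2]]|[r h]].
    by apply: (good_fork r sc s1 s2) IH1 IH2 => i _; rewrite ?e1 ?e2.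
  by apply: (good_split r sc s1 s2) IH1 IH2 => i /h ->.
Qed.

Definition has_tree q v := exists t, [/\ lossy_deduction_tree I t, droot t = (q, v) & final t].

(** Each lossy step removes one unit of the excess of [v'] over [v]; the induction is on the sum of
    the entries of [v']. *)
Lemma has_tree_le q v v' : q < nQ I -> size v = d -> size v' = d ->
  (forall i, i < d -> v $ i <= v' $ i) -> has_tree q v -> has_tree q v'.
Proof.
move=> hq sv; move: {2}(sumn v') (leqnn (sumn v')) => n.
elim: n v' => [|n IH] v' le sv' h ht.
  suff -> : v' = v by [].
  apply: eq_vec => // i lt; have := h i lt; suff -> : v' $ i = 0 by lia.
  move: le; rewrite leqn0 sumnE => /eqP/eqP; rewrite sum_nat_seq_eq0 => /allP h0.
  by apply/eqP; apply: h0; rewrite mem_nth // sv'.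
case: (pselect (exists2 i, i < d & v $ i < v' $ i)) => [[i lt lti]|no]; last first.
  suff -> : v' = v by [].
  apply: eq_vec => // i lt; apply/eqP; rewrite eqn_leq h // andbT leqNgt; apply/negP => lti.
  by apply: no; exists i.
pose v2 := set_nth 0 v' i (v' $ i).-1.
have s2 : size v2 = d by rewrite size_set_nth sv'; apply/maxn_idPr.
have [t [h1 h2 h3]] : has_tree q v2.
  apply: IH => //.
    by have := sumn_set_nth v' 0 i (v' $ i).-1; rewrite -/v2 sv' lt muln1; lia.
  by move=> j ltj; rewrite nth_set_nth /=; case: eqP => [->|_]; [lia | apply: h].
exists (DUn (q, v') t); split=> //=; split=> //; split=> //; right; rewrite h2; split=> //.
by exists i; split=> //; split=> //=; lia.
Qed.

Lemma good_tree q v : q < nQ I -> good q v -> has_tree q v.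
Proof.
have [wu wf' ws wz [_ wl]] := wf.
move=> hq g; elim: g hq => {q v} [q v hq sv|q u q1 v v1 r sv s1 h g IH|q q1 q2 v v1 v2 r sv s1 s2 h1 h2 g1 IH1 g2 IH2|q q1 q2 v v1 v2 r sv s1 s2 h g1 IH1 g2 IH2|q q1 v r sv g IH] lq.
- apply: (@has_tree_le q (zero_vec I)) => //; rewrite ?size_zero //.
    by move=> i _; rewrite nth_zero.
  exists (DLeaf (q, zero_vec I)); split=> //=; first by split=> //; apply: size_zero.
  by move=> c; rewrite inE => /eqP->.
- have /and3P[_ /= lq1 _] := allP wu _ r.
  (* A unary step is exact, so its child carries this vector; it dominates [v1], and lossy steps
     make up the difference. *)
  pose x i := absz ((v $ i)%:Z + nth 0 u i)%R.
  have sx : size (mkseq x d) = d by rewrite size_mkseq.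
  have ex i : i < d -> (((mkseq x d) $ i)%:Z = (v $ i)%:Z + nth 0 u i)%R.
    by move=> lt; rewrite nth_mkseq // /x; have := h i lt; lia.
  have [t [t1 t2 t3]] : has_tree q1 (mkseq x d).
    by apply: (has_tree_le lq1 s1 sx _ (IH lq1)) => i lt; have := ex i lt; have := h i lt; lia.
  exists (DUn (q, v) t); split=> //=; split=> //; split=> //; left; left; exists u; rewrite t2 /=.
  by split.
- have /and3P[_ /= lq1 lq2] := allP wf' _ r.
  have [t1 [a1 b1 c1]] := has_tree_le lq1 s1 sv h1 (IH1 lq1).
  have [t2 [a2 b2 c2]] := has_tree_le lq2 s2 sv h2 (IH2 lq2).
  exists (DBin (q, v) t1 t2); split=> //=.
    by split=> //; split=> //; left; rewrite b1 b2.
  by move=> c; rewrite mem_cat => /orP[/c1|/c2].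
- have /and3P[_ /= lq1 lq2] := allP ws _ r.
  (* A split is exact as well, so the first child receives all that the second does not take. *)
  pose x i := v $ i - v2 $ i.
  have sx : size (mkseq x d) = d by rewrite size_mkseq.
  have hx i : i < d -> v1 $ i <= (mkseq x d) $ i.
    by move=> lt; rewrite nth_mkseq // /x; have := h i lt; lia.
  have [t1 [a1 b1 c1]] := has_tree_le lq1 s1 sx hx (IH1 lq1).
  have [t2 [a2 b2 c2]] := IH2 lq2.
  exists (DBin (q, v) t1 t2); split=> //=.
    split=> //; split=> //; right; rewrite b1 b2; split=> // i lt /=.
    by rewrite nth_mkseq // /x; have := h i lt; lia.
  by move=> c; rewrite mem_cat => /orP[/c1|/c2].
- have /andP[_ /= lq1] := allP wz _ r.
  (* The vector is first lost down to zero, where the test can fire. *)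
  apply: (@has_tree_le q (zero_vec I)) => //; rewrite ?size_zero //.
    by move=> i _; rewrite nth_zero.
  have [t [t1 t2 t3]] := IH lq1.
  exists (DUn (q, zero_vec I) t); split=> //=; split; first by split=> //; apply: size_zero.
  by split=> //; left; right; rewrite t2.
Qed.

Lemma lossy_reach_good : lossy_reach I <-> good (qr I) (zero_vec I).
Proof.
have [_ _ _ _ [hq _]] := wf.
split=> [[t [h1 [h2 h3]]]|/(good_tree hq)[t [h1 h2 h3]]]; last by exists t.
by have := tree_good h1 h3; rewrite h2.
Qed.

End Good.

(** * Stabilisation of a monotone filter *)

Section Stabilize.
Variables (T : eqType) (box : seq T) (f : seq T -> pred T).
Hypothesis f_mono : forall S S', {subset S <= box} -> {subset S' <= box} ->
  {subset S <= S'} -> {in box, subpred (f S) (f S')}.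
Let F S := filter (f S) box.

Lemma filter_sub (p p' : pred T) : {in box, subpred p p'} ->
  filter p box = filter p (filter p' box).
Proof.
move=> sub; rewrite -filter_predI; apply: eq_in_filter => x xb /=.
by case px: (p x); rewrite ?(sub x xb px) ?andbT.
Qed.

Lemma filter_size_eq (p p' : pred T) : {in box, subpred p p'} ->
  size (filter p box) = size (filter p' box) -> filter p box = filter p' box.
Proof.
move=> /filter_sub e1 e; rewrite e1; apply/all_filterP; rewrite all_count -size_filter -e1.
exact/eqP.
Qed.

Lemma iter_sub n : {subset iter n F [::] <= box}.
Proof. by case: n => // n x; rewrite /= mem_filter => /andP[]. Qed.

Lemma iter_mono n : {subset iter n F [::] <= iter n.+1 F [::]}.
Proof.
elim: n => [//|n IH] x; rewrite [iter n.+1 _ _]/= [iter n.+2 _ _]/= !mem_filter => /andP[h xb].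
by rewrite xb andbT; apply: (f_mono (@iter_sub n) (@iter_sub n.+1) IH).
Qed.

(** As long as the iteration moves, its size grows by at least one per round. All stages filter the
    same list, so equal sizes of successive stages force equality even if the box has
    repetitions. *)
Lemma iter_stable : F (iter (size box) F [::]) = iter (size box) F [::].
Proof.
suff h n : iter n.+1 F [::] = iter n F [::] \/ n < size (iter n.+1 F [::]).
  by case: (h (size box)) => [//|]; rewrite ltnNge /= size_filter count_size.
elim: n => [|n [e|lt]].
- by case E: (iter 1 F [::]) => [|x s]; [left | right].
- by left; rewrite [LHS]/= -/(iter n.+1 F [::]) e.
- have sub : {in box, subpred (f (iter n F [::])) (f (iter n.+1 F [::]))}.
    by apply: f_mono (@iter_sub _) (@iter_sub _) (@iter_mono n).
  case: (eqVneq (size (iter n.+2 F [::])) (size (iter n.+1 F [::]))) => [e|ne].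
    by left; apply/esym; apply: filter_size_eq sub (esym e).
  right; apply: leq_ltn_trans lt _; rewrite ltn_neqAle eq_sym ne /=.
  change (size (filter (f (iter n F [::])) box) <= size (filter (f (iter n.+1 F [::])) box)).
  by rewrite (filter_sub sub) size_filter count_size.
Qed.

Lemma foldl_iter (s : seq T) S0 : foldl (fun S _ => F S) S0 s = iter (size s) F S0.
Proof. by elim: s S0 => //= x s IH S0; rewrite IH -iterSr. Qed.

End Stabilize.

Lemma all_zipP (A B : Type) (x0 : A) (y0 : B) (p : pred (A * B)) s t n : size s = n -> size t = n ->
  reflect (forall i, i < n -> p (nth x0 s i, nth y0 t i)) (all p (zip s t)).
Proof.
move=> hs ht; have e : size s = size t by rewrite hs ht.
apply: (iffP (all_nthP (x0, y0))) => h i; have := h i; rewrite size_zip hs ht minnn nth_zip //.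
Qed.

Lemma entry_ok_tok cap x1 x z : absz z <= cap ->
  entry_ok cap x1 x (tok z) = ((x1%:Z <= x%:Z + z)%R).
Proof.
have no4 n : has (fun c : nat => c == 4) (bin n) = false.
  by apply/hasP => -[c hc /eqP ec]; have := notin_bin n (isT : ~~ is_bit 4); rewrite -ec hc.
rewrite /entry_ok; case: z => n hz; first by rewrite /= no4 bin_val //; lia.
change (has _ (tok (Negz n))) with true; change (tokval cap (tok (Negz n))) with (tokval cap (bin n.+1)).
by rewrite bin_val //; lia.
Qed.

(** * Correctness of the saturation *)

Section Correct.
Variables (I : instance) (B m : nat).
Hypothesis wf : wf_instance I.
Notation d := (abdim I).
Notation N := (nQ I).
Notation "v $ i" := (nth 0%N v i) (at level 9, i at level 9).
Hypothesis Bm : 0 < d -> m <= B.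
Hypothesis hm : forall r z, r \in Tu I -> z \in r.1.2 -> absz z <= m.
Hypothesis hB : forall k, k < d -> m * 2 ^ max_height N d m k <= B.
Let w := enc_instance I.
Let vs := vecs B (sec 1 w).
Let Box := box w vs.

Lemma mem_Box s v : ((s, v) \in Box) = [&& s \in cand w, size v == d & all (fun x => x <= B) v].
Proof.
rewrite /Box /box; apply/allpairsP/idP => [[[s' v'] [/= h1 h2 [-> ->]]]|/andP[h1 h2]].
  by rewrite h1 /=; move: h2; rewrite /vs mem_vecs sec1 size_nseq.
by exists (s, v); split=> //=; rewrite /vs mem_vecs sec1 size_nseq.
Qed.

Lemma vec_leP v1 v : size v1 = d -> size v = d ->
  reflect (forall i, i < d -> v1 $ i <= v $ i) (vec_le v1 v).
Proof. by move=> h1 h2; apply: (all_zipP 0 0). Qed.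

Lemma vec_add_leP v1 v2 v : size v1 = d -> size v2 = d -> size v = d ->
  reflect (forall i, i < d -> v1 $ i + v2 $ i <= v $ i) (vec_add_le v1 v2 v).
Proof.
move=> h1 h2 h3; have hz : size (zip v2 v) = d by rewrite size_zip h2 h3 minnn.
have e : size v2 = size v by rewrite h2.
apply: (iffP (all_zipP 0 (0, 0) _ h1 hz)) => h i /h; rewrite nth_zip //.
Qed.

Lemma vec_okP v1 v u q : size v1 = d -> size v = d -> size u = d ->
  (forall z, z \in u -> absz z <= B) ->
  reflect (forall i, i < d -> ((v1 $ i)%:Z <= (v $ i)%:Z + nth 0 u i)%R)
    (vec_ok B v1 v (rcons (map tok u) q)).
Proof.
move=> h1 h2 h3 hu; rewrite /vec_ok.
have -> : zip v (rcons (map tok u) q) = zip v (map tok u).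
  by rewrite -cats1 -[v]cats0 zip_cat ?size_map ?h2 ?h3 // cats0 /= cats0.
have e : size v = size (map tok u) by rewrite size_map h2.
have hz : size (zip v (map tok u)) = d by rewrite size_zip -e h2 minnn.
have hi i : i < d -> absz (nth 0%R u i) <= B by move=> lt; apply: hu; rewrite mem_nth ?h3.
apply: (iffP (all_zipP 0 (0, [::]) _ h1 hz)) => h i lt; have := h i lt;
  by rewrite nth_zip //= (nth_map 0%R) ?h3 // entry_ok_tok ?hi.
Qed.

Lemma vec0P v : size v = d -> reflect (v = zero_vec I) (vec0 v).
Proof. by move=> h; rewrite /zero_vec -h; apply: (iffP (all_pred1P 0 v)). Qed.

(** The propositional form of [ok], with numerals traced back to the states that they encode. *)
Inductive justified (S : seq bconf) : str -> seq nat -> Prop :=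
| just_leaf q v : q \in Ql I -> justified S (bin q) v
| just_unary q u q1 v v1 : (q, u, q1) \in Tu I -> (bin q1, v1) \in S ->
    (forall i, i < d -> ((v1 $ i)%:Z <= (v $ i)%:Z + nth 0 u i)%R) -> justified S (bin q) v
| just_fork q q1 q2 v v1 v2 : (q, q1, q2) \in Tf I -> (bin q1, v1) \in S -> (bin q2, v2) \in S ->
    (forall i, i < d -> v1 $ i <= v $ i) -> (forall i, i < d -> v2 $ i <= v $ i) ->
    justified S (bin q) v
| just_split q q1 q2 v v1 v2 : (q, q1, q2) \in Ts I -> (bin q1, v1) \in S -> (bin q2, v2) \in S ->
    (forall i, i < d -> v1 $ i + v2 $ i <= v $ i) -> justified S (bin q) v
| just_zero q q1 v : (q, q1) \in Tz I -> (bin q1, zero_vec I) \in S -> justified S (bin q) v.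

(** In positive dimension the cap dominates [m], so entries are read without truncation. In
    dimension 0, where the cap will be only linear in the length of the word, there are no entries
    to read. *)
Lemma unary_bound q u q1 : (q, u, q1) \in Tu I -> size u = d /\ forall z, z \in u -> absz z <= B.
Proof.
move=> r; have [wu _ _ _ _] := wf.
have /and3P[_ _ /eqP su] := allP wu _ r; split=> // z hz.
apply: leq_trans (hm r hz) (Bm _); rewrite -su /=.
by case: (u) hz.
Qed.

Lemma okP S s v : (forall c, c \in S -> size c.2 = d) -> size v = d ->
  ok w B S (s, v) <-> justified S s v.
Proof.
move=> hS sv; split.
  rewrite /ok; case/or4P => [||| /orP[|]].
  - rewrite /ok_leaf leaves7 => /hasP[x /mapP[q hq ->] /eqP /= ->].
    exact: just_leaf hq.
  - rewrite /ok_unary rules2 => /hasP[r /mapP[[[q u] q1] hr ->]] /= /andP[/eqP<-].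
    case/hasP=> -[s1 v1] h1 /=; rewrite last_rcons => /andP[/eqP e].
    have [su hu] := unary_bound hr.
    move=> /(vec_okP _ (hS _ h1) sv su hu) h2; rewrite -e in h1.
    exact: just_unary hr h1 h2.
  - rewrite /ok_fork rules3 => /hasP[r /mapP[[[q q1] q2] hr ->]] /= /andP[/eqP<-] /andP[].
    case/hasP=> -[s1 v1] h1 /= /andP[/eqP e1 /(vec_leP (hS _ h1) sv) l1].
    case/hasP=> -[s2 v2] h2 /= /andP[/eqP e2 /(vec_leP (hS _ h2) sv) l2].
    by rewrite -e1 in h1; rewrite -e2 in h2; apply: just_fork hr h1 h2 l1 l2.
  - rewrite /ok_split rules4 => /hasP[r /mapP[[[q q1] q2] hr ->]] /= /andP[/eqP<-].
    case/hasP=> -[s1 v1] h1 /= /andP[/eqP e1].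
    case/hasP=> -[s2 v2] h2 /= /andP[/eqP e2 /(vec_add_leP (hS _ h1) (hS _ h2) sv) l].
    by rewrite -e1 in h1; rewrite -e2 in h2; apply: just_split hr h1 h2 l.
  - rewrite /ok_zero rules5 => /hasP[r /mapP[[q q1] hr ->]] /= /andP[/eqP<-].
    case/hasP=> -[s1 v1] h1 /= /andP[/eqP e1 /(vec0P (hS _ h1)) /= e2].
    by rewrite -e1 e2 in h1; apply: just_zero hr h1.
rewrite /ok => j; case: j sv => {s v}
  [q v hq|q u q1 v v1 hr h1 l|q q1 q2 v v1 v2 hr h1 h2 l1 l2|q q1 q2 v v1 v2 hr h1 h2 l|q q1 v hr h1] sv.
- by apply/or4P/Or41; rewrite /ok_leaf leaves7; apply/hasP; exists (bin q); rewrite ?map_f ?eqxx.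
- apply/or4P/Or42; rewrite /ok_unary rules2; apply/hasP; exists (un_code (q, u, q1)); rewrite ?map_f //=.
  rewrite eqxx /=; apply/hasP; exists (bin q1, v1) => //=; rewrite last_rcons eqxx /=.
  have [su hu] := unary_bound hr.
  by apply/(vec_okP _ (hS _ h1) sv su hu).
- apply/or4P/Or43; rewrite /ok_fork rules3; apply/hasP; exists (bi_code (q, q1, q2)); rewrite ?map_f //=.
  rewrite eqxx /=; apply/andP; split; apply/hasP; [exists (bin q1, v1) | exists (bin q2, v2)] => //=;
    rewrite eqxx /=.
    exact/(vec_leP (hS _ h1) sv).
  exact/(vec_leP (hS _ h2) sv).
- apply/or4P/Or44/orP; left; rewrite /ok_split rules4; apply/hasP; exists (bi_code (q, q1, q2)); rewrite ?map_f //=.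
  rewrite eqxx /=; apply/hasP; exists (bin q1, v1) => //=; rewrite eqxx /=.
  apply/hasP; exists (bin q2, v2) => //=; rewrite eqxx /=.
  exact/(vec_add_leP (hS _ h1) (hS _ h2) sv).
- apply/or4P/Or44/orP; right; rewrite /ok_zero rules5; apply/hasP; exists (ze_code (q, q1)); rewrite ?map_f //=.
  rewrite eqxx /=; apply/hasP; exists (bin q1, zero_vec I) => //=; rewrite eqxx /=.
  by apply/vec0P => //; apply: size_zero.
Qed.

Lemma justified_sub (S S' : seq bconf) s v : {subset S <= S'} -> justified S s v -> justified S' s v.
Proof.
move=> sub; case=> {s v}
  [q v hq|q u q1 v v1 hr h1 l|q q1 q2 v v1 v2 hr h1 h2 l1 l2|q q1 q2 v v1 v2 hr h1 h2 l|q q1 v hr h1].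
- exact: just_leaf.
- by apply: just_unary hr (sub _ h1) l.
- by apply: just_fork hr (sub _ h1) (sub _ h2) l1 l2.
- by apply: just_split hr (sub _ h1) (sub _ h2) l.
- by apply: just_zero hr (sub _ h1).
Qed.

Lemma justified_cand S s v : justified S s v -> s \in cand w.
Proof.
have hd i r s' : i < 8 -> (s' :: r) \in rules i w -> s' \in cand w.
  by move=> i8 h; apply: (cand_rule i8 h); rewrite inE eqxx.
case=> {s v}
  [q v hq|q u q1 v v1 hr h1 l|q q1 q2 v v1 v2 hr h1 h2 l1 l2|q q1 q2 v v1 v2 hr h1 h2 l|q q1 v hr h1].
- exact: cand_leaf.
- by apply: (hd 2 (behead (un_code (q, u, q1)))) => //; rewrite rules2; apply: (map_f un_code hr).
- by apply: (hd 3 (behead (bi_code (q, q1, q2)))) => //; rewrite rules3; apply: (map_f bi_code hr).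
- by apply: (hd 4 (behead (bi_code (q, q1, q2)))) => //; rewrite rules4; apply: (map_f bi_code hr).
- by apply: (hd 5 (behead (ze_code (q, q1)))) => //; rewrite rules5; apply: (map_f ze_code hr).
Qed.

Let S := saturate w B vs.

Lemma sized (T : seq bconf) : {subset T <= Box} -> forall c, c \in T -> size c.2 = d.
Proof. by move=> sub -[s v] /sub; rewrite mem_Box => /and3P[_ /eqP]. Qed.

Lemma ok_mono T T' : {subset T <= Box} -> {subset T' <= Box} -> {subset T <= T'} ->
  {in Box, subpred (ok w B T) (ok w B T')}.
Proof.
move=> h1 h2 sub [s v]; rewrite mem_Box => /and3P[_ /eqP sv _].
move=> /(okP _ (sized h1) sv) j; apply/(okP _ (sized h2) sv).
exact: justified_sub j.
Qed.

Lemma S_iter : S = iter (size Box) (fun T => filter (ok w B T) Box) [::].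
Proof. by rewrite /S /saturate -/Box (foldl_iter Box (fun T => ok w B T)). Qed.

Lemma S_sub : {subset S <= Box}.
Proof. by rewrite S_iter; apply: iter_sub. Qed.

Lemma S_closed s v : justified S s v -> size v = d -> all (fun x => x <= B) v -> (s, v) \in S.
Proof.
move=> j sv hv; have := iter_stable ok_mono; rewrite -S_iter => <-.
rewrite mem_filter mem_Box (justified_cand j) sv eqxx hv /= andbT.
by apply/okP => //; apply: sized S_sub.
Qed.

Lemma S_sound s v : (s, v) \in S -> exists2 q, s = bin q & good I q v.
Proof.
rewrite S_iter; elim: (size Box) s v => [//|n IH] s v.
have sub := @iter_sub _ Box (fun T => ok w B T) n.
rewrite iterS mem_filter => /andP[h]; rewrite mem_Box => /and3P[_ /eqP sv _].
have get q u : (bin q, u) \in iter n (fun T => filter (ok w B T) Box) [::] -> size u = d /\ good I q u.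
  by move=> hu; split; [apply: (sized sub hu) | have [q' /bin_inj-> //] := IH _ _ hu].
move/(okP _ (sized sub) sv): h => j; case: j sv => {s v}
  [q v hq|q u q1 v v1 hr h1 l|q q1 q2 v v1 v2 hr h1 h2 l1 l2|q q1 q2 v v1 v2 hr h1 h2 l|q q1 v hr h1] sv;
  exists q => //.
- exact: good_leaf.
- by have [s1 g1] := get _ _ h1; apply: good_unary hr sv s1 l g1.
- have [s1 g1] := get _ _ h1; have [s2 g2] := get _ _ h2.
  exact: good_fork hr sv s1 s2 l1 l2 g1 g2.
- have [s1 g1] := get _ _ h1; have [s2 g2] := get _ _ h2.
  exact: good_split hr sv s1 s2 l g1 g2.
- by have [s1 g1] := get _ _ h1; apply: good_zero hr sv g1.
Qed.

(** Zero tests are looked up in the saturated set itself, so the rules handed to the Rackoff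
    argument contain none. *)
Definition axiom_state (q : 'I_N) := (val q \in Ql I) \/
  exists q1, (val q, q1) \in Tz I /\ (bin q1, zero_vec I) \in S.

Definition rule_rel (q q1 q2 : 'I_N) (k : option ('I_d -> int)) :=
  [\/ exists u, [/\ (val q, u, val q1) \in Tu I, q2 = q1 & k = Some (fun i : 'I_d => nth 0%R u i)],
      (val q, val q1, val q2) \in Tf I /\ k = Some (fun=> 0%R) |
      (val q, val q1, val q2) \in Ts I /\ k = None].

Lemma rule_rel_le q q1 q2 u : rule_rel q q1 q2 (Some u) -> forall i, (- m%:Z <= u i <= m%:Z)%R.
Proof.
case=> [[u' [hr _ [->]]]|[_ [->]]|[_ //]] i; last by lia.
have [su _] := unary_bound hr.
have := hm hr (mem_nth 0%R (_ : i < size u')); rewrite su ltn_ord => /(_ isT) /=; move: (nth _ _ _) => z; lia.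
Qed.

Notation der := (@der N d axiom_state rule_rel).
Definition vec_of (v : seq nat) : 'I_d -> nat := fun i => v $ i.
Definition seq_of (v : 'I_d -> nat) : seq nat := [seq v i | i <- enum 'I_d].

Lemma size_seq_of v : size (seq_of v) = d.
Proof. by rewrite size_map size_enum_ord. Qed.

Lemma nth_seq_of v (i : 'I_d) : (seq_of v) $ i = v i.
Proof. by rewrite (nth_map i) ?size_enum_ord // nth_ord_enum. Qed.

Lemma der_S h q v : der (fun x => x <= B) setT h q v -> (forall i, v i <= B) -> (bin q, seq_of v) \in S.
Proof.
elim=> {h q v} [h q v Lq|h q q1 q2 k v v1 v2 r s c d1 h1 d2 h2] hv.
  have hall : all (fun x => x <= B) (seq_of v) by rewrite all_map; apply/allP => i _; apply: hv.
  apply: S_closed _ (size_seq_of _) hall; case: Lq => [hq|[q1 [hr h1]]]; first exact: just_leaf.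
  exact: just_zero hr h1.
have hall : all (fun x => x <= B) (seq_of v) by rewrite all_map; apply/allP => i _; apply: hv.
apply: S_closed _ (size_seq_of _) hall.
have hv1 i : v1 i <= B by have [] := c i (in_setT i).
have hv2 i : v2 i <= B by have [] := c i (in_setT i).
have {}h1 := h1 hv1; have {}h2 := h2 hv2.
have s' (i : nat) (lt : i < d) := s (Ordinal lt) (in_setT _).
have n1 u (i : nat) (lt : i < d) : (seq_of u) $ i = u (Ordinal lt) by rewrite -(nth_seq_of _ (Ordinal lt)).
case: r s' => [[u [hr e2 ->]]|[hr ->]|[hr ->]] s'.
- by apply: (just_unary hr h1) => i lt; rewrite !(n1 _ _ lt); have [] := s' i lt.
- by apply: (just_fork hr h1 h2) => i lt; rewrite !(n1 _ _ lt); have := s' i lt; lia.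
- by apply: (just_split hr h1 h2) => i lt; rewrite !(n1 _ _ lt); have := s' i lt; lia.
Qed.

Lemma derivable_S q v : (exists h, der (fun=> True) setT h q v) -> (forall i, v i <= B) ->
  (bin q, seq_of v) \in S.
Proof.
move=> dv hv; have := @rackoff N d m axiom_state rule_rel rule_rel_le B setT q v.
rewrite cardsT card_ord => /(_ hB dv) /(der_mono (leqnn _) (v' := v)) h; apply: der_S (h _) hv.
by move=> i _; apply: geq_minr.
Qed.

(** Zero tests disappear from the inside out: by induction the configuration of [q1] and the zero
    vector reached by a test has a derivation, [derivable_S] places it in [S], and this makes the
    tested state an axiom. *)
Lemma good_derivable q v (lq : q < N) : good I q v ->
  exists h, der (fun=> True) setT h (Ordinal lq) (vec_of v).
Proof.
have [wu wf' ws wz [_ wl]] := wf.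
move=> g; elim: g lq => {q v} [q v hq sv|q u q1 v v1 r sv s1 h g IH|q q1 q2 v v1 v2 r sv s1 s2 h1 h2 g1 IH1 g2 IH2|q q1 q2 v v1 v2 r sv s1 s2 h g1 IH1 g2 IH2|q q1 v r sv g IH] lq.
- by exists 0; apply: der_leaf; left.
- have /and3P[_ /= lq1 _] := allP wu _ r; have [k dk] := IH lq1.
  exists k.+1; apply: (der_rule (q1 := Ordinal lq1) (q2 := Ordinal lq1)
    (k := Some (fun i : 'I_d => nth 0%R u i)) (v1 := vec_of v1) (v2 := vec_of v1)) => //.
    by apply: Or31; exists u.
  by move=> i _; rewrite /vec_of; split; apply: h.
- have /and3P[_ /= lq1 lq2] := allP wf' _ r; have [k1 dk1] := IH1 lq1; have [k2 dk2] := IH2 lq2.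
  exists (maxn k1 k2).+1; apply: (der_rule (q1 := Ordinal lq1) (q2 := Ordinal lq2)
    (k := Some (fun=> 0%R)) (v1 := vec_of v1) (v2 := vec_of v2)) => //.
  + exact: Or32.
  + by move=> i _; rewrite /vec_of; have := h1 i (ltn_ord i); have := h2 i (ltn_ord i); lia.
  + by apply: der_mono dk1 => //; apply: leq_maxl.
  + by apply: der_mono dk2 => //; apply: leq_maxr.
- have /and3P[_ /= lq1 lq2] := allP ws _ r; have [k1 dk1] := IH1 lq1; have [k2 dk2] := IH2 lq2.
  exists (maxn k1 k2).+1; apply: (der_rule (q1 := Ordinal lq1) (q2 := Ordinal lq2)
    (k := None) (v1 := vec_of v1) (v2 := vec_of v2)) => //.
  + exact: Or33.
  + by move=> i _; rewrite /vec_of; apply: h.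
  + by apply: der_mono dk1 => //; apply: leq_maxl.
  + by apply: der_mono dk2 => //; apply: leq_maxr.
- have /andP[_ /= lq1] := allP wz _ r.
  exists 0; apply: der_leaf; right; exists q1; split=> //.
  have -> : zero_vec I = seq_of (vec_of (zero_vec I)).
    apply: (@eq_vec I); rewrite ?size_seq_of ?size_zero // => i lt.
    by rewrite (nth_seq_of _ (Ordinal lt)).
  by apply: (derivable_S (IH lq1)) => i; rewrite /vec_of nth_zero.
Qed.

Lemma answer_correct : answer w B vs <-> lossy_reach I.
Proof.
rewrite (lossy_reach_good wf); have [_ _ _ _ [hq _]] := wf.
rewrite /answer -/S root6 /=; split.
  case/hasP=> -[s v] hS /= /andP[/eqP es].
  have [q eq g] := S_sound hS; rewrite es in eq; rewrite (bin_inj eq).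
  by move/(vec0P (good_size g)) => <-.
move/(good_derivable hq) => dv.
apply/hasP; exists (bin (qr I), zero_vec I) => /=; last first.
  by rewrite eqxx; apply/vec0P => //; apply: size_zero.
have -> : zero_vec I = seq_of (vec_of (zero_vec I)).
  apply: (@eq_vec I); rewrite ?size_seq_of ?size_zero // => i lt.
  by rewrite (nth_seq_of _ (Ordinal lt)).
by apply: (derivable_S dv) => i; rewrite /vec_of nth_zero.
Qed.

End Correct.

(** * Time bounds *)

Lemma height_ge n d : 0 < n -> n <= height n d.
Proof. by move=> n0; apply: (@height_mono n 0 d). Qed.

(** The summand [m'] belongs to the induction because the next threshold is
    [2 ^ m' * 2 ^ max_height N d (2 ^ m') k]. With [z = height n k], one level of the recursion
    stays below 2 to the power [(z + z.+1 * d).+1], which is at most [(d + 2) * z]; hence the factor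
    [n] in the exponents of [height]. *)
Lemma max_height_le N d m' n k : N + m' <= n -> d + 2 <= n ->
  max_height N d (2 ^ m') k + m' <= height n k.
Proof.
move=> le1 le2; elim: k => [//|k IH]; rewrite heightS /=.
rewrite -expnD [m' + _]addnC.
have zn : n <= height n k by apply: height_ge; lia.
move: (height n k) (max_height N d (2 ^ m') k) IH zn => z a IH zn.
have h1 : (2 ^ (a + m')).+1 <= 2 ^ z.+1.
  have : 2 ^ (a + m') <= 2 ^ z by rewrite leq_exp2l.
  by have : 0 < 2 ^ z; rewrite ?expn_gt0 // expnS; lia.
have h2 : N * (2 ^ (a + m')).+1 ^ d <= 2 ^ (z + z.+1 * d).
  rewrite (expnD 2 z) expnM leq_mul ?leq_expl //.
  by apply: ltnW; apply: leq_trans (ltn_expl z (erefl : 1 < 2)); lia.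
have h3 : a + m' <= 2 ^ (z + z.+1 * d).
  apply: leq_trans IH _; apply: ltnW; apply: leq_trans (ltn_expl z (erefl : 1 < 2)) _.
  by rewrite leq_exp2l // leq_addr.
apply: (@leq_trans (2 ^ (z + z.+1 * d).+1)); first by rewrite expnS; lia.
rewrite leq_exp2l //; apply: (@leq_trans ((d + 2) * z)); last by rewrite leq_mul2r le2 orbT.
by rewrite mulnDl mulSn [z * d]mulnC; lia.
Qed.

Lemma decide_correct I : wf_instance I -> decide (enc_instance I) <-> lossy_reach I.
Proof.
move=> wf; have sw := size_w I.
set w := enc_instance I in sw *.
(* The part of the word left after the unary numbers and the section marks bounds the length of
   every numeral, so [2 ^ m'] bounds every entry, while [nQ I + m'] still stays below the length of
   the word. *)
pose m' := size w - (nQ I + abdim I + 8).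
have hmax k : 2 ^ m' * 2 ^ max_height (nQ I) (abdim I) (2 ^ m') k <= height (size w).+1 k.+1.
  have h : max_height (nQ I) (abdim I) (2 ^ m') k + m' <= height (size w).+1 k.
    by apply: max_height_le; rewrite /m'; lia.
  rewrite -expnD addnC heightS leq_exp2l //; apply: leq_trans h _.
  by rewrite leq_pmull.
have eB : capB w = height (size w).+1 (abdim I) by rewrite capBE sec1 size_nseq.
have hB k : k < abdim I -> 2 ^ m' * 2 ^ max_height (nQ I) (abdim I) (2 ^ m') k <= capB w.
  by move=> lt; apply: leq_trans (hmax k) _; rewrite eB height_mono.
apply: (@answer_correct I (capB w) (2 ^ m')) => //.
- by move=> d0; apply: leq_trans (hB 0 d0); rewrite leq_pmulr // expn_gt0.
- move=> r z hr hz; apply: leq_trans (tok_size z) _; rewrite leq_exp2l // /m'.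
  by have := size_w_rule hr hz; rewrite -/w; lia.
Qed.

Lemma exp_iterS d m : exp_iter d.+1 m = 2 ^ exp_iter d m.
Proof. by []. Qed.

Lemma exp_iter_mono d m m' : m <= m' -> exp_iter d m <= exp_iter d m'.
Proof. by move=> le; elim: d => // d IH; rewrite !exp_iterS leq_exp2l. Qed.

(** Moving a factor [n ^ a] one level inwards turns it into [n ^ a.+1], by [n ^ a * 2 ^ (n * z) <= 2
    ^ (n * (a + z)) <= 2 ^ (n ^ a.+1 * z)]. All factors thus end up in the innermost polynomial, and
    no further exponential arises. *)
Lemma height_exp_iter n a k : 2 <= n -> n ^ a * height n k <= exp_iter k (n ^ (a + k).+1).
Proof.
move=> n2; elim: k a => [|k IH] a; first by rewrite addn0 expnS mulnC.
rewrite heightS exp_iterS addnS -addSn.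
have h1 : n ^ a <= 2 ^ (n * a) by rewrite expnM leq_expl // ltnW // ltn_expl.
apply: leq_trans (leq_mul h1 (leqnn _)) _; rewrite -expnD leq_exp2l //.
apply: leq_trans (IH a.+1); rewrite -mulnDr expnS -mulnA leq_mul2l; apply/orP; right.
have z1 : 0 < height n k by apply: leq_trans (height_ge k (ltnW n2)); apply: ltnW.
have ha : a < n ^ a by apply: ltn_expl.
move: (height n k) (n ^ a) z1 ha => z u z1 ha.
by apply: (@leq_trans (a.+1 * z)); [nia | rewrite leq_mul2r ha orbT].
Qed.

(** The exponent [2 * (d + 4) * K] of the cap depends on [d], but [d] is at most the length of the
    word. For positive [d] it therefore enters the topmost exponent as a polynomial factor, and
    [height_exp_iter] carries it inwards; for [d = 0] it is the degree [8 * K]. *)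
Lemma time_bound s d K : d + 8 <= s ->
  (s + height s.+1 d + vecs_bound (height s.+1 d) d + 2) ^ K <= exp_iter d (s.+1 ^ (8 * K + 3 + d)).
Proof.
move=> le; set n := s.+1.
have n2 : 2 <= n by rewrite /n; lia.
set B := height n d; have nB : n <= B by apply: height_ge.
have h1 : s + B + vecs_bound B d + 2 <= B ^ (2 * (d + 4)).
  have hX : B.+1 <= B ^ 2 by rewrite expnS expn1; nia.
  rewrite expnM; apply: leq_trans (leq_expl (d + 4) hX); rewrite /vecs_bound.
  have X4 : 4 <= B.+1 by lia.
  have hd : d <= B.+1 by lia.
  rewrite expnD; have : 0 < B.+1 ^ d by rewrite expn_gt0.
  have -> : 2 * B + 2 = 2 * B.+1 by lia.
  have hs : s + B + 3 <= 2 * B.+1 + 1 by lia.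
  move: (B.+1) (B.+1 ^ d) X4 hd hs => X u X4 hd hs u0.
  have e1 : u * (d * (2 * X) + 2) <= u * (X * (2 * X) + 2) by rewrite leq_mul2l leq_add2r leq_mul2r hd !orbT.
  have e2 : X * (2 * X) + 2 + 2 * X + 1 <= X ^ 4 by rewrite !expnS expn0; nia.
  apply: (@leq_trans (u * (X * (2 * X) + 2) + (2 * X + 1))); first by lia.
  apply: leq_trans (leq_mul (leqnn u) e2).
  by nia.
apply: leq_trans (leq_expl K h1) _; rewrite -expnM.
have hK : 2 * K <= n ^ (2 * K) by apply: ltnW; apply: ltn_expl.
rewrite /B; case: d le {B nB h1} => [|d] le.
  by rewrite /height /exp_iter /= leq_exp2l //; lia.
rewrite heightS exp_iterS -expnM leq_exp2l //.
have h2 : 2 * (d.+1 + 4) * K <= n ^ (2 * K + 1).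
  rewrite expnD expn1 (_ : 2 * (d.+1 + 4) * K = 2 * K * (d.+1 + 4)); last by nia.
  by rewrite leq_mul // /n; lia.
apply: (@leq_trans (n ^ (2 * K + 2) * height n d)).
  rewrite mulnAC leq_mul2r; apply/orP; right.
  by apply: leq_trans (leq_mul (leqnn n) h2) _; rewrite -expnS leq_exp2l //; lia.
apply: leq_trans (height_exp_iter _ _ n2) (exp_iter_mono _ _).
by rewrite leq_exp2l //; lia.
Qed.

Lemma tower_ge m : m <= tower m.
Proof.
by elim: m => // m IH /=; apply: leq_trans (ltn_expl m (erefl : 1 < 2)) _; rewrite leq_exp2l.
Qed.

Lemma tower_mono m m' : m <= m' -> tower m <= tower m'.
Proof.
elim: m' => [|m' IH]; first by rewrite leqn0 => /eqP->.
rewrite leq_eqVlt => /orP[/eqP->//|]; rewrite ltnS => /IH le; apply: leq_trans le _ => /=.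
exact: ltnW (ltn_expl _ _).
Qed.

Lemma exp_iter_tower d m : exp_iter d m <= tower (d + m).
Proof. by elim: d => [|d IH]; [apply: tower_ge | rewrite exp_iterS addSn /= leq_exp2l]. Qed.

Lemma peval_monomial c e s : peval (rcons (nseq e 0) c) s = c * s ^ e.
Proof.
rewrite /peval size_rcons size_nseq big_ord_recr /= big1 ?add0n.
  by rewrite nth_rcons size_nseq ltnn eqxx.
by move=> i _; rewrite nth_rcons size_nseq ltn_ord nth_nseq ltn_ord.
Qed.

(** Since [s.+1 <= 2 * s] for positive [s], a single monomial suffices. *)
Lemma peval_ge e s : 0 < s -> s.+1 ^ e <= peval (rcons (nseq e 0) (2 ^ e)) s.
Proof. by move=> s0; rewrite peval_monomial -expnMn leq_expl //; lia. Qed.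

Fixpoint const_eterm c := if c is c'.+1 then EAdd EOne (const_eterm c') else EMonus EOne EOne.

Lemma const_etermE c x : eeval (const_eterm c) x = c.
Proof. by elim: c => //= c ->. Qed.

Lemma elementary_bound c : elementary (fun s => s + s.+1 ^ (c + s)).
Proof.
(* Inside the product, index 0 is the running variable and [EProj 1] is [s]. *)
exists (EAdd (EProj 0) (EProd (EAdd (EProj 1) EOne) (EAdd (const_eterm c) (EProj 0)))) => s /=.
by rewrite const_etermE prod_nat_const_nat subn0 addn1.
Qed.

(** One machine and one [K] serve all dimensions, and only the bounding function varies; the bound
    by a tower relies on this uniformity. *)
Lemma lossy_reach_time : exists (M : TM) K, forall I, wf_instance I -> forall T : nat -> nat,
  exp_iter (abdim I) ((size (enc_instance I)).+1 ^ (8 * K + 3 + abdim I)) <= T (size (enc_instance I)) ->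
  decides_within M T (enc_instance I) (lossy_reach I).
Proof.
have [M [K hM]] := tm_decide; exists M, K => I wf T leT.
have [t [le [h1 h2]]] := hM _ (letters_w I).
exists t; split; last by rewrite /= h2 decide_correct.
apply: leq_trans le (leq_trans _ leT).
rewrite capBE sec1 size_nseq; apply: time_bound.
by have := size_w I; lia.
Qed.

Theorem theorem5p3 :
  (* lossy reachability in ABVASS_0 is in TOWER *)
  (exists e : nat -> nat, elementary e /\
     exists M : TM, forall I : instance, wf_instance I ->
       decides_within M (fun n => tower (e n)) (enc_instance I) (lossy_reach I))
  /\
  (* fixed dimension d: PTIME if d = 0, d-EXPTIME if d >= 1 *)
  (forall d : nat,
     (d = 0 ->
        exists (p : seq nat) (M : TM), forall I : instance, wf_instance I -> abdim I = d ->
          decides_within M (fun n => peval p n) (enc_instance I) (lossy_reach I))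
     /\
     (1 <= d ->
        exists (p : seq nat) (M : TM), forall I : instance, wf_instance I -> abdim I = d ->
          decides_within M (fun n => exp_iter d (peval p n)) (enc_instance I) (lossy_reach I))).
Proof.
have [M [K hM]] := lossy_reach_time; split.
  (* The first summand pays for the exponentials, whose number is the dimension and hence at most
     [s], as the dimension is written in unary; [exp_iter_tower] then gives the tower. *)
  exists (fun s => s + s.+1 ^ (8 * K + 3 + s)); split; first exact: elementary_bound.
  exists M => I wf; apply: hM => //; apply: leq_trans (exp_iter_tower _ _) (tower_mono _).
  have := size_w I; set s := size _ => le.
  by rewrite leq_add ?leq_exp2l //; lia.
have hpoly I d : abdim I = d -> wf_instance I ->
    decides_within M (fun n => exp_iter d (peval (rcons (nseq (8 * K + 3 + d) 0) (2 ^ (8 * K + 3 + d))) n))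
      (enc_instance I) (lossy_reach I).
  move=> ed wf; apply: hM => //; rewrite ed; apply: exp_iter_mono; apply: peval_ge.
  by have := size_w I; lia.
move=> d; split=> [d0|_]; exists (rcons (nseq (8 * K + 3 + d) 0) (2 ^ (8 * K + 3 + d))), M => I wf ed.
  by have := hpoly I d ed wf; rewrite {1}d0.
exact: hpoly.
Qed.
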